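(* Let $1 \leq p < \infty$, let $\phi$ be analytic on $\mathbb{D}$ and let $\varphi$ be an analytic self-map of $\mathbb{D}$. Suppose that $W_{\phi,\varphi}\colon S^p \to S^p$ is bounded. If $m(E_\varphi)>0$, where $E_\varphi=\{\zeta\in\partial\mathbb{D}: |\varphi(\zeta)|=1\}$, and $\phi\varphi'$ is not identically zero, then $W_{\phi,\varphi}$ fixes an isomorphic copy of $\ell^2$ in $S^p$.
   Context: $\mathbb{D}$ is the open unit disk, $m$ the normalized Lebesgue measure on $\partial\mathbb{D}$, and $\varphi(\zeta)$ for $\zeta\in\partial\mathbb{D}$ denotes the radial limit of $\varphi$ (which exists for $m$-almost every $\zeta$). For $0<p<\infty$, $H^p$ is the Hardy space of analytic $f$ on $\mathbb{D}$ with $\|f\|_{H^p}=\sup_{0\le r<1}\left(\int_{\partial\mathbb{D}}|f(r\xi)|^p\,dm(\xi)\right)^{1/p}<\infty$. The derivative Hardy space is $S^p=\{f \text{ analytic on } \mathbb{D}: \|f\|_{S^p}:=|f(0)|+\|f'\|_{H^p}<\infty\}$. The weighted composition operator is $W_{\phi,\varphi}f=\phi\cdot(f\circ\varphi)$. A bounded operator $T\colon X\to Y$ fixes a copy of a Banach space $E$ if there is a closed subspace $M\subset X$ linearly isomorphic to $E$ such that $T|_M$ is an isomorphism from $M$ onto $T(M)$. *)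

(* Defs.v *)
(* Complex numbers are R[i] (mathcomp
   real_closed), R : realType; R[i]^o is R[i] seen as a normed module over
   itself, so that [derivable f z 1] / [derive1 f z] are COMPLEX derivatives. *)
From HB Require Import structures.
From mathcomp Require Import all_boot all_order all_algebra.
From mathcomp Require Import all_classical all_reals all_analysis.
From mathcomp Require Import complex.
Set Implicit Arguments. Unset Strict Implicit. Unset Printing Implicit Defensive.
Import Order.TTheory GRing.Theory Num.Theory numFieldNormedType.Exports.
Local Open Scope classical_set_scope.
Local Open Scope ring_scope.

Notation Cc R := ((R[i])^o).

Section HardyDefs.
Variable R : realType.

Definition cabs (z : Cc R) : R := ComplexField.Normc.normc z.

Definition disk : set (Cc R) := [set z | cabs z < 1].

Definition analytic_on_disk (f : Cc R -> Cc R) : Prop :=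
  forall z, disk z -> derivable f z 1.

Definition self_map_disk (f : Cc R -> Cc R) : Prop :=
  forall z, disk z -> disk (f z).

Definition eit (t : R) : Cc R := Complex (cos t) (sin t).

Definition polar (r t : R) : Cc R := (r%:C * eit t)%C.

Definition int_mean (p : R) (f : Cc R -> Cc R) (r : R) : \bar R :=
  (((2 * pi)^-1)%:E *
   \int[lebesgue_measure]_(t in `[0%R, (2 * pi)%R]) ((cabs (f (polar r t))) `^ p)%:E)%E.

Definition Hp_pow (p : R) (f : Cc R -> Cc R) : \bar R :=
  ereal_sup [set int_mean p f r | r in `[0%R, 1%R[].

Definition in_Hp (p : R) (f : Cc R -> Cc R) : Prop :=
  analytic_on_disk f /\ (Hp_pow p f < +oo)%E.

Definition Hp_norm (p : R) (f : Cc R -> Cc R) : R :=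
  (fine (Hp_pow p f)) `^ p^-1.

Definition in_Sp (p : R) (f : Cc R -> Cc R) : Prop :=
  analytic_on_disk f /\ in_Hp p (derive1 f).

Definition Sp_norm (p : R) (f : Cc R -> Cc R) : R :=
  cabs (f 0) + Hp_norm p (derive1 f).

Definition wcomp (phi vphi : Cc R -> Cc R) (f : Cc R -> Cc R) : Cc R -> Cc R :=
  fun z => phi z * f (vphi z).

Definition bounded_on_Sp (p : R) (T : (Cc R -> Cc R) -> (Cc R -> Cc R)) : Prop :=
  (forall f, in_Sp p f -> in_Sp p (T f)) /\
  exists c : R, forall f, in_Sp p f -> Sp_norm p (T f) <= c * Sp_norm p f.

Definition in_l2 (x : nat -> Cc R) : Prop :=
  (\sum_(0 <= k <oo) ((cabs (x k)) ^+ 2)%:E < +oo)%E.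

Definition l2_norm (x : nat -> Cc R) : R :=
  Num.sqrt (fine (\sum_(0 <= k <oo) ((cabs (x k)) ^+ 2)%:E)%E).

(* T fixes a copy of ell^2 in S^p: there is a closed subspace M of S^p,
   linearly isomorphic to ell^2 (via J), such that T restricted to M is an
   isomorphism onto T(M).  Elements of S^p are functions on the disk, so two
   functions agreeing on the disk are the same element; closedness of M is
   stated up to this identification. *)
Definition fixes_copy_of_l2 (p : R) (T : (Cc R -> Cc R) -> (Cc R -> Cc R)) : Prop :=
  exists (M : set (Cc R -> Cc R)) (J : (nat -> Cc R) -> (Cc R -> Cc R)),
    [/\
        (forall f, M f -> in_Sp p f),
        (forall f g (a b : Cc R), M f -> M g -> M (fun z => a * f z + b * g z)),
        (forall (u : nat -> (Cc R -> Cc R)) g, (forall n, M (u n)) -> in_Sp p g ->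
           (fun n => Sp_norm p (fun z => u n z - g z)) @ \oo --> (0 : R) ->
           exists2 h, M h & forall z, disk z -> h z = g z),
        [/\ (forall x, in_l2 x -> M (J x)),
            (forall f, M f -> exists2 x, in_l2 x & J x = f),
            (forall x y, in_l2 x -> in_l2 y -> J x = J y -> x = y),
            (forall x y (a b : Cc R), in_l2 x -> in_l2 y ->
               J (fun k => a * x k + b * y k) = (fun z => a * J x z + b * J y z)) &
            exists a b : R, 0 < a /\ 0 < b /\
              forall x, in_l2 x -> a * l2_norm x <= Sp_norm p (J x) /\
                                   Sp_norm p (J x) <= b * l2_norm x] &
        exists2 c : R, 0 < c & forall f, M f -> c * Sp_norm p f <= Sp_norm p (T f)].

(* E_phi = { zeta in dD : |phi(zeta)| = 1 }, parametrised by t in [0, 2pi),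
   zeta = e^{it}, phi(zeta) the radial limit *)
Definition E_set (vphi : Cc R -> Cc R) : set R :=
  [set t | (0 <= t < 2 * pi) /\
     exists w : Cc R, (fun r : R => vphi (polar r t)) @ at_left 1 --> w /\ cabs w = 1].

End HardyDefs.

(* Main.v *)
Require Import Defs.
From HB Require Import structures.
From mathcomp Require Import all_boot all_order all_algebra.
From mathcomp Require Import all_classical all_reals all_analysis.
From mathcomp Require Import measurable_realfun complex.
From mathcomp Require Import ring lra zify.
Set Implicit Arguments. Unset Strict Implicit. Unset Printing Implicit Defensive.
Import Order.TTheory GRing.Theory Num.Theory numFieldNormedType.Exports.
Local Open Scope classical_set_scope.
Local Open Scope ring_scope.
Local Notation Re := complex.Re.
Local Notation Im := complex.Im.

(* Let h = phi * vphi' and Jx = sum_k x_k z^(N_k+1) / (N_k+1) for a lacunary sequence N, so that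
   (T Jx)' = phi' * (Jx o vphi) + h * (g o vphi) with g = sum_k x_k z^(N_k).  The norm of Jx in S^p
   is at most K |x|_2 because lacunary sums have comparable L^q norms for all finite q (proved by an
   exponential-moment estimate for Riesz products).

   For the lower bound, Egorov's theorem gives a set A of positive measure on which |vphi| -> 1
   uniformly along radii r_n -> 1, and Jensen's inequality bounds the masses of the weights
   w_n = 1_A |h(r_n .)|^p below.  Along an ultrafilter in n, the integrals of w_n vphi^k are small for
   all large k: otherwise a lacunary set of bad exponents would violate a Bessel-type inequality coming
   from the boundedness of T.  Hence, for sparse N, the powers vphi^(N_k) are almost orthogonal for
   w_n, which bounds the integral of w_n |g o vphi|^2 below by a multiple of |x|_2^2.  The integral of
   w_n |g o vphi|^(3p) is bounded above, by boundedness of T applied to a primitive of g^3; so the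
   integral of w_n |g o vphi|^p is bounded below as well.  Finally phi' * (Jx o vphi) is negligible if
   N_0 is large, since |Jx| <= 2 |x|_2 / N_0 on the disk.

   Since no Minkowski inequality is used, S^p norms are only estimated by the quasi-triangle
   inequality, with constant 4. *)

(** * Complex differentiability *)

Arguments cabs {R} z : simpl never.
Arguments polar {R} r t : simpl never.
Section ComplexBasics.
Variable R : realType.
Implicit Types (z w c : Cc R) (f g : Cc R -> Cc R).

(** All integrals live on circles of radius [crad n] inside the disk, and the ultrafilter stands in
    for a weak limit of the measures with density [wt n]: finitely many conditions, each true along
    it, hold together at a single [n]. This is all that a finite sum requires, provided that the
    constants depend neither on [n] nor on the length of the sum. Only correlations with nonnegative
    powers have to be controlled, because v^a conj(v)^b is close to v^(a-b), for b <= a, where |v|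
    is close to 1. The main obstacle is the exponent. Almost orthogonality is a statement about
    squares, whereas boundedness of T controls p-th powers, so for p < 2 a moment of order above 2
    must be bounded uniformly. The cube is the smallest power that works for all p >= 1: the square
    would give order 2p, which leaves no room for interpolation when p = 1. The order of choices
    matters as well: the lower bound for h (g o vphi) has to be independent of the first exponent,
    since this exponent is enlarged afterwards to absorb the term with phi'. *)

Lemma cabs_ge0 z : 0 <= cabs z.
Proof. by case: z => a b; rewrite /cabs /= sqrtr_ge0. Qed.

Lemma cabs0 : cabs (0 : Cc R) = 0.
Proof. exact: ComplexField.Normc.normc0. Qed.

Lemma cabs1 : cabs (1 : Cc R) = 1.
Proof. exact: ComplexField.Normc.normc1. Qed.

Lemma cabs_eq0 z : cabs z = 0 -> z = 0.
Proof. exact: ComplexField.Normc.eq0_normc. Qed.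

Lemma cabs_gt0 z : (0 < cabs z) = (z != 0).
Proof.
rewrite lt_def cabs_ge0 andbT; congr (~~ _).
by apply/eqP/eqP => [/cabs_eq0 //|->]; rewrite cabs0.
Qed.

Lemma cabsM z w : cabs (z * w) = cabs z * cabs w.
Proof. exact: ComplexField.Normc.normcM. Qed.

Lemma cabsV z : cabs z^-1 = (cabs z)^-1.
Proof. exact: ComplexField.Normc.normcV. Qed.

Lemma cabsX z n : cabs (z ^+ n) = cabs z ^+ n.
Proof. by elim: n => [|n IH]; rewrite ?expr0 ?cabs1 // !exprS cabsM IH. Qed.

Lemma cabsN z : cabs (- z) = cabs z.
Proof. exact: normcN. Qed.

Lemma cabsD z w : cabs (z + w) <= cabs z + cabs w.
Proof. exact: le_normcD. Qed.

Lemma cabsB z w : cabs (z - w) = cabs (w - z).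
Proof. by rewrite -cabsN opprB. Qed.

Lemma cabsBD z w : cabs (z - w) <= cabs z + cabs w.
Proof. by rewrite (le_trans (cabsD _ _))// cabsN. Qed.

Lemma cabsB_ge z w : cabs z - cabs w <= cabs (z - w).
Proof. by rewrite lerBlDr (le_trans _ (cabsD _ _)) // subrK. Qed.

Lemma cabs_RC (x : R) : cabs (x%:C)%C = `|x|.
Proof. by rewrite /cabs /= expr0n /= addr0 sqrtr_sqr. Qed.

Lemma cabs_sum (I : Type) (r : seq I) (P : pred I) (F : I -> Cc R) :
  cabs (\sum_(i <- r | P i) F i) <= \sum_(i <- r | P i) cabs (F i).
Proof.
elim/big_rec2: _ => [|i x y _ H]; first by rewrite cabs0.
by rewrite (le_trans (cabsD _ _)) // lerD2l.
Qed.

Lemma cabs_prod (I : Type) (r : seq I) (P : pred I) (F : I -> Cc R) :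
  cabs (\prod_(i <- r | P i) F i) = \prod_(i <- r | P i) cabs (F i).
Proof. by elim/big_rec2: _ => [|i x y _ H]; rewrite ?cabs1 // cabsM H. Qed.

Lemma Re_le z : `|Re z| <= cabs z.
Proof.
case: z => a b; rewrite /cabs /= -sqrtr_sqr ler_wsqrtr // lerDl sqr_ge0 //.
Qed.

Lemma Im_le z : `|Im z| <= cabs z.
Proof.
case: z => a b; rewrite /cabs /= -sqrtr_sqr ler_wsqrtr // lerDr sqr_ge0 //.
Qed.

Lemma cabs_le z : cabs z <= `|Re z| + `|Im z|.
Proof.
case: z => a b; rewrite /cabs /= -[leRHS]ger0_norm ?addr_ge0 // -sqrtr_sqr.
rewrite ler_wsqrtr // sqrrD !real_normK ?num_real //.
have : 0 <= `|a| * `|b| by rewrite mulr_ge0.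
lra.
Qed.

Lemma sqr_cabs z : cabs z ^+ 2 = Re z ^+ 2 + Im z ^+ 2.
Proof. by case: z => a b; rewrite /cabs /= sqr_sqrtr // addr_ge0 // sqr_ge0. Qed.

Lemma normE (z : R[i]) : `|z| = ((cabs z)%:C)%C.
Proof. by rewrite normc_def; case: z. Qed.

Lemma cReD z w : Re (z + w) = Re z + Re w. Proof. by case: z w => [a b] [c d]. Qed.
Lemma cImD z w : Im (z + w) = Im z + Im w. Proof. by case: z w => [a b] [c d]. Qed.
Lemma cReN z : Re (- z) = - Re z. Proof. by case: z. Qed.
Lemma cImN z : Im (- z) = - Im z. Proof. by case: z. Qed.
Lemma cReB z w : Re (z - w) = Re z - Re w. Proof. by rewrite cReD cReN. Qed.
Lemma cImB z w : Im (z - w) = Im z - Im w. Proof. by rewrite cImD cImN. Qed.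
Lemma cReM z w : Re (z * w) = Re z * Re w - Im z * Im w.
Proof. by case: z w => [a b] [c d]. Qed.
Lemma cImM z w : Im (z * w) = Re z * Im w + Im z * Re w.
Proof. by case: z w => [a b] [c d]. Qed.

Lemma complex_ext z w : Re z = Re w -> Im z = Im w -> z = w.
Proof. by case: z w => [a b] [c d] /= -> ->. Qed.

(** The norm of [R[i]] takes its values in [R[i]], so the radius of a ball is a complex number;
    being positive forces its imaginary part to be 0, which permits the passage to real radii. *)
Lemma cnbhsP z (P : set (Cc R)) :
  nbhs z P <-> exists2 e : R, 0 < e & forall w, cabs (w - z) < e -> P w.
Proof.
split.
  move=> /nbhs_ballP[e /= e0 H].
  have [/= ei e0'] : Im e = 0 /\ 0 < Re e.
    by move: e0; rewrite ltcE /= => /andP[/eqP].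
  exists (Re e) => // w hw; apply: H; rewrite /ball /= distrC normE ltcE /=.
  by rewrite ei eqxx.
move=> [e e0 H]; apply/nbhs_ballP; exists (e%:C)%C; first by rewrite /= ltcR.
by move=> w; rewrite /ball /= distrC normE ltcR => /H.
Qed.

(** The first-order expansion instead of the difference quotient: w = 0 is not exceptional, and
    expansions can be added, composed and passed to the limit. *)
Definition cdiff f z c := forall e : R, 0 < e -> exists2 d : R, 0 < d &
  forall w, cabs w < d -> cabs (f (z + w) - f z - c * w) <= e * cabs w.

Lemma cdiff_is_derive f z c : cdiff f z c -> is_derive (z : Cc R) (1 : Cc R) f c.
Proof.
move=> H.
suff Hc : (fun h : Cc R => h^-1 *: (f (h *: (1 : Cc R) + z) - f z)) @ (0 : Cc R)^' --> c.
  split; last exact/cvg_lim.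
  by apply/cvg_ex; exists c.
move=> P /cnbhsP[e e0 HP].
have [d d0 Hd] := H (e / 2) (divr_gt0 e0 (ltr0n _ 2)).
apply/cnbhsP; exists d => // h; rewrite subr0 => hd h0; apply: HP => /=.
have {}Hd := Hd _ hd.
have -> : h^-1 *: (f (h *: (1 : Cc R) + z) - f z) - c = h^-1 * (f (z + h) - f z - c * h).
  rewrite mulrBr (mulrC c) mulrA mulVf // mul1r.
  by rewrite /GRing.scale /= mulr1 (addrC h).
have hp : 0 < cabs h by rewrite cabs_gt0.
rewrite cabsM cabsV mulrC ltr_pdivrMr // (le_lt_trans Hd) //.
by rewrite ltr_pM2r // gtr_pMr // invf_lt1 // ltr1n.
Qed.

Lemma is_derive_cdiff f z c : is_derive (z : Cc R) (1 : Cc R) f c -> cdiff f z c.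
Proof.
move=> [Hd Hc] e e0.
have /cvg_lim : (fun h : Cc R => h^-1 *: (f (h *: (1 : Cc R) + z) - f z)) @ (0 : Cc R)^' --> c.
  by rewrite -Hc; exact: Hd.
have : (fun h : Cc R => h^-1 *: (f (h *: (1 : Cc R) + z) - f z)) @ (0 : Cc R)^' --> c.
  by rewrite -Hc; exact: Hd.
move=> /(_ [set w | cabs (w - c) < e])[].
  by apply/cnbhsP; exists e.
move=> d' /= d0' Hd' _.
have /cnbhsP[d d0 {}Hd'] : nbhs (0 : Cc R) [set h : Cc R | h != 0 ->
   cabs (h^-1 *: (f (h *: (1 : Cc R) + z) - f z) - c) < e].
  by apply/nbhs_ballP; exists d' => // h /Hd'.
exists d => // w wd.
have [->|w0] := eqVneq w 0; first by rewrite addr0 mulr0 subrr subr0 cabs0 mulr0.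
have := Hd' w; rewrite subr0 => /(_ wd w0).
have -> : w^-1 *: (f (w *: (1 : Cc R) + z) - f z) - c = w^-1 * (f (z + w) - f z - c * w).
  rewrite mulrBr (mulrC c) mulrA mulVf // mul1r.
  by rewrite /GRing.scale /= mulr1 (addrC w).
have hp : 0 < cabs w by rewrite cabs_gt0.
by rewrite cabsM cabsV mulrC ltr_pdivrMr // => /ltW.
Qed.

Lemma is_derive_derivable f z c : is_derive (z : Cc R) (1 : Cc R) f c -> derivable f z 1.
Proof. by move=> [h _]. Qed.

Lemma is_derive_derive1 f z c : is_derive (z : Cc R) (1 : Cc R) f c -> derive1 f z = c.
Proof. by move=> [h <-]; rewrite derive1E. Qed.

Lemma derivable_is_derive f z : derivable f z 1 ->
  is_derive (z : Cc R) (1 : Cc R) f (derive1 f z).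
Proof. by move=> h; rewrite derive1E; exact: derivableP. Qed.

Lemma is_derive_comp f g z c d : is_derive (z : Cc R) (1 : Cc R) f c ->
  is_derive (f z) (1 : Cc R) g d -> is_derive z (1 : Cc R) (fun x => g (f x)) (d * c).
Proof.
move=> /is_derive_cdiff Hf /is_derive_cdiff Hg; apply: cdiff_is_derive => e e0.
have D0 : 0 < cabs d + cabs c + 2 by rewrite !ltr_wpDl ?cabs_ge0 ?addr_ge0 ?cabs_ge0.
pose e1 := Num.min (e / (cabs d + cabs c + 2)) 1.
have e10 : 0 < e1 by rewrite lt_min ltr01 andbT divr_gt0.
have e11 : e1 <= 1 by rewrite ge_min lexx orbT.
have e1e : e1 * (cabs d + cabs c + 2) <= e by rewrite -ler_pdivlMr // ge_min lexx.
have [d1 d10 H1] := Hf e1 e10; have [d2 d20 H2] := Hg e1 e10.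
have C1 : 0 < cabs c + 1 by rewrite ltr_wpDl ?cabs_ge0.
exists (Num.min d1 (d2 / (cabs c + 1))); first by rewrite lt_min d10 divr_gt0.
move=> w; rewrite lt_min => /andP[wd1 wd2].
have {H1} := H1 w wd1; set k := f (z + w) - f z => H1.
have hk : cabs k <= (cabs c + 1) * cabs w.
  rewrite -[k](subrK (c * w)) (le_trans (cabsD _ _)) // cabsM mulrDl mul1r addrC.
  by rewrite lerD2l (le_trans H1) // ler_piMl ?cabs_ge0.
have {H2} : cabs (g (f z + k) - g (f z) - d * k) <= e1 * cabs k.
  by apply: H2; rewrite (le_lt_trans hk) // mulrC -ltr_pdivlMr.
have -> : f z + k = f (z + w) by rewrite /k addrC subrK.
move=> H2.
have -> : g (f (z + w)) - g (f z) - d * c * w =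
   (g (f (z + w)) - g (f z) - d * k) + d * (k - c * w) by ring.
rewrite (le_trans (cabsD _ _)) // cabsM.
apply: (@le_trans _ _ (e1 * ((cabs c + 1) * cabs w) + cabs d * (e1 * cabs w))).
  by apply: lerD; [rewrite (le_trans H2)// ler_wpM2l // ltW|rewrite ler_wpM2l ?cabs_ge0].
have := cabs_ge0 w; have := cabs_ge0 d; have := cabs_ge0 c; have := ltW e10; nra.
Qed.

Lemma derivable_ceps f z : derivable f z 1 -> forall e : R, 0 < e ->
  exists2 d : R, 0 < d & forall w, cabs (w - z) < d -> cabs (f w - f z) < e.
Proof.
move=> /derivable_is_derive; set c := derive1 f z => /is_derive_cdiff /(_ 1 ltr01)[d d0 H] e e0.
have C1 : 0 < cabs c + 1 by rewrite ltr_wpDl ?cabs_ge0.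
exists (Num.min d (e / (cabs c + 1))); first by rewrite lt_min d0 divr_gt0.
move=> w; rewrite lt_min => /andP[wd we].
have {H} := H (w - z) wd; rewrite [z + _]addrC subrK => H.
rewrite -[f w - f z](subrK (c * (w - z))) (le_lt_trans (cabsD _ _)) // cabsM.
rewrite ltr_pdivlMr // in we; nra.
Qed.

End ComplexBasics.

(** * Integrals of bounded measurable functions *)

Section BoundedMeasurable.
Variable R : realType.
Implicit Types (a b c r : R) (f g : R -> R).
Notation mu := (@lebesgue_measure R).

(** Bounded measurable functions are stable under products and are integrable on a segment, so that
    integrability comes with the algebra of the integrands. *)
Definition bmeas a b f := measurable_fun `[a, b] f /\
  exists M : R, forall t, a <= t <= b -> `|f t| <= M.

Definition itg a b f : R := \int[mu]_(t in `[a, b]) f t.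

Lemma bmeas_integrable a b f : bmeas a b f -> mu.-integrable `[a, b] (EFin \o f).
Proof.
move=> [mf [M HM]]; apply: measurable_bounded_integrable => //.
  by rewrite /= lebesgue_measure_itv /=; case: ifP => // _; rewrite -EFinB ltry.
exists M; split; first exact: num_real.
move=> x Mx t /= ht; apply: le_trans (ltW Mx); apply: HM.
by move: ht; rewrite in_itv.
Qed.

Lemma bmeas_cont a b f : (forall t, a <= t <= b -> {for t, continuous f}) -> bmeas a b f.
Proof.
move=> cf.
have wc : {within `[a, b], continuous f}.
  apply/subspace_continuousP => t /=; rewrite in_itv /= => /cf h.
  by apply: cvg_within_filter.
split; first by apply: subspace_continuous_measurable_fun.
have [M [_ HM]] := compact_bounded (continuous_compact wc (@segment_compact _ a b)).
exists (M + 1) => t ht; apply: (HM (M + 1)); first by rewrite ltrDl.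
by exists t => //=; rewrite in_itv.
Qed.

Lemma bmeas_ext a b f g : (forall t, f t = g t) -> bmeas a b f -> bmeas a b g.
Proof. by move=> /funext <-. Qed.

Lemma bmeas_cst a b c : bmeas a b (fun=> c).
Proof. by split; [exact: measurable_cst|exists `|c|]. Qed.

Lemma bmeasD a b f g : bmeas a b f -> bmeas a b g -> bmeas a b (fun t => f t + g t).
Proof.
move=> [mf [M HM]] [mg [N HN]]; split; first exact: measurable_funD.
exists (M + N) => t ht.
by rewrite (le_trans (ler_normD _ _)) // lerD // ?HM ?HN.
Qed.

Lemma bmeasM a b f g : bmeas a b f -> bmeas a b g -> bmeas a b (fun t => f t * g t).
Proof.
move=> [mf [M HM]] [mg [N HN]]; split; first exact: measurable_funM.
exists (M * N) => t ht.
by rewrite normrM ler_pM // ?HM ?HN.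
Qed.

Lemma bmeasZ a b c f : bmeas a b f -> bmeas a b (fun t => c * f t).
Proof. by move=> h; apply: bmeasM => //; exact: bmeas_cst. Qed.

Lemma bmeasN a b f : bmeas a b f -> bmeas a b (fun t => - f t).
Proof.
move=> [mf [M HM]]; split; first exact: measurable_funN.
by exists M => t ht; rewrite normrN HM.
Qed.

Lemma bmeasB a b f g : bmeas a b f -> bmeas a b g -> bmeas a b (fun t => f t - g t).
Proof. by move=> hf hg; apply: bmeasD => //; exact: bmeasN. Qed.

Lemma bmeas_norm a b f : bmeas a b f -> bmeas a b (fun t => `|f t|).
Proof.
move=> [mf [M HM]]; split; first exact: measurableT_comp.
by exists M => t ht; rewrite normr_id HM.
Qed.

Lemma bmeas_powR a b f (p : R) : 0 <= p -> bmeas a b f -> bmeas a b (fun t => `|f t| `^ p).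
Proof.
move=> p0 hf; have [mf [M HM]] := bmeas_norm hf; split.
  exact: (measurableT_comp (measurable_powR p) mf).
exists (`|M| `^ p) => t ht; rewrite ger0_norm ?powR_ge0 // ge0_ler_powR // ?nnegrE //.
by rewrite -[X in X <= _]normr_id (le_trans (HM _ ht)) // ler_norm.
Qed.

Lemma bmeas_sum a b (I : Type) (r : seq I) (P : pred I) (F : I -> R -> R) :
  (forall i, P i -> bmeas a b (F i)) -> bmeas a b (fun t => \sum_(i <- r | P i) F i t).
Proof.
move=> H; elim: r => [|i r IH].
  by apply: bmeas_ext (bmeas_cst a b 0) => t; rewrite big_nil.
have [Pi|Pi] := boolP (P i).
  by apply: bmeas_ext (bmeasD (H i Pi) IH) => t; rewrite big_cons Pi.
by apply: bmeas_ext IH => t; rewrite big_cons (negbTE Pi).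
Qed.

Lemma bmeas_indic a b (A : set R) : measurable A -> bmeas a b (\1_A : R -> R).
Proof.
move=> mA; split; first exact: measurable_indic.
by exists 1 => t _; rewrite indicE; case: (_ \in _); rewrite ?normr1 ?normr0.
Qed.

Lemma itgD a b f g : bmeas a b f -> bmeas a b g ->
  itg a b (fun t => f t + g t) = itg a b f + itg a b g.
Proof. by move=> hf hg; rewrite /itg RintegralD //; exact: bmeas_integrable. Qed.

Lemma itgZ a b c f : bmeas a b f -> itg a b (fun t => c * f t) = c * itg a b f.
Proof. by move=> hf; rewrite /itg RintegralZl //; exact: bmeas_integrable. Qed.

Lemma itgN a b f : bmeas a b f -> itg a b (fun t => - f t) = - itg a b f.
Proof.
move=> hf; rewrite -mulN1r -itgZ //; congr itg; apply/funext => t.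
by rewrite mulN1r.
Qed.

Lemma itgB a b f g : bmeas a b f -> bmeas a b g ->
  itg a b (fun t => f t - g t) = itg a b f - itg a b g.
Proof. by move=> hf hg; rewrite itgD ?itgN //; exact: bmeasN. Qed.

Lemma itg_cst a b c : a <= b -> itg a b (fun=> c) = c * (b - a).
Proof.
move=> ab; rewrite /itg Rintegral_cst //= lebesgue_measure_itv /= lte_fin.
by move: ab; rewrite le_eqVlt => /predU1P[->|->]; rewrite ?ltxx ?subrr.
Qed.

Lemma itg_eq a b f g : (forall t, a <= t <= b -> f t = g t) -> itg a b f = itg a b g.
Proof. by move=> H; apply: eq_Rintegral => t; rewrite inE /= in_itv => /H. Qed.

Lemma itg_le a b f g : bmeas a b f -> bmeas a b g ->
  (forall t, a <= t <= b -> f t <= g t) -> itg a b f <= itg a b g.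
Proof.
by move=> hf hg H; apply: (le_Rintegral _ (bmeas_integrable hf) (bmeas_integrable hg)).
Qed.

Lemma itg_ge0 a b f : (forall t, a <= t <= b -> 0 <= f t) -> 0 <= itg a b f.
Proof. by move=> H; apply: Rintegral_ge0 => t /=; rewrite in_itv => /H. Qed.

Lemma itg_norm a b f : bmeas a b f -> `|itg a b f| <= itg a b (fun t => `|f t|).
Proof. by move=> hf; apply: le_normr_Rintegral => //; exact: bmeas_integrable. Qed.

Lemma itg_norm_le a b f (M : R) : a <= b -> bmeas a b f ->
  (forall t, a <= t <= b -> `|f t| <= M) -> `|itg a b f| <= M * (b - a).
Proof.
move=> ab hf H; apply: (le_trans (itg_norm hf)); rewrite -itg_cst //.
by apply: itg_le => //; [exact: bmeas_norm|exact: bmeas_cst].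
Qed.

Lemma itg_split a c b f : a <= c <= b -> bmeas a b f ->
  itg a b f = itg a c f + itg c b f.
Proof.
move=> /andP[ac cb] hf; have hi := bmeas_integrable hf.
have := @Rintegral_itvB _ f (BLeft a) (BRight b) c hi.
rewrite !bnd_simp => /(_ ac cb) H.
have -> : itg c b f = \int[mu]_(x in `]c, b]) f x.
  rewrite Rintegral_itv_obnd_cbnd //; apply: integrableS hi => //.
  by apply: subset_itvr; rewrite bnd_simp.
by rewrite -H /itg; lra.
Qed.

Lemma itg_FTC a b f F : a <= b ->
  (forall t, {for t, continuous f}) -> (forall t, is_derive t (1 : R) F (f t)) ->
  itg a b f = F b - F a.
Proof.
rewrite le_eqVlt => /predU1P[<- _ _|ab cf dF].
  by rewrite subrr /itg set_itv1 Rintegral_set1.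
have cF t : {for t, continuous F}.
  by apply: differentiable_continuous; apply/derivable1_diffP; case: (dF t).
rewrite /itg /Rintegral (@continuous_FTC2 _ f F a b ab) //.
- by apply: continuous_subspaceT => t; exact: cf.
- split; first by move=> x _; case: (dF x).
  + by apply: cvg_at_right_filter; exact: cF.
  + by apply: cvg_at_left_filter; exact: cF.
- by move=> x _; rewrite derive1E; case: (dF x).
Qed.

End BoundedMeasurable.

(** * Goursat's theorem on an annulus *)

Section Goursat.
Variable R : realType.
Implicit Types (P Q : R -> R -> R) (a b c d x y : R).

(** Total differentiability at the point (x, y), with partial derivatives p1 and p2. *)
Definition diff2 P x y (p1 p2 : R) := forall e : R, 0 < e -> exists2 d : R, 0 < d &
  forall x' y', `|x' - x| < d -> `|y' - y| < d ->
  `|P x' y' - P x y - p1 * (x' - x) - p2 * (y' - y)| <= e * (`|x' - x| + `|y' - y|).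

Lemma diff2_cont P x y p1 p2 : diff2 P x y p1 p2 -> forall e : R, 0 < e ->
  exists2 d : R, 0 < d & forall x' y', `|x' - x| < d -> `|y' - y| < d ->
    `|P x' y' - P x y| < e.
Proof.
move=> /(_ 1 ltr01)[d d0 H] e e0.
have D0 : 0 < `|p1| + `|p2| + 2 by rewrite ltr_wpDl.
exists (Num.min d (e / (`|p1| + `|p2| + 2))); first by rewrite lt_min d0 divr_gt0.
move=> x' y'; rewrite !lt_min => /andP[xd xe] /andP[yd ye].
have {}H := H _ _ xd yd.
have E : P x' y' - P x y = (P x' y' - P x y - p1 * (x' - x) - p2 * (y' - y))
  + (p1 * (x' - x) + p2 * (y' - y)) by lra.
rewrite E (le_lt_trans (ler_normD _ _)) //.
have H2 := ler_normD (p1 * (x' - x)) (p2 * (y' - y)).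
rewrite !normrM in H2.
rewrite !ltr_pdivlMr // in xe ye.
have := normr_ge0 p1; have := normr_ge0 p2.
have := normr_ge0 (x' - x); have := normr_ge0 (y' - y).
move: H H2 xe ye.
set u := `|x' - x|; set v := `|y' - y|; set s := `|p1|; set t := `|p2|.
set A := `| _ - _ |; set B := `| _ + _|.
move=> H H2 xe ye v0 u0 t0 s0.
apply: (@le_lt_trans _ _ ((s + 1) * u + (t + 1) * v)).
  by apply: (le_trans (lerD H H2)); rewrite le_eqVlt; apply/orP; left; apply/eqP; ring.
case: (leP u v) => uv.
  apply: (@le_lt_trans _ _ (v * (s + t + 2))) => //.
  rewrite (_ : v * (s + t + 2) = (s + 1) * v + (t + 1) * v); last by ring.
  by rewrite lerD2r ler_wpM2l // addr_ge0.
apply: (@le_lt_trans _ _ (u * (s + t + 2))) => //.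
rewrite (_ : u * (s + t + 2) = (s + 1) * u + (t + 1) * u); last by ring.
by rewrite lerD2l ler_wpM2l ?(ltW uv) // addr_ge0.
Qed.

Lemma diff2_contx P x y p1 p2 : diff2 P x y p1 p2 -> {for x, continuous (P^~ y)}.
Proof.
move=> H; apply/cvgrPdist_lt => e e0; have [d d0 Hd] := diff2_cont H e0.
near=> t; rewrite distrC; apply: Hd; last by rewrite subrr normr0.
by rewrite distrC; near: t; exact: (@cvgr_dist_lt _ _ _ (nbhs x) _ id x cvg_id d d0).
Unshelve. all: by end_near. Qed.

Lemma diff2_conty P x y p1 p2 : diff2 P x y p1 p2 -> {for y, continuous (P x)}.
Proof.
move=> H; apply/cvgrPdist_lt => e e0; have [d d0 Hd] := diff2_cont H e0.
near=> t; rewrite distrC; apply: Hd; first by rewrite subrr normr0.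
by rewrite distrC; near: t; exact: (@cvgr_dist_lt _ _ _ (nbhs y) _ id y cvg_id d d0).
Unshelve. all: by end_near. Qed.

(** The shared number [k] expresses dP/dy = dQ/dx: the form P dx + Q dy is closed at the point. *)
Definition closed_form P Q x y := exists p1 k q2, diff2 P x y p1 k /\ diff2 Q x y k q2.

(** The integral of P dx + Q dy along the boundary of the rectangle, counterclockwise. *)
Definition loop P Q a b c d :=
  itg a b (fun x => P x c - P x d) + itg c d (fun y => Q b y - Q a y).

Definition rect_closed P Q a b c d := forall x y, a <= x <= b -> c <= y <= d ->
  closed_form P Q x y.

Lemma rc_bmx P Q a b c d y : rect_closed P Q a b c d -> c <= y <= d -> bmeas a b (P^~ y).
Proof.
move=> H hy; apply: bmeas_cont => x hx.
by have [? [? [? [/diff2_contx]]]] := H x y hx hy.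
Qed.

Lemma rc_bmy P Q a b c d x : rect_closed P Q a b c d -> a <= x <= b -> bmeas c d (Q x).
Proof.
move=> H hx; apply: bmeas_cont => y hy.
by have [? [? [? [_ /diff2_conty]]]] := H x y hx hy.
Qed.

Lemma loop_splitx P Q a m b c d : a <= m <= b -> c <= d -> rect_closed P Q a b c d ->
  loop P Q a b c d = loop P Q a m c d + loop P Q m b c d.
Proof.
move=> /[dup] mm /andP[am mb] cd H; rewrite /loop (@itg_split _ a m b) //; last first.
  by apply: bmeasB; apply: (rc_bmx H); rewrite ?lexx ?cd.
have -> : itg c d (fun y => Q b y - Q a y) =
    itg c d (fun y => Q b y - Q m y) + itg c d (fun y => Q m y - Q a y).
  have ab := le_trans am mb.
  by rewrite !itgB; try (by apply: (rc_bmy H); rewrite ?lexx ?ab ?am ?mb); lra.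
by lra.
Qed.

Lemma loop_splity P Q a b c m d : a <= b -> c <= m <= d -> rect_closed P Q a b c d ->
  loop P Q a b c d = loop P Q a b c m + loop P Q a b m d.
Proof.
move=> ab /[dup] mm /andP[cm md] H; rewrite /loop (@itg_split _ c m d) //; last first.
  by apply: bmeasB; apply: (rc_bmy H); rewrite ?lexx ?ab.
have -> : itg a b (fun x => P x c - P x d) =
    itg a b (fun x => P x c - P x m) + itg a b (fun x => P x m - P x d).
  have cd := le_trans cm md.
  by rewrite !itgB; try (by apply: (rc_bmx H); rewrite ?lexx ?cd ?cm ?md); lra.
by lra.
Qed.

Lemma rect_closedS P Q a b c d a' b' c' d' : a <= a' -> b' <= b -> c <= c' -> d' <= d ->
  rect_closed P Q a b c d -> rect_closed P Q a' b' c' d'.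
Proof.
move=> aa bb cc dd H x y /andP[ax xb] /andP[cy yd]; apply: H.
  by rewrite (le_trans aa ax) (le_trans xb bb).
by rewrite (le_trans cc cy) (le_trans yd dd).
Qed.

(** The boundary integral is the sum of those of the four quarters; if all of these were below A/4
    in absolute value, the whole would be below A. *)
Lemma loop_quarter P Q a c w l (A : R) : 0 <= w -> 0 <= l ->
  rect_closed P Q a (a + w) c (c + l) -> A <= `|loop P Q a (a + w) c (c + l)| ->
  exists a' c', [/\ a <= a', a' + w / 2 <= a + w, c <= c', c' + l / 2 <= c + l &
    A / 4 <= `|loop P Q a' (a' + w / 2) c' (c' + l / 2)|].
Proof.
move=> w0 l0 H HA; apply: contrapT => N.
have N' a' c' : a <= a' -> a' + w / 2 <= a + w -> c <= c' -> c' + l / 2 <= c + l ->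
    `|loop P Q a' (a' + w / 2) c' (c' + l / 2)| < A / 4.
  move=> h1 h2 h3 h4; rewrite ltNge; apply/negP => h5; apply: N.
  by exists a', c'.
have h1 := N' a c; have h2 := N' (a + w / 2) c; have h3 := N' a (c + l / 2).
have h4 := N' (a + w / 2) (c + l / 2).
have ew : a + w / 2 + w / 2 = a + w by lra.
have el : c + l / 2 + l / 2 = c + l by lra.
rewrite ew in h2 h4; rewrite el in h3 h4.
move: HA.
have wa : a <= a + w / 2 <= a + w by clear -w0; lra.
have lc : c <= c + l / 2 <= c + l by clear -l0; lra.
have /andP[wa1 wa2] := wa; have /andP[lc1 lc2] := lc.
have cl := le_trans lc1 lc2; have lcc := lexx c; have lcl := lexx (c + l).
rewrite (@loop_splitx _ _ a (a + w / 2)) //.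
rewrite (@loop_splity _ _ a _ c (c + l / 2)) //; last exact: rect_closedS H.
rewrite (@loop_splity _ _ (a + w / 2) _ c (c + l / 2)) //; last exact: rect_closedS H.
rewrite leNgt => /negP; apply.
have {}h1 : `|loop P Q a (a + w / 2) c (c + l / 2)| < A / 4 by apply: h1.
have {}h2 : `|loop P Q (a + w / 2) (a + w) c (c + l / 2)| < A / 4 by apply: h2.
have {}h3 : `|loop P Q a (a + w / 2) (c + l / 2) (c + l)| < A / 4 by apply: h3.
have {}h4 : `|loop P Q (a + w / 2) (a + w) (c + l / 2) (c + l)| < A / 4 by apply: h4.
rewrite (le_lt_trans (ler_normD _ _)) //.
have k1 := ler_normD (loop P Q a (a + w / 2) c (c + l / 2)) (loop P Q a (a + w / 2) (c + l / 2) (c + l)).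
have k2 := ler_normD (loop P Q (a + w / 2) (a + w) c (c + l / 2)) (loop P Q (a + w / 2) (a + w) (c + l / 2) (c + l)).
clear -k1 k2 h1 h2 h3 h4; lra.
Qed.

(** The affine parts of P and Q at (x, y) contribute 0, the two terms in [k] cancelling by
    closedness. What is left is an error of at most e (w + l) on each side of the rectangle. *)
Lemma loop_small P Q x y : closed_form P Q x y -> forall e : R, 0 < e ->
  exists2 dl : R, 0 < dl & forall a w c l : R, 0 <= w -> 0 <= l ->
  w + l < dl -> a <= x <= a + w -> c <= y <= c + l ->
  rect_closed P Q a (a + w) c (c + l) ->
  `|loop P Q a (a + w) c (c + l)| <= 2 * e * (w + l) ^+ 2.
Proof.
move=> [p1 [k [q2 [HP HQ]]]] e e0.
have [d1 d10 {}HP] := HP e e0; have [d2 d20 {}HQ] := HQ e e0.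
exists (Num.min d1 d2) => [|a w c l w0 l0]; first by rewrite lt_min d10.
rewrite lt_min => /andP[wl1 wl2] hx hy H.
have Bx x' : a <= x' <= a + w -> `|x' - x| <= w by rewrite ler_distl; lra.
have By y' : c <= y' <= c + l -> `|y' - y| <= l by rewrite ler_distl; lra.
have {}HP x' y' : a <= x' <= a + w -> c <= y' <= c + l ->
  `|P x' y' - P x y - p1 * (x' - x) - k * (y' - y)| <= e * (w + l).
  move=> hx' hy'; have h1 := Bx _ hx'; have h2 := By _ hy'.
  apply: (le_trans (HP x' y' _ _)); [lra|lra|].
  by rewrite ler_wpM2l ?(ltW e0)// lerD.
have {}HQ x' y' : a <= x' <= a + w -> c <= y' <= c + l ->
  `|Q x' y' - Q x y - k * (x' - x) - q2 * (y' - y)| <= e * (w + l).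
  move=> hx' hy'; have h1 := Bx _ hx'; have h2 := By _ hy'.
  apply: (le_trans (HQ x' y' _ _)); [lra|lra|].
  by rewrite ler_wpM2l ?(ltW e0)// lerD.
have hc : c <= c <= c + l by lra.
have hd : c <= c + l <= c + l by lra.
have ha : a <= a <= a + w by lra.
have hb : a <= a + w <= a + w by lra.
have aw : a <= a + w by lra.
have cl : c <= c + l by lra.
have bP : bmeas a (a + w) (fun x => P x c - P x (c + l)).
  by apply: bmeasB; apply: (rc_bmx H).
have bQ : bmeas c (c + l) (fun y => Q (a + w) y - Q a y).
  by apply: bmeasB; apply: (rc_bmy H).
have h1 : `|itg a (a + w) (fun x' => P x' c - P x' (c + l) - k * (c - (c + l)))|
    <= 2 * (e * (w + l)) * (a + w - a).
  apply: itg_norm_le => //; first by apply: bmeasB => //; exact: bmeas_cst.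
  move=> t ht; have := HP t c ht hc; have := HP t (c + l) ht hd.
  by rewrite !ler_norml; lra.
have h2 : `|itg c (c + l) (fun y' => Q (a + w) y' - Q a y' - k * (a + w - a))|
    <= 2 * (e * (w + l)) * (c + l - c).
  apply: itg_norm_le => //; first by apply: bmeasB => //; exact: bmeas_cst.
  move=> t ht; have := HQ (a + w) t hb ht; have := HQ a t ha ht.
  by rewrite !ler_norml; lra.
rewrite itgB // in h1; last exact: bmeas_cst.
rewrite itgB // in h2; last exact: bmeas_cst.
rewrite !itg_cst // in h1 h2.
rewrite /loop; move: h1 h2; set I1 := itg _ _ _; set I2 := itg _ _ _.
move=> h1 h2; have -> : I1 + I2 = (I1 - k * (c - (c + l)) * (a + w - a)) +
   (I2 - k * (a + w - a) * (c + l - c)) by ring.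
apply: (le_trans (ler_normD _ _)).
apply: (le_trans (lerD h1 h2)).
by rewrite le_eqVlt; apply/orP; left; apply/eqP; ring.
Qed.

(* Goursat's subdivision argument: no continuity of the partial derivatives is assumed. *)
Lemma loop_eq0 P Q a b c d : a <= b -> c <= d -> rect_closed P Q a b c d ->
  loop P Q a b c d = 0.
Proof.
move=> ab cd H; apply/eqP/negP => /negP N.
pose w := b - a; pose l := d - c; pose A := `|loop P Q a b c d|.
have A0 : 0 < A by rewrite normr_gt0.
have w0 : 0 <= w by rewrite subr_ge0.
have l0 : 0 <= l by rewrite subr_ge0.
have ew : a + w = b by rewrite /w; lra.
have el : c + l = d by rewrite /l; lra.
pose W n : R := w / 2 ^+ n; pose L n : R := l / 2 ^+ n.
have W0 n : 0 <= W n by rewrite divr_ge0 // exprn_ge0.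
have L0 n : 0 <= L n by rewrite divr_ge0 // exprn_ge0.
have W1 n : W n.+1 = W n / 2 by rewrite /W exprSr; field; rewrite expf_neq0 // pnatr_eq0.
have L1 n : L n.+1 = L n / 2 by rewrite /L exprSr; field; rewrite expf_neq0 // pnatr_eq0.
pose good n (s : R * R) := [/\ a <= s.1, s.1 + W n <= b, c <= s.2, s.2 + L n <= d &
   A / 4 ^+ n <= `|loop P Q s.1 (s.1 + W n) s.2 (s.2 + L n)|].
have step n (s : R * R) : good n s -> exists s' : R * R, good n.+1 s' /\
   [/\ s.1 <= s'.1, s'.1 + W n.+1 <= s.1 + W n, s.2 <= s'.2 & s'.2 + L n.+1 <= s.2 + L n].
  move=> [h1 h2 h3 h4 h5].
  have [|a' [c' [k1 k2 k3 k4 k5]]] := loop_quarter (W0 n) (L0 n) _ h5.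
    exact: rect_closedS H.
  exists (a', c'); rewrite /good /= W1 L1; split; split => //; [exact: le_trans k1|exact: le_trans k2 h2|exact: le_trans k3|exact: le_trans k4 h4|].
  by rewrite exprSr invfM mulrA.
have [s0 Hs0] : {s0 : R * R | good 0%N s0}.
  exists (a, c); rewrite /good /= /W /L !expr0 !divr1 ew el; split => //; lra.
(* The default [s] of [xget] is never taken on a good rectangle, because [step] provides a
   witness. *)
pose next n (s : R * R) : R * R := xget s [set s' | good n.+1 s' /\
   [/\ s.1 <= s'.1, s'.1 + W n.+1 <= s.1 + W n, s.2 <= s'.2 & s'.2 + L n.+1 <= s.2 + L n]].
pose S := fix S n := if n is m.+1 then next m (S m) else s0.
have nextP n s : good n s -> good n.+1 (next n s) /\
   [/\ s.1 <= (next n s).1, (next n s).1 + W n.+1 <= s.1 + W n, s.2 <= (next n s).2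
     & (next n s).2 + L n.+1 <= s.2 + L n].
  by move=> /step[s' hs']; rewrite /next; case: xgetP => [y _ []|/(_ s')].
have Sg n : good n (S n) by elim: n => // n /nextP[].
have Sm n m : (n <= m)%N -> [/\ (S n).1 <= (S m).1, (S m).1 + W m <= (S n).1 + W n,
   (S n).2 <= (S m).2 & (S m).2 + L m <= (S n).2 + L n].
  elim: m => [|m IH]; first by rewrite leqn0 => /eqP ->.
  rewrite leq_eqVlt => /predU1P[->//|/IH[k1 k2 k3 k4]].
  have [_ [j1 j2 j3 j4]] := nextP m _ (Sg m).
  by split; [exact: le_trans k1 j1|exact: le_trans j2 k2|exact: le_trans k3 j3|exact: le_trans j4 k4].
have Sb n m : (S n).1 <= (S m).1 + W m /\ (S n).2 <= (S m).2 + L m.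
  have [h|/ltnW h] := leqP n m; have [k1 k2 k3 k4] := Sm _ _ h.
    by split; rewrite ler_wpDr.
  by have := W0 n; have := L0 n; split; lra.
have Xb m : ubound (range (fun n => (S n).1)) ((S m).1 + W m).
  by move=> _ [n _ <-]; have [] := Sb n m.
have Yb m : ubound (range (fun n => (S n).2)) ((S m).2 + L m).
  by move=> _ [n _ <-]; have [] := Sb n m.
pose x := sup (range (fun n => (S n).1)); pose y := sup (range (fun n => (S n).2)).
have hx n : (S n).1 <= x <= (S n).1 + W n.
  rewrite ub_le_sup /=; [|by exists ((S 0%N).1 + W 0%N); exact: Xb|by exists n].
  by apply: ge_sup; [exists (S 0%N).1; exists 0%N|exact: Xb].
have hy n : (S n).2 <= y <= (S n).2 + L n.
  rewrite ub_le_sup /=; [|by exists ((S 0%N).2 + L 0%N); exact: Yb|by exists n].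
  by apply: ge_sup; [exists (S 0%N).2; exists 0%N|exact: Yb].
have cf : closed_form P Q x y.
  have [h1 h2 h3 h4 _] := Sg 0%N; have := hx 0%N; have := hy 0%N.
  by move=> /andP[? ?] /andP[? ?]; apply: H; lra.
(* With this [e], the bound 2 e (w + l)^2 / 4^n of [loop_small] is at most half of A / 4^n, the
   lower bound kept by the subdivision. *)
pose e := A / (4 * (w + l + 1) ^+ 2).
have wl0 : 0 < (w + l + 1) ^+ 2 by rewrite exprn_gt0 // ltr_wpDl // addr_ge0.
have e0 : 0 < e by rewrite divr_gt0 // mulr_gt0.
have [dl dl0 Hd] := loop_small cf e0.
have [n Hn] : exists n, W n + L n < dl.
  have [n Hn] : exists n, (w + l) / dl < 2 ^+ n.
    exists (Num.Def.truncn ((w + l) / dl)).+1.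
    apply: (lt_trans (truncnS_gt _)); rewrite -natrX ltr_nat.
    exact: ltn_expl.
  exists n; rewrite /W /L -mulrDl ltr_pdivrMr ?exprn_gt0 //.
  by rewrite mulrC -ltr_pdivrMr.
have [h1 h2 h3 h4 h5] := Sg n.
have := Hd _ _ _ _ (W0 n) (L0 n) Hn (hx n) (hy n).
have rc : rect_closed P Q (S n).1 ((S n).1 + W n) (S n).2 ((S n).2 + L n).
  by apply: rect_closedS H.
move=> /(_ rc) /(le_trans h5).
rewrite /W /L -mulrDl expr_div_n -exprM mulnC exprM.
rewrite (_ : (2 ^+ 2 : R) = 4); last by rewrite -natrX.
rewrite [leRHS]mulrA.
rewrite ler_pM2r ?invr_gt0 ?exprn_gt0 //.
rewrite leNgt => /negP; apply.
have eX : e * (w + l + 1) ^+ 2 = A / 4 by rewrite /e; field; apply: lt0r_neq0; clear -w0 l0; lra.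
have : e * (w + l) ^+ 2 <= e * (w + l + 1) ^+ 2.
  rewrite ler_wpM2l ?(ltW e0) //.
  by apply: lerXn2r; rewrite ?nnegrE; clear -w0 l0; lra.
rewrite eX; rewrite -[2 * e * _]mulrA; move: A0 (e * _) => + e1; move: (A) => B; clear; lra.
Qed.

End Goursat.

(** * Complex exponential, complex-valued integrals and means over circles *)

Section CircleMeans.
Variable R : realType.
Implicit Types (z w c : Cc R) (f g : Cc R -> Cc R) (r s t : R).

Lemma cabs_dist z w : `|cabs z - cabs w| <= cabs (z - w).
Proof.
have := cabsB_ge z w; have := cabsB_ge w z.
by rewrite (cabsB w z) ler_norml; lra.
Qed.

Lemma is_derive_eps (f : R -> R) (x c : R) : is_derive x (1 : R) f c ->
  forall e : R, 0 < e -> exists2 d : R, 0 < d & forall h, `|h| < d ->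
    `|f (x + h) - f x - c * h| <= e * `|h|.
Proof.
move=> [Hd Hc] e e0.
have : (fun h : R => h^-1 *: (f (h *: (1 : R) + x) - f x)) @ (0 : R)^' --> c.
  by rewrite -Hc; exact: Hd.
move=> /(_ [set w | `|w - c| < e])[].
  by apply/nbhs_ballP; exists e => // w; rewrite /ball /= distrC.
move=> d /= d0 Hd'; exists d => // h hd.
have [->|h0] := eqVneq h 0; first by rewrite addr0 mulr0 subrr subr0 normr0 mulr0.
have := Hd' h; rewrite /= sub0r normrN => /(_ hd h0).
have -> : h^-1 *: (f (h *: (1 : R) + x) - f x) - c = h^-1 * (f (x + h) - f x - c * h).
  by rewrite /GRing.scale /= mulr1 (addrC h); field.
have hp : 0 < `|h| by rewrite normr_gt0.
by rewrite normrM normfV mulrC ltr_pdivrMr // => /ltW.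
Qed.

Lemma eitD t s : eit (t + s) = eit t * eit s.
Proof.
apply: complex_ext; rewrite ?cReM ?cImM /=; first by rewrite cosD.
by rewrite sinD addrC.
Qed.

Lemma eit0 : eit 0 = 1 :> Cc R.
Proof. by rewrite /eit cos0 sin0. Qed.

Lemma eit2pi : eit (2 * pi) = 1 :> Cc R.
Proof. by rewrite mulr_natl /eit -[pi *+ 2]add0r cosD2pi sinD2pi cos0 sin0. Qed.

Lemma cabs_eit t : cabs (eit t) = 1.
Proof. by rewrite /cabs /= cos2Dsin2 sqrtr1. Qed.

Lemma cabs_polar r t : cabs (polar r t) = `|r|.
Proof. by rewrite /polar cabsM cabs_RC cabs_eit mulr1. Qed.

Lemma polarM r s t t' : polar r t * polar s t' = polar (r * s) (t + t').
Proof. by rewrite /polar eitD rmorphM /=; ring. Qed.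

Lemma polarD2pi r t : polar r (t + 2 * pi) = polar r t.
Proof. by rewrite /polar eitD eit2pi mulr1. Qed.

Lemma disk_polar r t : 0 <= r < 1 -> disk (polar r t).
Proof. by move=> /andP[r0 r1]; rewrite /disk /= cabs_polar ger0_norm. Qed.

(** The complex exponential. In the coordinates (log of the radius, angle) an annulus becomes a
    rectangle, to which Goursat's theorem applies. *)
Definition cexp w : Cc R := polar (expR (Re w)) (Im w).

Lemma cexpD z w : cexp (z + w) = cexp z * cexp w.
Proof. by rewrite /cexp polarM cReD cImD expRD. Qed.

(** The addition law reduces the claim to z = 0, where it follows from the first-order expansions of
    exp, cos and sin at 0. *)
Lemma is_derive_cexp z : is_derive (z : Cc R) (1 : Cc R) cexp (cexp z).
Proof.
apply: cdiff_is_derive => e e0.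
have Z0 : 0 < cabs (cexp z) by rewrite cabs_polar normr_gt0 gt_eqF // expR_gt0.
suff [d d0 H] : exists2 d : R, 0 < d & forall w, cabs w < d ->
    cabs (cexp w - 1 - w) <= e / cabs (cexp z) * cabs w.
  exists d => // w /H wd; rewrite cexpD.
  have -> : cexp z * cexp w - cexp z - cexp z * w = cexp z * (cexp w - 1 - w) by ring.
  by rewrite cabsM mulrC -ler_pdivlMr // mulrAC.
have k0 : 0 < e / cabs (cexp z) by rewrite divr_gt0.
set k := e / _ in k0 *.
(* The errors below add up to at most 6 n |w|, so n <= k / 8 suffices; n <= 1 bounds expR x - 1 by 2
   |w|. *)
pose n := Num.min (k / 8) 1.
have n0 : 0 < n by rewrite lt_min ltr01 andbT divr_gt0.
have [nk n1] : n <= k / 8 /\ n <= 1 by rewrite !ge_min !lexx orbT.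
have [d1 d10 H1] := is_derive_eps (is_derive_expR 0) n0.
have [d2 d20 H2] := is_derive_eps (is_derive_cos 0) n0.
have [d3 d30 H3] := is_derive_eps (is_derive_sin 0) n0.
exists (Num.min (Num.min d1 d2) (Num.min d3 (n / 2))).
  by rewrite !lt_min d10 d20 d30 divr_gt0.
move=> w; rewrite !lt_min => /andP[/andP[wd1 wd2] /andP[wd3 wn]].
have xw := Re_le w; have yw := Im_le w.
move: xw yw wd1 wd2 wd3 wn; set x := Re w; set y := Im w; set a := cabs w.
move=> xw yw wd1 wd2 wd3 wn.
have {}H1 := H1 x (le_lt_trans xw wd1); have {}H2 := H2 y (le_lt_trans yw wd2).
have {}H3 := H3 y (le_lt_trans yw wd3).
rewrite add0r expR0 mul1r in H1; rewrite add0r cos0 sin0 oppr0 mul0r subr0 in H2.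
rewrite add0r sin0 subr0 cos0 mul1r in H3.
have a0 : 0 <= a := cabs_ge0 w.
have nx : n * `|x| <= n * a by rewrite ler_wpM2l // ltW.
have ny : n * `|y| <= n * a by rewrite ler_wpM2l // ltW.
have na : n * a <= a by rewrite ler_piMl.
have ex1 : `|expR x - 1| <= 2 * a.
  move: H1 xw; rewrite !ler_norml; lra.
have ex2 : expR x <= 2 by move: ex1; rewrite ler_norml; lra.
have ex0 := expR_ge0 x.
apply: (le_trans (cabs_le _)).
rewrite /cexp !cReB !cImB /= -/x -/y !mul0r subr0 addr0 subr0.
have -> : expR x * cos y - 1 - x = (expR x - 1 - x) + expR x * (cos y - 1) by ring.
have -> : expR x * sin y - y = expR x * (sin y - y) + (expR x - 1) * y by ring.
have e1 : `|expR x * (cos y - 1)| <= 2 * (n * a).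
  by rewrite normrM ger0_norm // ler_pM // (le_trans H2).
have e2 : `|expR x * (sin y - y)| <= 2 * (n * a).
  by rewrite normrM ger0_norm // ler_pM // (le_trans H3).
have e3 : `|(expR x - 1) * y| <= n * a.
  by rewrite normrM ler_pM //; apply: (le_trans ex1); lra.
apply: (le_trans (lerD (ler_normD _ _) (ler_normD _ _))).
have kn : 8 * n * a <= k * a by rewrite ler_wpM2r //; lra.
have na0 : 0 <= n * a by rewrite mulr_ge0 // ltW.
lra.
Qed.

(** The Cauchy-Riemann equations in the coordinates (log of the radius, angle); k1 + i k2 is the
    derivative of g o exp. *)
Lemma diff2_polar g s t : derivable g (polar (expR s) t) 1 -> exists k1 k2 : R,
  diff2 (fun s t => Re (g (polar (expR s) t))) s t k1 (- k2) /\
  diff2 (fun s t => Im (g (polar (expR s) t))) s t k2 k1.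
Proof.
move=> /derivable_is_derive; set c := derive1 _ _ => Hg.
have := is_derive_comp (is_derive_cexp (Complex s t)) Hg.
set d := c * _ => /is_derive_cdiff H.
have K (s' t' : R) : g (cexp (Complex s t + Complex (s' - s) (t' - t))) = g (polar (expR s') t').
  by rewrite /cexp cReD cImD /=; do 2 f_equal; [rewrite addrC subrK|rewrite addrC subrK].
have aux s' t' : cabs (Complex (s' - s) (t' - t) : Cc R) <= `|s' - s| + `|t' - t|.
  exact: cabs_le.
exists (Re d), (Im d); split => e e0; have [dl dl0 Hd] := H e e0;
  exists (dl / 2) => [|s' t' hs ht]; rewrite ?divr_gt0 //.
- have wd : cabs (Complex (s' - s) (t' - t) : Cc R) < dl by have := aux s' t'; lra.
  have {Hd} := Hd _ wd; rewrite K => Hd.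
  have := le_trans (Re_le _) Hd; rewrite !cReB cReM /= => Hr.
  rewrite -mulNr opprK in Hr || idtac.
  apply: (@le_trans _ _ (e * cabs (Complex (s' - s) (t' - t) : Cc R))); last first.
    by rewrite ler_wpM2l ?(ltW e0).
  by apply: le_trans Hr; rewrite le_eqVlt; apply/orP; left; apply/eqP; congr `|_|; rewrite /cexp /=; ring.
- have wd : cabs (Complex (s' - s) (t' - t) : Cc R) < dl by have := aux s' t'; lra.
  have {Hd} := Hd _ wd; rewrite K => Hd.
  have := le_trans (Im_le _) Hd; rewrite !cImB cImM /= => Hr.
  apply: (@le_trans _ _ (e * cabs (Complex (s' - s) (t' - t) : Cc R))); last first.
    by rewrite ler_wpM2l ?(ltW e0).
  by apply: le_trans Hr; rewrite le_eqVlt; apply/orP; left; apply/eqP; congr `|_|; rewrite /cexp /=; ring.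
Qed.

(** By Cauchy-Riemann the form Im g ds + Re g dt is closed on [ln r1, ln r2] x [0, 2 pi]. In its
    boundary integral the sides t = 0 and t = 2 pi cancel by periodicity, and the two others are the
    means in question. *)
Lemma circ_Re_const g r1 r2 : 0 < r1 <= r2 ->
  (forall z, r1 <= cabs z <= r2 -> derivable g z 1) ->
  itg 0 (2 * pi) (fun t => Re (g (polar r1 t))) = itg 0 (2 * pi) (fun t => Re (g (polar r2 t))).
Proof.
move=> /andP[r10 r12] H.
have r20 : 0 < r2 := lt_le_trans r10 r12.
have p0 : 0 <= 2 * pi :> R by rewrite mulr_ge0 // pi_ge0.
pose P s t := Im (g (polar (expR s) t)); pose Q s t := Re (g (polar (expR s) t)).
have rc : rect_closed P Q (ln r1) (ln r2) 0 (2 * pi).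
  move=> s t /andP[s1 s2] _.
  have [|k1 [k2 [h1 h2]]] := @diff2_polar g s t.
    apply: H; rewrite cabs_polar ger0_norm ?expR_ge0 //.
    by rewrite -ler_ln ?posrE ?expR_gt0 // -[X in _ && X]ler_ln ?posrE ?expR_gt0 // expRK s1.
  by exists k2, k1, (- k2).
have ll : ln r1 <= ln r2 by rewrite ler_ln ?posrE.
have := loop_eq0 ll p0 rc; rewrite /loop.
rewrite (_ : itg _ _ _ = 0) ?add0r; last first.
  rewrite -[RHS](mul0r (ln r2 - ln r1)) -itg_cst //; apply: itg_eq => x _.
  by rewrite /P -[2 * pi]add0r polarD2pi subrr.
rewrite itgB; last 2 first.
- by apply: (rc_bmy rc); rewrite lexx ll.
- by apply: (rc_bmy rc); rewrite lexx ll.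
move/eqP; rewrite subr_eq0 => /eqP; by rewrite /Q !lnK ?posrE.
Qed.

Lemma pi2_gt0 : 0 < 2 * pi :> R. Proof. by rewrite mulr_gt0 // pi_gt0. Qed.

Definition cbmeas (u : R -> Cc R) :=
  bmeas 0 (2 * pi) (fun t => Re (u t)) /\ bmeas 0 (2 * pi) (fun t => Im (u t)).

Definition cint (u : R -> Cc R) : Cc R :=
  Complex (itg 0 (2 * pi) (fun t => Re (u t))) (itg 0 (2 * pi) (fun t => Im (u t))).

Implicit Types u v : R -> Cc R.

Lemma cbmeas_cabs u : cbmeas u -> bmeas 0 (2 * pi) (fun t => cabs (u t)).
Proof.
move=> [hr hi].
have -> : (fun t => cabs (u t)) = fun t => `|Re (u t) * Re (u t) + Im (u t) * Im (u t)| `^ 2^-1.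
  apply/funext => t; rewrite powR12_sqrt // -!expr2 ger0_norm ?addr_ge0 ?sqr_ge0 //.
  by case: (u t).
by apply: bmeas_powR; [rewrite invr_ge0|apply: bmeasD; apply: bmeasM].
Qed.

Lemma cbmeas_cst c : cbmeas (fun=> c).
Proof. by split; exact: bmeas_cst. Qed.

Lemma cbmeas_ext u v : (forall t, u t = v t) -> cbmeas u -> cbmeas v.
Proof. by move=> /funext <-. Qed.

Lemma cbmeasD u v : cbmeas u -> cbmeas v -> cbmeas (fun t => u t + v t).
Proof.
move=> [h1 h2] [h3 h4]; split.
  by apply: bmeas_ext (bmeasD h1 h3) => t; rewrite cReD.
by apply: bmeas_ext (bmeasD h2 h4) => t; rewrite cImD.
Qed.

Lemma cbmeasM u v : cbmeas u -> cbmeas v -> cbmeas (fun t => u t * v t).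
Proof.
move=> [h1 h2] [h3 h4]; split.
  by apply: bmeas_ext (bmeasB (bmeasM h1 h3) (bmeasM h2 h4)) => t; rewrite cReM.
by apply: bmeas_ext (bmeasD (bmeasM h1 h4) (bmeasM h2 h3)) => t; rewrite cImM.
Qed.

Lemma cbmeasZ c u : cbmeas u -> cbmeas (fun t => c * u t).
Proof. by move=> h; apply: cbmeasM => //; exact: cbmeas_cst. Qed.

Lemma cbmeasX u n : cbmeas u -> cbmeas (fun t => u t ^+ n).
Proof.
move=> h; elim: n => [|n IH]; first exact: cbmeas_cst.
by apply: cbmeas_ext (cbmeasM h IH) => t; rewrite exprS.
Qed.

Lemma cbmeas_sum (I : Type) (s : seq I) (F : I -> R -> Cc R) :
  (forall i, cbmeas (F i)) -> cbmeas (fun t => \sum_(i <- s) F i t).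
Proof.
move=> H; elim: s => [|i s IH].
  by apply: cbmeas_ext (cbmeas_cst 0) => t; rewrite big_nil.
by apply: cbmeas_ext (cbmeasD (H i) IH) => t; rewrite big_cons.
Qed.

Lemma cbmeas_RC (f : R -> R) : bmeas 0 (2 * pi) f -> cbmeas (fun t => (f t)%:C%C).
Proof. by move=> h; split => //=; exact: bmeas_cst. Qed.

Lemma cint_eq u v : (forall t, 0 <= t <= 2 * pi -> u t = v t) -> cint u = cint v.
Proof. by move=> H; rewrite /cint; congr Complex; apply: itg_eq => t /H ->. Qed.

Lemma cintD u v : cbmeas u -> cbmeas v -> cint (fun t => u t + v t) = cint u + cint v.
Proof.
move=> [h1 h2] [h3 h4]; apply: complex_ext; rewrite ?cReD ?cImD /= -itgD //;
by apply: itg_eq => t _; rewrite ?cReD ?cImD.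
Qed.

Lemma cintZ c u : cbmeas u -> cint (fun t => c * u t) = c * cint u.
Proof.
move=> [h1 h2]; apply: complex_ext; rewrite ?cReM ?cImM /= -!itgZ //.
  rewrite -itgB; [|exact: bmeasZ..].
  by apply: itg_eq => t _; rewrite cReM.
rewrite -itgD; [|exact: bmeasZ..].
by apply: itg_eq => t _; rewrite cImM.
Qed.

Lemma cint_cst c : cint (fun=> c) = (2 * pi)%:C%C * c.
Proof.
have p := ltW pi2_gt0.
by apply: complex_ext; rewrite ?cReM ?cImM /= itg_cst // mul0r ?subr0 ?addr0 mulrC.
Qed.

Lemma cintB u v : cbmeas u -> cbmeas v -> cint (fun t => u t - v t) = cint u - cint v.
Proof.
move=> hu hv; rewrite -mulN1r -cintZ // -cintD //; last exact: cbmeasZ.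
by apply: cint_eq => t _; rewrite mulN1r.
Qed.

Lemma cint_sum (I : Type) (s : seq I) (F : I -> R -> Cc R) :
  (forall i, cbmeas (F i)) -> cint (fun t => \sum_(i <- s) F i t) = \sum_(i <- s) cint (F i).
Proof.
move=> H; elim: s => [|i s IH].
  rewrite big_nil -[RHS](mulr0 (2 * pi)%:C%C) -cint_cst.
  by apply: cint_eq => t _; rewrite big_nil.
rewrite big_cons -IH -cintD //; last exact: cbmeas_sum.
by apply: cint_eq => t _; rewrite big_cons.
Qed.

(** Multiplication by a suitable unimodular constant [d] makes the integral real and nonnegative;
    then the bound follows from Re (d u) <= |u|. *)
Lemma cabs_cint u : cbmeas u -> cabs (cint u) <= itg 0 (2 * pi) (fun t => cabs (u t)).
Proof.
move=> hu; have [->|c0] := eqVneq (cint u) 0.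
  by rewrite cabs0; apply: itg_ge0 => t _; exact: cabs_ge0.
have n0 : 0 < cabs (cint u) by rewrite cabs_gt0.
pose d : Cc R := ((cint u)^*)%C * ((cabs (cint u))^-1)%:C%C.
have E : d * cint u = (cabs (cint u))%:C%C.
  rewrite /d; have := sqr_cabs (cint u); case: (cint u) n0 => a b n0 /= S.
  set m := cabs _ in n0 S *.
  have m0 : m != 0 by rewrite gt_eqF.
  apply: complex_ext; rewrite ?cReM ?cImM ?cReM ?cImM /= !(mul0r, mulr0, subr0, addr0, oppr0, add0r).
    rewrite ?(mul0r, mulr0, subr0, addr0, oppr0, add0r).
    by apply: (mulfI m0); rewrite -expr2 S; field.
  by field.
have dn : cabs d = 1.
  have : cabs (d * cint u) = cabs (cint u) by rewrite E cabs_RC ger0_norm // ltW.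
  by rewrite cabsM -[RHS]mul1r => /(mulIf (lt0r_neq0 n0)).
have -> : cabs (cint u) = Re (cint (fun t => d * u t)) by rewrite cintZ // E.
apply: itg_le => [||t _]; [by have [] := cbmeasZ d hu|exact: cbmeas_cabs|].
by rewrite (le_trans (ler_norm _)) // (le_trans (Re_le _)) // cabsM dn mul1r.
Qed.

Lemma cabs_cint_le u (M : R) : cbmeas u -> (forall t, 0 <= t <= 2 * pi -> cabs (u t) <= M) ->
  cabs (cint u) <= 2 * pi * M.
Proof.
move=> hu H; apply: (le_trans (cabs_cint hu)).
rewrite [leRHS]mulrC -[X in M * X]subr0 -itg_cst ?(ltW pi2_gt0) //.
by apply: itg_le => //; [exact: cbmeas_cabs|exact: bmeas_cst].
Qed.

Lemma eit_cont t : forall e : R, 0 < e -> exists2 d : R, 0 < d & forall t', `|t' - t| < d ->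
  cabs (eit t' - eit t) < e.
Proof.
move=> e e0.
have /cvgrPdist_lt/(_ (e / 2) (divr_gt0 e0 (ltr0n _ 2)))/nbhs_ballP[d1 /= d10 H1] := @continuous_cos R t.
have /cvgrPdist_lt/(_ (e / 2) (divr_gt0 e0 (ltr0n _ 2)))/nbhs_ballP[d2 /= d20 H2] := @continuous_sin R t.
exists (Num.min d1 d2) => [|t']; first by rewrite lt_min d10.
rewrite lt_min => /andP[h1 h2]; apply: le_lt_trans (cabs_le _) _.
rewrite cReB cImB /=.
rewrite distrC in h1; rewrite distrC in h2.
have /= := H1 _ h1; have /= := H2 _ h2; rewrite distrC [X in _ -> X < _ -> _]distrC; lra.
Qed.

Definition ccont g z := forall e : R, 0 < e -> exists2 d : R, 0 < d &
  forall w, cabs (w - z) < d -> cabs (g w - g z) < e.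

Lemma derivable_ccont g z : derivable g z 1 -> ccont g z.
Proof. by move=> H e e0; exact: derivable_ceps. Qed.

Lemma ccont_polar g r t : ccont g (polar r t) -> forall e : R, 0 < e ->
  exists2 d : R, 0 < d & forall r' t', `|r' - r| < d -> `|t' - t| < d ->
  cabs (g (polar r' t') - g (polar r t)) < e.
Proof.
move=> H e e0; have [d d0 Hd] := H e e0.
have R0 : 0 < `|r| + 1 by rewrite ltr_wpDl.
have [d1 d10 H1] := @eit_cont t (d / (2 * (`|r| + 1))) (divr_gt0 d0 (mulr_gt0 (ltr0n _ 2) R0)).
exists (Num.min d1 (d / 2)) => [|r' t']; first by rewrite lt_min d10 divr_gt0.
rewrite !lt_min => /andP[_ r2] /andP[/H1 {}H1 _]; apply: Hd.
have -> : polar r' t' - polar r t = (r' - r)%:C%C * eit t' + r%:C%C * (eit t' - eit t).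
  by rewrite /polar rmorphB /=; ring.
apply: (le_lt_trans (cabsD _ _)); rewrite !cabsM !cabs_RC cabs_eit mulr1.
have : `|r| * cabs (eit t' - eit t) <= (`|r| + 1) * cabs (eit t' - eit t).
  by rewrite ler_wpM2r ?cabs_ge0 // lerDl.
rewrite ltr_pdivlMr ?mulr_gt0 // in H1; lra.
Qed.

Lemma cbmeas_circ g r : (forall t, ccont g (polar r t)) -> cbmeas (fun t => g (polar r t)).
Proof.
move=> H; split; apply: bmeas_cont => t _; apply/cvgrPdist_lt => e e0;
have [d d0 Hd] := ccont_polar (H t) e0; apply/nbhs_ballP; exists d => //= t';
rewrite /ball /= distrC => ht; rewrite distrC -?cReB -?cImB.
- by apply: le_lt_trans (Re_le _) (Hd r t' _ ht); rewrite subrr normr0.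
- by apply: le_lt_trans (Im_le _) (Hd r t' _ ht); rewrite subrr normr0.
Qed.

Lemma circ_const g r1 r2 : 0 < r1 <= r2 ->
  (forall z, r1 <= cabs z <= r2 -> derivable g z 1) ->
  cint (fun t => g (polar r1 t)) = cint (fun t => g (polar r2 t)).
Proof.
move=> hr H; rewrite /cint; congr Complex; first exact: circ_Re_const.
(* The imaginary part of g is the real part of -i g. *)
pose G : Cc R -> Cc R := fun z => Complex 0 (-1) * g z.
have E r t : Im (g (polar r t)) = Re (G (polar r t)).
  by rewrite /G cReM /=; lra.
transitivity (itg 0 (2 * pi) (fun t => Re (G (polar r1 t)))).
  by apply: itg_eq => t _; rewrite E.
transitivity (itg 0 (2 * pi) (fun t => Re (G (polar r2 t)))); last first.
  by apply: itg_eq => t _; rewrite E.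
apply: (circ_Re_const hr) => z /H hz; apply: is_derive_derivable (Complex 0 (-1) * derive1 g z) _.
by apply: (@is_deriveZ _ _ _ g (Complex 0 (-1) : R[i])); exact: derivable_is_derive.
Qed.

(* The value at 0 is only required as a limit, so that the singularity may be removable. *)
Lemma circ_mean g a r : 0 < r ->
  (forall z, 0 < cabs z <= r -> derivable g z 1) ->
  (forall e : R, 0 < e -> exists2 d : R, 0 < d & forall z, 0 < cabs z < d -> cabs (g z - a) < e) ->
  cint (fun t => g (polar r t)) = (2 * pi)%:C%C * a.
Proof.
move=> r0 H Ha; apply/eqP; rewrite -subr_eq0; apply/eqP/cabs_eq0.
apply/eqP; rewrite eq_le cabs_ge0 andbT; apply/ler_addgt0Pl => e e0; rewrite addr0.
have [d d0 Hd] := Ha (e / (2 * pi)) (divr_gt0 e0 pi2_gt0).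
pose s := Num.min r (d / 2).
have s0 : 0 < s by rewrite lt_min r0 divr_gt0.
have sr : s <= r by rewrite ge_min lexx.
have sd : s < d by rewrite (@le_lt_trans _ _ (d / 2)) ?ge_min ?lexx ?orbT // ltr_pdivrMr // mulr_natr mulr2n ltrDl.
rewrite -(@circ_const g s r) ?s0 //; last first.
  by move=> z /andP[sz zr]; apply: H; rewrite zr (lt_le_trans s0 sz).
have mg : cbmeas (fun t => g (polar s t)).
  apply: cbmeas_circ => t; apply: derivable_ccont; apply: H.
  by rewrite cabs_polar gtr0_norm // s0.
rewrite -cint_cst -cintB //; last exact: cbmeas_cst.
apply: (le_trans (cabs_cint_le _ _ (M := e / (2 * pi)))).
- by have := cbmeasD mg (cbmeasZ (-1) (cbmeas_cst a)); apply: cbmeas_ext => t; rewrite mulN1r.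
- by move=> t _; apply/ltW/Hd; rewrite cabs_polar gtr0_norm // s0.
- by rewrite mulrC mulfVK // gt_eqF // pi2_gt0.
Qed.

End CircleMeans.

(** * Cauchy's formula and zeros *)

Section Cauchy.
Variable R : realType.
Implicit Types (z w c : Cc R) (f g h : Cc R -> Cc R) (r s t : R).

Lemma itg_dct (F : nat -> R -> R) (f : R -> R) (a b M : R) :
  (forall n, bmeas a b (F n)) -> bmeas a b f ->
  (forall n t, a <= t <= b -> `|F n t| <= M) ->
  (forall t, a <= t <= b -> (fun n => F n t) @ \oo --> f t) ->
  (fun n => itg a b (F n)) @ \oo --> itg a b f.
Proof.
move=> bF bf HM Hc.
have [] // := @dominated_convergence _ _ R (@lebesgue_measure R) `[a, b]%classic _
   (fun n t => (F n t)%:E) (fun t => (f t)%:E) (fun=> M%:E).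
- by move=> n; apply/measurable_EFinP; case: (bF n).
- by apply/measurable_EFinP; case: bf.
- apply: aeW => t /=; rewrite in_itv /= => ht; apply/cvg_EFin; first exact: nearW.
  exact: Hc.
- exact: (bmeas_integrable (bmeas_cst a b M)).
- by apply: aeW => t n /=; rewrite in_itv /= => ht; rewrite lee_fin HM.
move=> _ _ H; rewrite /itg /Rintegral.
apply: fine_cvg; rewrite fineK //.
exact: integrable_fin_num (bmeas_integrable bf).
Qed.

Lemma sector_bounded (G : Cc R -> R) (r1 r2 : R) :
  (forall s t, r1 <= s <= r2 -> forall e : R, 0 < e -> exists2 d : R, 0 < d & forall s' t',
     `|s' - s| < d -> `|t' - t| < d -> `|G (polar s' t') - G (polar s t)| < e) ->
  exists M : R, forall s t, r1 <= s <= r2 -> 0 <= t <= 2 * pi -> `|G (polar s t)| <= M.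
Proof.
move=> H.
pose A : set (R * R) := `[r1, r2] `*` `[0, 2 * pi].
have cA : compact A by apply: compact_setX; exact: segment_compact.
have wc : {within A, continuous (fun x : R * R => G (polar x.1 x.2))}.
  apply/subspace_continuousP => -[s t] /= [/=]; rewrite !in_itv /= => hs ht.
  apply: cvg_within_filter; apply/cvgrPdist_lt => e e0.
  have [d d0 Hd] := H s t hs e e0.
  apply/nbhs_ballP; exists d => //= -[s' t'] [/= h1 h2].
  by rewrite distrC; apply: Hd; rewrite distrC.
have [M [_ HM]] := compact_bounded (continuous_compact wc cA).
exists (M + 1) => s t hs ht; apply: (HM (M + 1)); first by rewrite ltrDl.
by exists (s, t) => //=; split => /=; rewrite in_itv.
Qed.

(** The real function [G], whose increments are dominated by those of g, stands for both Re g and Im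
    g. Boundedness on the closed annulus gives the majorant for dominated convergence. *)
Lemma circ_limit (g : Cc R -> Cc R) (r1 r2 r : R) (u : nat -> R) :
  (forall z, r1 <= cabs z <= r2 -> ccont g z) -> 0 < r1 -> r1 <= r <= r2 ->
  (forall n, r1 <= u n <= r2) -> u @ \oo --> r ->
  (forall (G : Cc R -> R), (forall z w, `|G z - G w| <= cabs (g z - g w)) ->
    (fun n => itg 0 (2 * pi) (fun t => G (polar (u n) t))) @ \oo -->
    itg 0 (2 * pi) (fun t => G (polar r t))).
Proof.
move=> cg r10 hr hu ur G HG.
have cG s t : r1 <= s <= r2 -> forall e : R, 0 < e -> exists2 d : R, 0 < d & forall s' t',
     `|s' - s| < d -> `|t' - t| < d -> `|G (polar s' t') - G (polar s t)| < e.
  move=> hs e e0.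
  have s0 : 0 < s by case/andP: hs => h _; exact: lt_le_trans h.
  have [|d d0 Hd] := @ccont_polar _ g s t _ e e0.
    by apply: cg; rewrite cabs_polar gtr0_norm.
  by exists d => // s' t' h1 h2; apply: le_lt_trans (HG _ _) _; exact: Hd.
have [M HM] := sector_bounded cG.
have bG s : r1 <= s <= r2 -> bmeas 0 (2 * pi) (fun t => G (polar s t)).
  move=> hs; apply: bmeas_cont => t _; apply/cvgrPdist_lt => e e0.
  have [d d0 Hd] := cG s t hs e e0; apply/nbhs_ballP; exists d => //= t'.
  rewrite /ball /= distrC => ht; rewrite distrC; apply: Hd => //.
  by rewrite subrr normr0.
apply: (@itg_dct _ _ _ _ M) => [n||n t ht|t ht]; [exact: bG|exact: bG|exact: HM|].
apply/cvgrPdist_lt => e e0; have [d d0 Hd] := cG r t hr e e0.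
near=> n; rewrite distrC; apply: Hd; last by rewrite subrr normr0.
by rewrite distrC; near: n; exact: cvgr_dist_lt.
Unshelve. all: by end_near. Qed.

(** On either side of the circle through z0 the mean does not depend on the radius; continuity of g
    extends this to the radius r itself, so both sides have the same mean. *)
Lemma circ_cross g (r1 r2 r : R) z0 : 0 < r1 <= r -> r <= r2 -> r1 < r2 -> r = cabs z0 ->
  (forall z, r1 <= cabs z <= r2 -> ccont g z) ->
  (forall z, r1 <= cabs z <= r2 -> z != z0 -> derivable g z 1) ->
  cint (fun t => g (polar r1 t)) = cint (fun t => g (polar r2 t)).
Proof.
move=> /andP[r10 r1r] rr2 r12 rz0 cg dg.
suff H s : r1 <= s <= r2 -> cint (fun t => g (polar s t)) = cint (fun t => g (polar r t)).
  by rewrite !H ?lexx ?(ltW r12).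
move=> hs; have [->//|sr] := eqVneq s r.
(* These radii tend to r from the side of s, so the annulus between s and [u n] avoids the circle
   through z0. *)
pose u n : R := r + (s - r) / n.+1%:R.
have nb n : 0 < (n.+1%:R : R)^-1 <= 1 by rewrite invr_gt0 ltr0Sn invf_le1 ?ltr0Sn // ler1n.
have hu n : r1 <= u n <= r2.
  have /andP[n0 n1] := nb n; case/andP: hs => h1 h2; rewrite /u.
  by set k := _^-1 in n0 n1 *; apply/andP; split; nra.
have uc : u @ \oo --> r.
  rewrite -[X in _ --> X]addr0 -(mulr0 (s - r)); apply: cvgD; first exact: cvg_cst.
  by apply: cvgM; [exact: cvg_cst|exact: cvg_harmonic].
have cst n : cint (fun t => g (polar (u n) t)) = cint (fun t => g (polar s t)).
  have /andP[n0 n1] := nb n; case/andP: hs => h1 h2.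
  have der z : Num.min s (u n) <= cabs z <= Num.max s (u n) -> derivable g z 1.
    move=> hz; apply: dg.
      case/andP: hz => hz1 hz2; rewrite (le_trans _ hz1) ?(le_trans hz2) //.
        by rewrite ge_max h2; case/andP: (hu n).
      by rewrite le_min h1; case/andP: (hu n).
    apply/eqP => zz0; move: hz; rewrite zz0 -rz0 /u.
    set k := _^-1 in n0 n1 *; move: sr; rewrite neq_lt.
    rewrite ge_min le_max; nra.
  have s0 : 0 < s := lt_le_trans r10 h1.
  have u0 : 0 < u n by case/andP: (hu n) => h _; exact: lt_le_trans h.
  case: (leP s (u n)) der => su der.
    by symmetry; apply: circ_const; rewrite ?s0.
  by apply: circ_const; rewrite ?u0 ?ltW.
have K (G : Cc R -> R) : (forall z w, `|G z - G w| <= cabs (g z - g w)) ->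
  (forall n, itg 0 (2 * pi) (fun t => G (polar (u n) t)) = itg 0 (2 * pi) (fun t => G (polar s t))) ->
  itg 0 (2 * pi) (fun t => G (polar s t)) = itg 0 (2 * pi) (fun t => G (polar r t)).
  move=> HG HE; have hr : r1 <= r <= r2 by rewrite r1r.
  have := circ_limit cg r10 hr hu uc HG.
  rewrite (_ : (fun n => _) = fun=> itg 0 (2 * pi) (fun t => G (polar s t))); last exact/funext.
  move=> h; exact: (@cvg_unique _ (@Rhausdorff R) _ _ _ _ (cvg_cst _) h).
rewrite /cint; congr Complex.
  apply: (K (fun z => Re (g z))) => [z w|n]; first by rewrite -cReB Re_le.
  by have := cst n; rewrite /cint => -[].
apply: (K (fun z => Im (g z))) => [z w|n]; first by rewrite -cImB Im_le.
by have := cst n; rewrite /cint => -[].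
Qed.

Lemma derivable_eq_near f g z (d : R) : 0 < d -> (forall w, cabs (w - z) < d -> f w = g w) ->
  derivable f z 1 -> derivable g z 1.
Proof.
move=> d0 H /derivable_is_derive/is_derive_cdiff Hf.
apply: is_derive_derivable (derive1 f z) _; apply: cdiff_is_derive => e e0.
have [d1 d10 H1] := Hf e e0; exists (Num.min d d1) => [|w]; first by rewrite lt_min d0.
rewrite lt_min => /andP[wd wd1]; have := H1 w wd1; rewrite !H //.
  by rewrite subrr cabs0.
by rewrite (addrC z) addrK.
Qed.

(** The integral does not change when the radius grows, and z / (z - z0) tends to 1 at infinity. *)
Lemma cint_pole z0 r : cabs z0 < r ->
  cint (fun t => polar r t * (polar r t - z0)^-1) = (2 * pi)%:C%C.
Proof.
move=> zr; have r0 : 0 < r := le_lt_trans (cabs_ge0 _) zr.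
pose g z : Cc R := z * (z - z0)^-1.
have zz z : r <= cabs z -> z - z0 != 0.
  move=> h; rewrite -cabs_gt0 (lt_le_trans _ (cabsB_ge _ _)) // subr_gt0.
  exact: lt_le_trans h.
have dg z : r <= cabs z -> derivable g z 1.
  move=> h; apply: derivableM; first exact: derivable_id.
  apply: derivableV; first exact: zz.
  by apply: derivableB; [exact: derivable_id|exact: derivable_cst].
have cg s : r <= s -> cbmeas (fun t => g (polar s t)).
  move=> rs; apply: cbmeas_circ => t; apply: derivable_ccont; apply: dg.
  by rewrite cabs_polar ger0_norm // (le_trans (ltW r0)).
apply/eqP; rewrite -subr_eq0; apply/eqP/cabs_eq0.
apply/eqP; rewrite eq_le cabs_ge0 andbT; apply/ler_addgt0Pl => e e0; rewrite addr0.
(* Since r > |z0|, this gives |z0| / (s - |z0|) <= e / (2 pi), which bounds z / (z - z0) - 1 on the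
   circle of radius s. *)
pose s := r + 2 * pi * cabs z0 / e.
have k0 : 0 <= 2 * pi * cabs z0 / e.
  by rewrite divr_ge0 ?(ltW e0) // mulr_ge0 ?cabs_ge0 // ltW // pi2_gt0.
have rs : r <= s by rewrite lerDl.
rewrite (@circ_const _ g r s) ?r0 //; last by move=> z /andP[/dg].
rewrite -[X in _ - X]mulr1 -cint_cst -cintB //; last 2 first.
- exact: cg.
- exact: cbmeas_cst.
apply: (le_trans (cabs_cint_le (M := e / (2 * pi)) _ _)).
- have := cbmeasD (cg s rs) (cbmeasZ (-1) (cbmeas_cst 1)).
  by apply: cbmeas_ext => t; rewrite mulN1r.
- move=> t _; have sz := zz (polar s t).
  rewrite cabs_polar ger0_norm ?(le_trans (ltW r0)) // in sz.
  have -> : g (polar s t) - 1 = z0 * (polar s t - z0)^-1 by rewrite /g; field; exact: sz.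
  rewrite cabsM cabsV ler_pdivrMr ?cabs_gt0 ?sz //.
  apply: (@le_trans _ _ (e / (2 * pi) * (s - cabs z0))).
    apply: (@le_trans _ _ (e / (2 * pi) * (2 * pi * cabs z0 / e))).
      have := gt_eqF (pi2_gt0 R); have := gt_eqF e0; move: (2 * pi) => P e0' P0'.
      by rewrite le_eqVlt; apply/orP; left; apply/eqP; field; rewrite e0' P0'.
    by rewrite ler_wpM2l ?divr_ge0 ?(ltW e0) ?(ltW (pi2_gt0 _)) // /s; lra.
  rewrite ler_wpM2l ?divr_ge0 ?(ltW e0) ?(ltW (pi2_gt0 _)) //.
  by rewrite (le_trans _ (cabsB_ge _ _)) // cabs_polar lerB // ler_norm.
- by rewrite mulrC mulfVK // gt_eqF // pi2_gt0.
Qed.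

(** For z0 != 0, the function z (f z - f z0) / (z - z0), extended by z0 f'(z0), is continuous,
    differentiable off z0 and zero at 0. By [circ_cross] its mean over |z| = r equals that over a
    small circle, hence 0, and [cint_pole] evaluates the part with f z0. For z0 = 0 the formula is
    the mean value property. *)
Lemma cauchy_formula f z0 r : analytic_on_disk f -> cabs z0 < r -> r < 1 ->
  cint (fun t => f (polar r t) * (polar r t * (polar r t - z0)^-1)) = (2 * pi)%:C%C * f z0.
Proof.
move=> af zr r1; have r0 : 0 < r := le_lt_trans (cabs_ge0 _) zr.
have inD z : cabs z <= r -> disk z by move=> h; exact: le_lt_trans r1.
have dz0 : disk z0 by apply: inD; exact: ltW.
have nz t : polar r t - z0 != 0.
  by rewrite -cabs_gt0 (lt_le_trans _ (cabsB_ge _ _)) // subr_gt0 cabs_polar gtr0_norm.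
have dq z : z != z0 -> derivable (fun z => (z - z0)^-1 : Cc R) z 1.
  move=> h; apply: derivableV; first by rewrite subr_eq0.
  by apply: derivableB; [exact: derivable_id|exact: derivable_cst].
have cq : cbmeas (fun t => (polar r t - z0)^-1).
  apply: (@cbmeas_circ _ (fun z => (z - z0)^-1)) => t; apply: derivable_ccont; apply: dq.
  by rewrite -subr_eq0.
have cp : cbmeas (fun t => polar r t).
  by apply: (@cbmeas_circ _ id) => t; apply: derivable_ccont; exact: derivable_id.
have cf : cbmeas (fun t => f (polar r t)).
  apply: cbmeas_circ => t; apply: derivable_ccont; apply: af; apply: inD.
  by rewrite cabs_polar gtr0_norm.
have [z00|z0n] := eqVneq z0 0.
  rewrite -(@circ_mean _ f (f z0) r) //.
  - apply: cint_eq => t _; rewrite z00 subr0 mulfV ?mulr1 //.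
    by have := nz t; rewrite z00 subr0.
  - by move=> z /andP[_ /inD/af].
  - move=> e e0; have [d d0 H] := derivable_ccont (af _ dz0) e0.
    by exists d => // z /andP[_ hz]; apply: H; rewrite z00 subr0.
pose g z : Cc R := if z == z0 then z0 * derive1 f z0 else z * (f z - f z0) * (z - z0)^-1.
have dg z : disk z -> z != z0 -> derivable g z 1.
  move=> hz zz0; have d0 : 0 < cabs (z - z0) by rewrite cabs_gt0 subr_eq0.
  apply: (@derivable_eq_near (fun z => z * (f z - f z0) * (z - z0)^-1) _ _ _ d0).
    move=> w hw; rewrite /g; case: eqP => // wz; move: hw.
    by rewrite wz cabsB ltxx.
  apply: derivableM; last exact: dq.
  apply: derivableM; first exact: derivable_id.
  by apply: derivableB; [exact: af|exact: derivable_cst].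
have cg z : disk z -> ccont g z.
  move=> hz; have [->|zz0] := eqVneq z z0; last exact/derivable_ccont/dg.
  move=> e e0.
  have /is_derive_cdiff Hd := derivable_is_derive (af _ dz0).
  set c := derive1 f z0 in Hd.
  have C0 : 0 < cabs c + 2 by rewrite ltr_wpDl ?cabs_ge0.
  have e10 : 0 < e / 4 by rewrite divr_gt0.
  have [d d0 {}Hd] := Hd _ e10.
  exists (Num.min d (Num.min 1 (e / (4 * (cabs c + 2))))) => [|w].
    by rewrite !lt_min d0 ltr01 divr_gt0 // mulr_gt0.
  rewrite !lt_min => /andP[wd /andP[w1 wc]].
  rewrite /g eqxx; case: eqP => [_|/eqP wz0]; first by rewrite subrr cabs0.
  have {Hd} := Hd _ wd; rewrite [z0 + _]addrC subrK => Hd.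
  have wn : 0 < cabs (w - z0) by rewrite cabs_gt0 subr_eq0.
  have wz : w - z0 != 0 by rewrite subr_eq0.
  have -> : w * (f w - f z0) * (w - z0)^-1 - z0 * c =
     w * ((f w - f z0 - c * (w - z0)) * (w - z0)^-1) + (w - z0) * c by field.
  apply: (le_lt_trans (cabsD _ _)); rewrite !cabsM cabsV.
  have z01 : cabs z0 < 1 := dz0.
  have w2 : cabs w <= 2.
    rewrite -[w](subrK z0) (le_trans (cabsD _ _)) //; lra.
  have : cabs (f w - f z0 - c * (w - z0)) / cabs (w - z0) <= e / 4 by rewrite ler_pdivrMr.
  have : 0 <= cabs (f w - f z0 - c * (w - z0)) / cabs (w - z0) by rewrite divr_ge0 ?cabs_ge0.
  set q := _ / _ => q0 qe.
  have : cabs w * q <= 2 * (e / 4) by rewrite ler_pM ?cabs_ge0.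
  rewrite ltr_pdivlMr ?mulr_gt0 // in wc.
  have := cabs_ge0 c; nra.
have rg : cint (fun t => g (polar r t)) = 0.
  pose s := cabs z0 / 2.
  have z0p : 0 < cabs z0 by rewrite cabs_gt0.
  have [s0 sz] : 0 < s /\ s < cabs z0 by rewrite /s; lra.
  rewrite -(@circ_cross g s r (cabs z0) z0) ?s0 ?(ltW sz) ?(ltW zr) //; last 3 first.
  - exact: lt_trans zr.
  - by move=> z /andP[_ /inD]; exact: cg.
  - by move=> z /andP[_ /inD]; exact: dg.
  rewrite (@circ_mean _ g 0 s) ?mulr0 // => [z /andP[_ zs]|e e0].
    apply: dg; first by apply: inD; rewrite (le_trans zs) // ltW // (lt_trans sz).
    by apply/eqP => zz; move: zs; rewrite zz leNgt sz.
  have g0 : g 0 = 0 by rewrite /g eq_sym (negbTE z0n) !mul0r.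
  have D0 : disk (0 : Cc R) by rewrite /disk /mkset cabs0.
  have [d d0 H] := cg _ D0 e e0.
  by exists d => // z /andP[_ hz]; rewrite -[X in _ - X]g0; apply: H; rewrite subr0.
move: rg; rewrite (_ : cint _ = cint (fun t => f (polar r t) * (polar r t * (polar r t - z0)^-1)
   - f z0 * (polar r t * (polar r t - z0)^-1))); last first.
  apply: cint_eq => t _; rewrite /g; case: eqP => [h|_]; last by ring.
  by have := nz t; rewrite h subrr eqxx.
rewrite cintB; last 2 first.
- by apply: cbmeasM => //; exact: cbmeasM.
- by apply: cbmeasZ; exact: cbmeasM.
rewrite cintZ; last exact: cbmeasM.
by rewrite cint_pole // => /eqP; rewrite subr_eq0 => /eqP ->; rewrite mulrC.
Qed.

Lemma geom_expand (z p : Cc R) N : p != 0 -> p - z != 0 ->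
  p * (p - z)^-1 = \sum_(n < N) z ^+ n * p^-1 ^+ n + z ^+ N * (p^-1 ^+ N * (p * (p - z)^-1)).
Proof.
move=> p0 pz; elim: N => [|N IH]; first by rewrite big_ord0 add0r !expr0 !mul1r.
rewrite big_ord_recr /= {1}IH -addrA; congr (_ + _).
rewrite !exprS; set A := z ^+ N; set B := p^-1 ^+ N; field.
by rewrite p0 pz.
Qed.

(** Expanding Cauchy's kernel as a finite geometric sum gives Taylor polynomials with a remainder of
    order (|z| / r)^N. If all coefficients vanished, this remainder would force h z1 = 0; so there
    is a first nonzero one. *)
Lemma finite_order_zero h z1 : analytic_on_disk h -> disk z1 -> h z1 != 0 ->
  exists k a (C d : R), [/\ a != 0, 0 < d, 0 <= C &
    forall z, cabs z < d -> cabs (h z - a * z ^+ k) <= C * cabs z ^+ k.+1].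
Proof.
move=> ah dz1 hz1.
(* The circle has to enclose z1, since the expansion is evaluated there to exclude that all
   coefficients vanish. *)
pose r := (cabs z1 + 1) / 2.
have z11 : cabs z1 < 1 := dz1.
have z1g := cabs_ge0 z1.
have [zr r1 r0] : [/\ cabs z1 < r, r < 1 & 0 < r] by rewrite /r; split; lra.
have pn t : polar r t != 0 by rewrite -cabs_gt0 cabs_polar gtr0_norm.
have cp : cbmeas (fun t => polar r t).
  by apply: (@cbmeas_circ _ id) => t; apply: derivable_ccont; exact: derivable_id.
have cpV : cbmeas (fun t => (polar r t)^-1).
  apply: (@cbmeas_circ _ (fun z => z^-1)) => t; apply: derivable_ccont.
  by apply: derivableV => //; exact: derivable_id.
have ch : cbmeas (fun t => h (polar r t)).
  apply: cbmeas_circ => t; apply: derivable_ccont; apply: ah.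
  by apply: disk_polar; rewrite (ltW r0).
have [_ [M0 HM0]] := cbmeas_cabs ch.
pose M := `|M0|.
have HM t : 0 <= t <= 2 * pi -> cabs (h (polar r t)) <= M.
  by move=> ht; rewrite -[leLHS]ger0_norm ?cabs_ge0 // (le_trans (HM0 _ ht)) // ler_norm.
have twopi : (2 * pi)%:C%C != 0 :> Cc R.
  by rewrite -cabs_gt0 cabs_RC gtr0_norm pi2_gt0.
pose a n : Cc R := ((2 * pi)%:C%C)^-1 * cint (fun t => h (polar r t) * (polar r t)^-1 ^+ n).
have expand N z : cabs z < r ->
    cabs (h z - \sum_(n < N) a n * z ^+ n) <= cabs z ^+ N * (M * r^-1 ^+ N * (r / (r - cabs z))).
  move=> hz.
  have nz t : polar r t - z != 0.
    by rewrite -cabs_gt0 (lt_le_trans _ (cabsB_ge _ _)) // subr_gt0 cabs_polar gtr0_norm.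
  have cq : cbmeas (fun t => (polar r t - z)^-1).
    apply: (@cbmeas_circ _ (fun w => (w - z)^-1)) => t; apply: derivable_ccont.
    apply: derivableV; first exact: nz.
    by apply: derivableB; [exact: derivable_id|exact: derivable_cst].
  pose u t := h (polar r t) * ((polar r t)^-1 ^+ N * (polar r t * (polar r t - z)^-1)).
  have cu : cbmeas u.
    by apply: cbmeasM => //; apply: cbmeasM; [exact: cbmeasX|exact: cbmeasM].
  have cn n : cbmeas (fun t => h (polar r t) * (polar r t)^-1 ^+ n).
    by apply: cbmeasM => //; exact: cbmeasX.
  have E : (2 * pi)%:C%C * h z = \sum_(n < N) z ^+ n * cint (fun t => h (polar r t) * (polar r t)^-1 ^+ n)
     + z ^+ N * cint u.
    rewrite -(cauchy_formula ah hz r1) -cintZ //.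
    rewrite (eq_bigr (fun n : 'I_N => cint (fun t => z ^+ n * (h (polar r t) * (polar r t)^-1 ^+ n)))) =>
      [|n _]; last by rewrite cintZ.
    rewrite -(@cint_sum _ _ _ (fun (n : 'I_N) t => z ^+ n * (h (polar r t) * (polar r t)^-1 ^+ n))); last first.
      by move=> n; exact: cbmeasZ.
    rewrite -cintD; last 2 first.
    - by apply: cbmeas_sum => n; exact: cbmeasZ.
    - exact: cbmeasZ.
    apply: cint_eq => t _; rewrite (@geom_expand z (polar r t) N) // mulrDr mulr_sumr /u.
    congr (_ + _); last by ring.
    by apply: eq_bigr => n _; ring.
  have -> : h z - \sum_(n < N) a n * z ^+ n = ((2 * pi)%:C%C)^-1 * (z ^+ N * cint u).
    apply: (mulfI twopi); rewrite mulrBr E mulrA mulfV // mul1r addrC addrA.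
    rewrite mulr_sumr (_ : \sum_(i < N) _ = \sum_(n < N) z ^+ n *
      cint (fun t => h (polar r t) * (polar r t)^-1 ^+ n)) ?addNr ?add0r //.
    by apply: eq_bigr => n _; rewrite /a -mulrA mulVKf // mulrC.
  rewrite !cabsM cabsV cabsX cabs_RC gtr0_norm ?pi2_gt0 //.
  rewrite mulrCA ler_wpM2l ?exprn_ge0 ?cabs_ge0 // mulrC ler_pdivrMr ?pi2_gt0 // mulrC.
  apply: cabs_cint_le => // t ht; rewrite !cabsM cabsX !cabsV cabs_polar gtr0_norm //.
  rewrite -[leRHS]mulrA ler_pM ?cabs_ge0 ?HM //.
    by rewrite !mulr_ge0 ?exprn_ge0 ?invr_ge0 ?cabs_ge0 ?(ltW r0).
  rewrite cabs_RC cabs_eit mulr1 gtr0_norm //.  rewrite ler_wpM2l ?exprn_ge0 ?invr_ge0 ?(ltW r0) // ler_wpM2l ?(ltW r0) //.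
  rewrite lef_pV2 ?posrE ?cabs_gt0 ?subr_gt0 //.
  by rewrite (le_trans _ (cabsB_ge _ _)) // cabs_polar gtr0_norm.
have [k0 Hk0] : exists k, a k != 0.
  apply: contrapT => N; have a0 n : a n = 0.
    by apply/eqP/negP => /negP han; apply: N; exists n.
  have q0 : 0 <= cabs z1 / r < 1.
    by rewrite divr_ge0 ?(ltW r0) //= ltr_pdivrMr // mul1r.
  pose K := M * (r / (r - cabs z1)).
  have B n : cabs (h z1) <= (cabs z1 / r) ^+ n * K.
    have := expand n z1 zr; rewrite big1 ?subr0 => [|i _]; last by rewrite a0 mul0r.
    move=> /le_trans; apply; rewrite le_eqVlt /K exprMn; apply/orP; left; apply/eqP; ring.
  have hp : 0 < cabs (h z1) by rewrite cabs_gt0.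
  have q1 : `|cabs z1 / r| < 1 by rewrite ger0_norm; case/andP: q0.
  have /cvgrPdist_lt/(_ _ hp)[m _ /(_ m (leqnn m))] /= := cvg_geometric K q1.
  rewrite sub0r normrN /geometric /= => /(le_lt_trans (ler_norm _)).
  by rewrite mulrC ltNge B.
have [k Hk kmin] := ex_minnP (ex_intro (fun n => a n != 0) k0 Hk0).
exists k, (a k), (M * r^-1 ^+ k.+1 * 2), (r / 2); split => //.
- by rewrite divr_gt0.
- apply: mulr_ge0 => //; apply: mulr_ge0; first exact: normr_ge0.
  by apply: exprn_ge0; rewrite invr_ge0 ltW.
move=> z hz; have zr' : cabs z < r by apply: lt_trans hz _; lra.
have := expand k.+1 z zr'; rewrite big_ord_recr /= big1 ?add0r => [|i _]; last first.
  case: (eqVneq (a i) 0) => [->|/kmin]; first by rewrite mul0r.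
  by rewrite leqNgt ltn_ord.
move=> /le_trans; apply; rewrite mulrC ler_wpM2r ?exprn_ge0 ?cabs_ge0 //.
apply: ler_wpM2l; last by rewrite ler_pdivrMr ?subr_gt0 //; have := cabs_ge0 z; lra.
apply: mulr_ge0; first exact: normr_ge0.
by apply: exprn_ge0; rewrite invr_ge0 ltW.
Qed.

End Cauchy.

(** * Jensen's inequality *)

Section Jensen.
Variable R : realType.
Implicit Types (z w c : Cc R) (f g h : Cc R -> Cc R) (r s t : R).

Lemma unif_cont_itv (F : R -> R) (a b : R) : (forall t, {for t, continuous F}) ->
  forall e : R, 0 < e -> exists2 d : R, 0 < d & forall s t, a <= s <= b -> `|s - t| < d ->
  `|F s - F t| < e.
Proof.
move=> cF e e0.
have /compact_near_coveringP := @segment_compact R a b.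
move=> /(_ R (0:R)^'+ (fun d s => forall t, `|s - t| < d -> `|F s - F t| < e) _)[].
  move=> x _.
  have /cvgrPdist_lt/(_ (e / 2) (divr_gt0 e0 (ltr0n _ 2)))/nbhs_ballP[d /= d0 Hd] := cF x.
  exists (ball x (d / 2), [set y | 0 < y < d / 2]) => /=.
    split; first by apply: nbhsx_ballx; rewrite divr_gt0.
    near=> y; apply/andP; split; first by near: y; exact: nbhs_right_gt.
    by near: y; apply: nbhs_right_lt; rewrite divr_gt0.
  move=> [s y] /= [xs /andP[y0 yd]] t st.
  have xt : `|x - t| < d.
    have -> : x - t = (x - s) + (s - t) by lra.
    by rewrite (le_lt_trans (ler_normD _ _)) //; move: xs; rewrite /ball /=; lra.
  have xs' : `|x - s| < d by move: xs; rewrite /ball /=; lra.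
  have /= h1 := Hd _ xs'; have /= h2 := Hd _ xt.
  have -> : F s - F t = (F x - F t) - (F x - F s) by lra.
  by rewrite (le_lt_trans (ler_normB _ _)) //; lra.
move=> d /= d0 Hd; exists (d / 2) => [|s t hs st]; first by rewrite divr_gt0.
apply: (Hd (d / 2)) => //=; rewrite ?divr_gt0 //.
  by rewrite sub0r normrN gtr0_norm ?divr_gt0 // ltr_pdivrMr // mulr_natr mulr2n ltrDl.
Unshelve. all: by end_near. Qed.

(** By periodicity the sum over N equally spaced points is unchanged when s moves by 2 pi / N. It is
    therefore enough to take s in [0, 2 pi / N], where uniform continuity compares each term with
    the integral over its cell. Uniformity in the shift s lets [jensen] use the bound at all points
    of a circle at once. *)
Lemma riemann_sum (F : R -> R) (e : R) : (forall t, {for t, continuous F}) ->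
  (forall t, F (t + 2 * pi) = F t) -> 0 < e -> exists2 N, (0 < N)%N &
  forall s, 0 <= s -> \sum_(k < N) F (s + 2 * pi * k%:R / N%:R) <=
    N%:R * (itg 0 (2 * pi) F / (2 * pi) + e).
Proof.
move=> cF pF e0; have [d d0 Hd] := unif_cont_itv 0 (2 * pi) cF e0.
have P0 := pi2_gt0 R; set P := 2 * pi in P0 pF Hd *.
pose n0 := Num.Def.truncn (P / d); pose N := n0.+1; exists N => //.
have NN : 0 < N%:R :> R by rewrite ltr0n.
have hN : P / N%:R < d.
  by rewrite ltr_pdivrMr // mulrC -ltr_pdivrMr // truncnS_gt.
pose S s := \sum_(k < N) F (s + P * k%:R / N%:R).
have shift s : S (s + P / N%:R) = S s.
  have nz : N%:R != 0 :> R by rewrite lt0r_neq0.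
  rewrite /S {1}/N big_ord_recr [RHS]big_ord_recl /= mulr0 mul0r addr0 addrC; congr (_ + _).
    rewrite -[RHS]pF; congr F; rewrite -addrA; congr (s + _).
    have En : n0%:R = N%:R - 1 :> R by rewrite /N -natr1 addrK.
    by rewrite En; field.
  apply: eq_bigr => k _; congr F; rewrite /bump /= add1n -natr1.
  by field.
have red j s : S (s + P / N%:R * j%:R) = S s.
  elim: j => [|j IH]; first by rewrite mulr0 addr0.
  by rewrite -natr1 mulrDr mulr1 addrA shift.
suff H s : 0 <= s <= P / N%:R -> S s <= N%:R * (itg 0 P F / P + e).
  move=> s s0; rewrite -/(S s).
  pose j := Num.Def.truncn (s / (P / N%:R)).
  have PN : 0 < P / N%:R by rewrite divr_gt0.
  have sj : 0 <= s / (P / N%:R) by rewrite divr_ge0 // ltW.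
  have /andP[j1 j2] := truncn_itv sj.
  rewrite -[s](subrK (P / N%:R * j%:R)) red; apply: H.
  move: j1 j2; rewrite -/j ler_pdivlMr // ltr_pdivrMr // -natr1; lra.
move=> /andP[s0 sN].
pose x (k : nat) : R := P * k%:R / N%:R.
have x0 k : 0 <= x k by rewrite divr_ge0 ?(ltW NN) // mulr_ge0 // ltW.
have xS k : x k.+1 = x k + P / N%:R by rewrite /x -natr1; field; rewrite lt0r_neq0.
have bF a b : bmeas a b F by apply: bmeas_cont.
have step k : (k < N)%N -> F (s + x k) * (P / N%:R) <= itg (x k) (x k.+1) F + e * (P / N%:R).
  move=> kN.
  have xk : x k <= x k.+1 by rewrite xS lerDl divr_ge0 ?ltW.
  have xN : x k.+1 <= P.
    by rewrite /x ler_pdivrMr // ler_wpM2l ?(ltW P0) // ler_nat.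
  have : itg (x k) (x k.+1) (fun=> F (s + x k) - e) <= itg (x k) (x k.+1) F.
    apply: itg_le => //; first exact: bmeas_cst.
    move=> t /andP[t1 t2]; rewrite xS in t2 xN.
    have hs : 0 <= s + x k <= P by have := x0 k; lra.
    have hd : `|s + x k - t| < d by rewrite ltr_norml; lra.
    have := Hd _ _ hs hd; rewrite ltr_norml; lra.
  rewrite itg_cst //; have -> : x k.+1 - x k = P / N%:R by rewrite xS; lra.
  by rewrite mulrBl; lra.
have tot n : (n <= N)%N -> (\sum_(k < n) F (s + x k)) * (P / N%:R) <=
    itg 0 (x n) F + n%:R * (e * (P / N%:R)).
  elim: n => [_|n IH nN].
    rewrite big_ord0 !mul0r addr0 /x mulr0 mul0r.
    by rewrite /itg set_itv1 Rintegral_set1.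
  rewrite big_ord_recr /= mulrDl (@itg_split _ 0 (x n)) //; last first.
    by rewrite x0 xS lerDl divr_ge0 ?ltW.
  rewrite -natr1 mulrDl mul1r.
  have := IH (ltnW nN); have := step n nN; lra.
have xN : x N = P by rewrite /x mulfK ?lt0r_neq0.
have := tot N (leqnn N); rewrite xN.
rewrite -ler_pdivlMr ?divr_gt0 // => /le_trans; apply.
rewrite le_eqVlt; apply/orP; left; apply/eqP; field.
by rewrite !lt0r_neq0.
Qed.

Definition clim0 g a := forall e : R, 0 < e -> exists2 d : R, 0 < d &
  forall z, 0 < cabs z < d -> cabs (g z - a) < e.

Lemma clim0M f g a b : clim0 f a -> clim0 g b -> clim0 (fun z => f z * g z) (a * b).
Proof.
move=> Hf Hg e e0.
have D0 : 0 < cabs a + cabs b + 1 by rewrite ltr_wpDl ?addr_ge0 ?cabs_ge0.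
pose n := Num.min 1 (e / (cabs a + cabs b + 1)).
have n0 : 0 < n by rewrite lt_min ltr01 divr_gt0.
have n1 : n <= 1 by rewrite ge_min lexx.
have ne : n * (cabs a + cabs b + 1) <= e by rewrite -ler_pdivlMr // ge_min lexx orbT.
have [d1 d10 H1] := Hf n n0; have [d2 d20 H2] := Hg n n0.
exists (Num.min d1 d2) => [|z]; first by rewrite lt_min d10.
rewrite lt_min => /andP[z0 /andP[zd1 zd2]].
have {}H1 : cabs (f z - a) < n by apply: H1; rewrite z0.
have {}H2 : cabs (g z - b) < n by apply: H2; rewrite z0.
have -> : f z * g z - a * b = (f z - a) * (g z - b) + (a * (g z - b) + (f z - a) * b) by ring.
apply: (le_lt_trans (cabsD _ _)); rewrite cabsM.
apply: (le_lt_trans (lerD (lexx _) (cabsD _ _))); rewrite !cabsM.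
have := cabs_ge0 a; have := cabs_ge0 b; have := cabs_ge0 (f z - a); have := cabs_ge0 (g z - b).
move: H1 H2 ne; clear -n0 n1; nra.
Qed.

Lemma clim0_prod (I : Type) (s : seq I) (g : I -> Cc R -> Cc R) a :
  (forall i, clim0 (g i) a) -> clim0 (fun z => \prod_(i <- s) g i z) (a ^+ size s).
Proof.
move=> H; elim: s => [|i s IH].
  by move=> e e0; exists 1 => // z _; rewrite big_nil subrr cabs0.
move=> e /(clim0M (H i) IH)[d d0 Hd]; exists d => // z /Hd.
by rewrite big_cons exprS.
Qed.

Lemma derivable_prod (I : Type) (s : seq I) (g : I -> Cc R -> Cc R) z :
  (forall i, derivable (g i) z 1) -> derivable (fun z => \prod_(i <- s) g i z) z 1.
Proof.
move=> H; elim: s => [|i s IH].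
  apply: (@derivable_eq_near _ (fun=> 1) _ _ 1 ltr01); last exact: derivable_cst.
  by move=> w _; rewrite big_nil.
apply: (@derivable_eq_near _ (fun z => g i z * \prod_(i <- s) g i z) _ _ 1 ltr01).
  by move=> w _; rewrite big_cons.
by apply: derivableM; [exact: H|exact: IH].
Qed.

(** Let u_j run over the N-th roots of unity. The product of h(z u_j) / (z u_j)^k over j tends to
    a^N at 0, so by the mean value property |a|^N is at most its maximum on |z| = r. The logarithm
    of its modulus is bounded by a shifted Riemann sum of the integrand, hence by N times the mean
    up to a small error, uniformly in the shift. The summand [e] keeps the logarithm continuous at
    the zeros of h. *)
Lemma jensen h k a (C d r e : R) : analytic_on_disk h -> a != 0 -> 0 < d -> 0 <= C ->
  (forall z, cabs z < d -> cabs (h z - a * z ^+ k) <= C * cabs z ^+ k.+1) ->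
  0 < r < 1 -> 0 < e ->
  2 * pi * ln (cabs a) <= itg 0 (2 * pi) (fun t => ln (cabs (h (polar r t)) / r ^+ k + e)).
Proof.
move=> ah a0 d0 C0 Hh /andP[r0 r1] e0.
pose F t := ln (cabs (h (polar r t)) / r ^+ k + e).
have y0 t : 0 < cabs (h (polar r t)) / r ^+ k + e.
  by rewrite ltr_wpDl // divr_ge0 ?cabs_ge0 // exprn_ge0 // ltW.
have ch t : ccont h (polar r t).
  by apply: derivable_ccont; apply: ah; apply: disk_polar; rewrite ltW.
have cF t : {for t, continuous F}.
  apply: continuous_comp; last exact: continuous_ln.
  apply: cvgD; last exact: cvg_cst.
  apply: cvgM; last exact: cvg_cst.
  apply/cvgrPdist_lt => n n0; have [dl dl0 Hd] := ccont_polar (ch t) n0.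
  apply/nbhs_ballP; exists dl => //= t'; rewrite /ball /= distrC => ht.
  rewrite distrC; apply: (@le_lt_trans _ _ (cabs (h (polar r t') - h (polar r t)))).
    exact: cabs_dist.
  by apply: Hd => //; rewrite subrr normr0.
have pF t : F (t + 2 * pi) = F t by rewrite /F polarD2pi.
have P0 := pi2_gt0 R.
rewrite mulrC -ler_pdivlMr //; apply/ler_addgt0Pr => n n0.
have [N N0 HN] := riemann_sum cF pF n0.
set m := itg _ _ _ / _ in HN *.
have NN : 0 < N%:R :> R by rewrite ltr0n.
pose u (j : 'I_N) : Cc R := eit (2 * pi * j%:R / N%:R).
pose g (j : 'I_N) z : Cc R := h (z * u j) * ((z * u j) ^+ k)^-1.
pose G z : Cc R := \prod_(j <- index_enum 'I_N) g j z.
have un j : cabs (u j) = 1 by rewrite cabs_eit.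
have dg j z : 0 < cabs z < 1 -> derivable (g j) z 1.
  move=> /andP[z0 z1].
  have du : is_derive (z : Cc R) (1 : Cc R) (fun w => w * u j) (u j).
    have := is_deriveM (is_derive_id (z : Cc R) (1 : Cc R)) (is_derive_cst (u j) (z : Cc R) (1 : Cc R)).
    by rewrite /GRing.scale /= mulr0 add0r mulr1.
  apply: derivableM.
    have dh : derivable h (z * u j) 1 by apply: ah; rewrite /disk /mkset cabsM un mulr1.
    by case: (is_derive_comp du (derivable_is_derive dh)).
  apply: derivableV.
    by rewrite expf_neq0 // -cabs_gt0 cabsM un mulr1.
  apply: (@derivable_eq_near _ ((fun w => w * u j) ^+ k) _ _ 1 ltr01).
    by move=> w _; rewrite fctE.
  by apply: derivableX; case: du.
have lg j : clim0 (g j) a.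
  move=> x x0; exists (Num.min d (x / (C + 1))) => [|z].
    by rewrite lt_min d0 divr_gt0 // ltr_wpDl.
  rewrite lt_min ltr_pdivlMr ?ltr_wpDl // => /andP[z0 /andP[zd zx]].
  have zu : cabs (z * u j) = cabs z by rewrite cabsM un mulr1.
  have zn : (z * u j) ^+ k != 0 by rewrite expf_neq0 // -cabs_gt0 zu.
  have -> : g j z - a = (h (z * u j) - a * (z * u j) ^+ k) * ((z * u j) ^+ k)^-1.
    by rewrite mulrBl mulfK.
  rewrite cabsM cabsV cabsX zu ltr_pdivrMr ?exprn_gt0 //.
  have := Hh (z * u j); rewrite zu => /(_ zd)/le_lt_trans; apply.
  rewrite exprS mulrA ltr_pM2r ?exprn_gt0 //.
  by move: zx; have := ltW z0; lra.
have GN : cint (fun t => G (polar r t)) = (2 * pi)%:C%C * a ^+ N.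
  apply: circ_mean => //.
    move=> z /andP[z0 zr]; apply: derivable_prod => j; apply: dg.
    by rewrite z0 (le_lt_trans zr).
  have -> : N = size (index_enum 'I_N) by rewrite -sum1_size sum1_card card_ord.
  exact: clim0_prod.
have : cabs ((2 * pi)%:C%C * a ^+ N) <= 2 * pi * expR (N%:R * (m + n)).
  rewrite -GN; apply: cabs_cint_le.
    apply: cbmeas_circ => t; apply: derivable_ccont; apply: derivable_prod => j; apply: dg.
    by rewrite cabs_polar gtr0_norm // r0.
  move=> t /andP[t0 _]; rewrite cabs_prod.
  apply: (@le_trans _ _ (expR (\sum_(j < N) F (t + 2 * pi * j%:R / N%:R)))); last first.
    by rewrite ler_expR; exact: HN.
  rewrite expR_sum; apply: ler_prod => j _; rewrite cabs_ge0 /= /F lnK ?posrE //.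
  rewrite /g /u (_ : eit _ = polar 1 (2 * pi * j%:R / N%:R)); last by rewrite /polar mul1r.
  rewrite polarM mulr1 cabsM cabsV cabsX cabs_polar (gtr0_norm r0).
  by rewrite lerDl ltW.
rewrite cabsM cabs_RC gtr0_norm // ler_pM2l // cabsX expRM_natl.
rewrite ler_pXn2r ?nnegrE ?cabs_ge0 ?expR_ge0 // => h1.
by rewrite -(expRK (m + n)) ler_ln ?posrE ?expR_gt0 ?cabs_gt0.
Qed.

(* Otherwise h would be small on most of A for radii close to 1, and Jensen's
   inequality would make the mean of ln |h| tend to -oo. *)
Lemma boundary_mass_lower h z1 (A : set R) (C0 : R) :
  analytic_on_disk h -> disk z1 -> h z1 != 0 -> measurable A ->
  0 < itg 0 (2 * pi) (\1_A) ->
  exists2 c : R, 0 < c & forall r, 2^-1 <= r < 1 ->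
    itg 0 (2 * pi) (fun t => cabs (h (polar r t))) <= C0 ->
    c <= itg 0 (2 * pi) (fun t => \1_A t * cabs (h (polar r t))).
Proof.
move=> ah dz1 hz1 mA A0.
have [k [a [C [d [a0 d0 C1 Hh]]]]] := finite_order_zero ah dz1 hz1.
set m := itg _ _ _ in A0.
have P0 := pi2_gt0 R.
pose q : R := 2 ^+ k.
have q0 : 0 < q by rewrite exprn_gt0.
(* Chosen so that the integrated inequality, in which ln s = -K contributes -K m, leaves q J / s >=
   1, where J is the mass of |h| on A. The factor q = 2^k bounds r^(-k) for r >= 1/2. *)
pose K : R := Num.max 0 ((2 * (2 * pi) + q * `|C0| + 1 - 2 * pi * ln (cabs a)) / m).
have K0 : 0 <= K by rewrite le_max lexx.
have Km : 2 * (2 * pi) + q * `|C0| + 1 - 2 * pi * ln (cabs a) <= K * m.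
  by rewrite -ler_pdivrMr // le_max lexx orbT.
pose s := expR (- K).
have s0 : 0 < s by rewrite expR_gt0.
have s1 : s <= 1 by rewrite expR_le1 oppr_le0.
exists (s / q); first by rewrite divr_gt0.
move=> r /andP[r2 r1] hC.
have r0 : 0 < r by apply: lt_le_trans r2.
have ch : cbmeas (fun t => h (polar r t)).
  apply: cbmeas_circ => t; apply: derivable_ccont; apply: ah; apply: disk_polar.
  by rewrite (ltW r0).
have bh := cbmeas_cabs ch.
have bA : bmeas 0 (2 * pi) (\1_A : R -> R) by exact: bmeas_indic.
have bAh := bmeasM bA bh.
have rk : (r ^+ k)^-1 <= q.
  rewrite /q -exprVn lerXn2r ?nnegrE ?invr_ge0 ?(ltW r0) //.
  by rewrite -[leRHS]invrK lef_pV2 ?posrE // invr_gt0.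
have rk0 : 0 < (r ^+ k)^-1 by rewrite invr_gt0 exprn_gt0.
set J := itg _ _ _.
have rr : 0 < r < 1 by rewrite r0.
have := jensen ah a0 d0 C1 Hh rr s0.
(* A pointwise majorant of the logarithm, from ln y <= y / x + ln x - 1: on A with x = s, which
   produces -K, and off A with x = 1. *)
pose B t : R := s^-1 * (q * (\1_A t * cabs (h (polar r t)))) + 1 + (- K) * \1_A t
   + q * cabs (h (polar r t)) + 1.
have bB1 := bmeasZ s^-1 (bmeasZ q bAh).
have b1 := bmeas_cst 0 (2 * pi) (1 : R).
have bB2 := bmeasZ (- K) bA.
have bB3 := bmeasZ q bh.
have EB : itg 0 (2 * pi) B = s^-1 * (q * J) + 2 * pi + (- K) * m +
   q * itg 0 (2 * pi) (fun t => cabs (h (polar r t))) + 2 * pi.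
  rewrite /B itgD //; last by apply: bmeasD => //; apply: bmeasD => //; apply: bmeasD.
  rewrite itgD //; last by apply: bmeasD => //; apply: bmeasD.
  rewrite itgD //; last by apply: bmeasD.
  rewrite itgD // !itgZ //; last exact: bmeasZ.
  by rewrite !itg_cst ?(ltW P0) // subr0 mul1r.
have bB : bmeas 0 (2 * pi) B.
  by apply: bmeasD => //; apply: bmeasD => //; apply: bmeasD => //; apply: bmeasD.
have y0 t : 0 < cabs (h (polar r t)) / r ^+ k + s.
  by rewrite ltr_wpDl // divr_ge0 ?cabs_ge0 // exprn_ge0 // ltW.
have lnle (y x : R) : 0 < y -> 0 < x -> ln y <= y / x + ln x - 1.
  move=> hy hx; have yx : 0 < y / x by rewrite divr_gt0.
  have := expR_ge1Dx (ln (y / x)); rewrite lnK ?posrE // ln_div ?posrE //; lra.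
have FB : itg 0 (2 * pi) (fun t => ln (cabs (h (polar r t)) / r ^+ k + s)) <= itg 0 (2 * pi) B.
  apply: itg_le => //.
    split.
      apply: (measurableT_comp (@measurable_ln R)); apply: measurable_funD; last exact: measurable_cst.
      by case: (bmeasM bh (bmeas_cst 0 (2 * pi) (r ^+ k)^-1)).
    have [_ [M HM]] := bh; exists (`|ln s| + q * M + 1) => t ht.
    have h1 := HM t ht; rewrite ger0_norm ?cabs_ge0 // in h1.
    have h2 := lnle _ _ (y0 t) ltr01; rewrite ln1 divr1 addr0 in h2.
    have h3 : cabs (h (polar r t)) / r ^+ k <= q * M.
      by rewrite mulrC ler_pM ?cabs_ge0 // ltW.
    have h4 : ln s <= ln (cabs (h (polar r t)) / r ^+ k + s).
      by rewrite ler_ln ?posrE // lerDr divr_ge0 ?cabs_ge0 // exprn_ge0 // ltW.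
    have := ler_norm (ln s); have := ler_norm (- ln s); rewrite normrN => h5 h6.
    have h7 : 0 <= cabs (h (polar r t)) / r ^+ k.
      by rewrite divr_ge0 ?cabs_ge0 // exprn_ge0 // ltW.
    by rewrite ler_norml; move: s1 h2 h3 h4 h5 h6 h7; clear; lra.
  move=> t _; have h3 : cabs (h (polar r t)) / r ^+ k <= q * cabs (h (polar r t)).
    by rewrite mulrC ler_wpM2r ?cabs_ge0.
  have hq : 0 <= q * cabs (h (polar r t)) by rewrite mulr_ge0 ?cabs_ge0 // ltW.
  rewrite /B indicE; case: (_ \in _); rewrite ?mul1r ?mul0r ?mulr0 ?mulr1.
    have := lnle _ _ (y0 t) s0; rewrite /s expRK -/s mulrDl mulfV ?lt0r_neq0 //.
    have : cabs (h (polar r t)) / r ^+ k / s <= s^-1 * (q * cabs (h (polar r t))).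
      by rewrite [leRHS]mulrC ler_wpM2r // invr_ge0 ltW.
    lra.
  have := lnle _ _ (y0 t) ltr01; rewrite ln1 divr1 addr0; lra.
move=> /le_trans/(_ FB); rewrite EB => H.
have hq : q * itg 0 (2 * pi) (fun t => cabs (h (polar r t))) <= q * `|C0|.
  by rewrite ler_pM2l // (le_trans hC) // ler_norm.
have : 1 <= s^-1 * (q * J) by move: Km H hq; clear; lra.
by rewrite mulrC ler_pdivlMr // mul1r ler_pdivrMr // mulrC.
Qed.

End Jensen.

(** * Moments of lacunary sums *)

Section Lacunary.
Variable R : realType.
Implicit Types (P : R -> R) (a b c s t : R) (N : nat -> nat).

Definition lacunary N := (0 < N 0)%N /\ forall k, (2 * N k <= N k.+1)%N.

(** A form of being a trigonometric polynomial of degree at most d that keeps only what integration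
    sees: orthogonality to all frequencies above d. *)
Definition trigdeg (d : nat) P := bmeas 0 (2 * pi) P /\ forall n, (d < n)%N ->
  itg 0 (2 * pi) (fun t => P t * cos (n%:R * t)) = 0 /\
  itg 0 (2 * pi) (fun t => P t * sin (n%:R * t)) = 0.

Lemma bmeas_cos (n : nat) : bmeas 0 (2 * pi) (fun t : R => cos (n%:R * t)).
Proof.
apply: bmeas_cont => t _; apply: continuous_comp; last exact: continuous_cos.
by apply: cvgM; [exact: cvg_cst|exact: cvg_id].
Qed.

Lemma bmeas_sin (n : nat) : bmeas 0 (2 * pi) (fun t : R => sin (n%:R * t)).
Proof.
apply: bmeas_cont => t _; apply: continuous_comp; last exact: continuous_sin.
by apply: cvgM; [exact: cvg_cst|exact: cvg_id].
Qed.

Lemma cos_nat2pi (n : nat) : cos (n%:R * (2 * pi)) = 1 :> R /\ sin (n%:R * (2 * pi)) = 0 :> R.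
Proof.
elim: n => [|n [IH1 IH2]]; first by rewrite mul0r cos0 sin0.
rewrite -natr1 mulrDl mul1r; set x := n%:R * _ in IH1 IH2 *.
by rewrite mulr_natl cosD2pi sinD2pi.
Qed.

Lemma trigdeg1 : trigdeg 0 (fun=> 1).
Proof.
split; first exact: bmeas_cst.
move=> n n0; have P0 := ltW (pi2_gt0 R).
have nz : n%:R != 0 :> R by rewrite pnatr_eq0 -lt0n.
have dl (x : R) : is_derive x (1 : R) (fun t => n%:R * t) n%:R.
  by have := is_deriveZ (n%:R : R) (is_derive_id x (1 : R)); rewrite /GRing.scale /= mulr1.
have cc t : {for t, continuous (fun t : R => cos (n%:R * t))}.
  apply: continuous_comp; last exact: continuous_cos.
  by apply: cvgM; [exact: cvg_cst|exact: cvg_id].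
have cs t : {for t, continuous (fun t : R => sin (n%:R * t))}.
  apply: continuous_comp; last exact: continuous_sin.
  by apply: cvgM; [exact: cvg_cst|exact: cvg_id].
have ds t : is_derive t (1 : R) (fun t : R => n%:R^-1 * sin (n%:R * t)) (cos (n%:R * t)).
  have h := is_derive1_comp (is_derive_sin (n%:R * t)) (dl t).
  apply: (is_derive_eq (is_deriveZ (n%:R^-1 : R) h)).
  by rewrite /GRing.scale /=; field.
have dc t : is_derive t (1 : R) (fun t : R => (- n%:R^-1) * cos (n%:R * t)) (sin (n%:R * t)).
  have h := is_derive1_comp (is_derive_cos (n%:R * t)) (dl t).
  apply: (is_derive_eq (is_deriveZ (- n%:R^-1 : R) h)).
  by rewrite /GRing.scale /=; field.
split.
- rewrite (@itg_eq _ _ _ _ (fun t => cos (n%:R * t))); last by move=> t _; rewrite mul1r.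
  by rewrite (itg_FTC P0 cc ds) mulr0 sin0 (cos_nat2pi n).2 subrr.
- rewrite (@itg_eq _ _ _ _ (fun t => sin (n%:R * t))); last by move=> t _; rewrite mul1r.
  by rewrite (itg_FTC P0 cs dc) mulr0 cos0 (cos_nat2pi n).1 subrr.
Qed.

Lemma itg_lin5 (c1 c2 c3 c4 c5 : R) (f1 f2 f3 f4 f5 : R -> R) a b :
  bmeas a b f1 -> bmeas a b f2 -> bmeas a b f3 -> bmeas a b f4 -> bmeas a b f5 ->
  itg a b (fun t => c1 * f1 t + c2 * f2 t + c3 * f3 t + c4 * f4 t + c5 * f5 t) =
  c1 * itg a b f1 + c2 * itg a b f2 + c3 * itg a b f3 + c4 * itg a b f4 + c5 * itg a b f5.
Proof.
move=> b1 b2 b3 b4 b5.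
have k1 := bmeasZ c1 b1; have k2 := bmeasZ c2 b2; have k3 := bmeasZ c3 b3.
have k4 := bmeasZ c4 b4; have k5 := bmeasZ c5 b5.
have k12 := bmeasD k1 k2; have k123 := bmeasD k12 k3; have k1234 := bmeasD k123 k4.
rewrite (itgD k1234 k5) (itgD k123 k4) (itgD k12 k3) (itgD k1 k2).
by rewrite (itgZ _ b1) (itgZ _ b2) (itgZ _ b3) (itgZ _ b4) (itgZ _ b5).
Qed.

(** By the product-to-sum formulas only the frequencies n + m, n - m and n occur, and all exceed d
    when n > d + m. *)
Lemma trigdegM d P (m : nat) a b c : trigdeg d P ->
  trigdeg (d + m) (fun t => P t * (a * cos (m%:R * t) + b * sin (m%:R * t) + c)).
Proof.
move=> [bP HP].
have bc n := bmeas_cos n; have bs n := bmeas_sin n.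
have bPc n := bmeasM bP (bc n); have bPs n := bmeasM bP (bs n).
split.
  apply: bmeasM => //; apply: bmeasD; last exact: bmeas_cst.
  by apply: bmeasD; apply: bmeasZ.
move=> n dn.
have h1 : (d < n)%N by apply: leq_ltn_trans dn; rewrite leq_addr.
have h2 : (d < n + m)%N by apply: ltn_addr.
have h3 : (d < n - m)%N by lia.
have En : n%:R - m%:R = (n - m)%:R :> R by rewrite natrB //; lia.
have [p1 p2] := HP _ h1; have [q1 q2] := HP _ h2; have [r1 r2] := HP _ h3.
split.
- rewrite (@itg_eq _ _ _ _ (fun t => a / 2 * (P t * cos ((n + m)%:R * t)) +
    a / 2 * (P t * cos ((n - m)%:R * t)) + b / 2 * (P t * sin ((n + m)%:R * t)) +
    (- (b / 2)) * (P t * sin ((n - m)%:R * t)) + c * (P t * cos (n%:R * t)))); last first.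
    move=> t _; rewrite -En natrD mulrDl mulrBl cosD cosB sinD sinB; by field.
  have E := itg_lin5 (a / 2) (a / 2) (b / 2) (- (b / 2)) c (bPc (n + m)%N) (bPc (n - m)%N) (bPs (n + m)%N) (bPs (n - m)%N) (bPc n).
  apply: etrans; first exact: E.
  by rewrite p1 q1 q2 r1 r2 !mulr0 !addr0.
- rewrite (@itg_eq _ _ _ _ (fun t => a / 2 * (P t * sin ((n + m)%:R * t)) +
    a / 2 * (P t * sin ((n - m)%:R * t)) + b / 2 * (P t * cos ((n - m)%:R * t)) +
    (- (b / 2)) * (P t * cos ((n + m)%:R * t)) + c * (P t * sin (n%:R * t)))); last first.
    move=> t _; rewrite -En natrD (mulrDl n%:R m%:R t) (mulrBl t n%:R m%:R) cosB cosD sinB sinD; by field.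
  have E := itg_lin5 (a / 2) (a / 2) (b / 2) (- (b / 2)) c (bPs (n + m)%N) (bPs (n - m)%N) (bPc (n - m)%N) (bPc (n + m)%N) (bPs n).
  apply: etrans; first exact: E.
  by rewrite p2 q1 q2 r1 r2 !mulr0 !addr0.
Qed.

Lemma lacunary_sum_lt N : lacunary N -> forall L, (\sum_(k < L) N k < N L)%N.
Proof.
move=> [N0 HN]; elim=> [|L IH]; first by rewrite big_ord0.
rewrite big_ord_recr /=; move: (HN L) IH; move: (\sum_(_ < _) _) (N L) (N L.+1) => a b c; lia.
Qed.

(** Riesz products: [N L] exceeds the sum of the earlier frequencies, hence the degree of the
    earlier factors, so the trigonometric terms of each new factor integrate to 0 and only its
    constant survives. *)
Lemma lacunary_prod N (a b c : nat -> R) L : lacunary N ->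
  let Q L t := \prod_(k < L) (a k * cos ((N k)%:R * t) + b k * sin ((N k)%:R * t) + c k) in
  trigdeg (\sum_(k < L) N k) (Q L) /\
  itg 0 (2 * pi) (Q L) = 2 * pi * \prod_(k < L) c k.
Proof.
move=> lN Q.
have QS n : Q n.+1 = fun t => Q n t *
    (a n * cos ((N n)%:R * t) + b n * sin ((N n)%:R * t) + c n).
  by apply/funext => t; rewrite /Q big_ord_recr.
have dQ n : trigdeg (\sum_(k < n) N k) (Q n).
  elim: n => [|n IH].
    rewrite big_ord0 (_ : Q 0%N = fun=> 1); first exact: trigdeg1.
    by apply/funext => t; rewrite /Q big_ord0.
  by rewrite QS big_ord_recr /=; exact: trigdegM.
split=> //; elim: L => [|L IH].
  rewrite big_ord0 (_ : Q 0%N = fun=> 1); last by apply/funext => t; rewrite /Q big_ord0.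
  by rewrite itg_cst ?(ltW (pi2_gt0 R)) // subr0 mul1r mulr1.
have [bQ HQ] := dQ L; have [p1 p2] := HQ _ (lacunary_sum_lt lN L).
rewrite QS big_ord_recr /= mulrA -IH.
have bc := bmeasM bQ (bmeas_cos (N L)); have bs := bmeasM bQ (bmeas_sin (N L)).
rewrite (@itg_eq _ _ _ _ (fun t => a L * (Q L t * cos ((N L)%:R * t)) +
   b L * (Q L t * sin ((N L)%:R * t)) + c L * Q L t)); last by move=> t _; ring.
have k1 := bmeasZ (a L) bc; have k2 := bmeasZ (b L) bs; have k3 := bmeasZ (c L) bQ.
have k12 := bmeasD k1 k2.
rewrite (itgD k12 k3) (itgD k1 k2) (itgZ _ bc) (itgZ _ bs) (itgZ _ bQ).
by rewrite p1 p2 !mulr0 !add0r mulrC.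
Qed.

(** The linear term is the one that vanishes in the integral of a Riesz product. For x > 1/2 one has
    x <= 2 x^2; otherwise exp x <= 1 / (1 - x) <= 1 + x + 2 x^2. *)
Lemma expR_le_subgauss (x : R) : expR x <= x + expR (2 * x ^+ 2).
Proof.
have h1 := expR_ge1Dx (2 * x ^+ 2).
have [x1|x1] := leP x 2^-1; last first.
  apply: (@le_trans _ _ (expR (2 * x ^+ 2))); last by rewrite lerDr; lra.
  by rewrite ler_expR; nra.
suff : expR x <= 1 + x + 2 * x ^+ 2 by lra.
have h2 := expR_ge1Dx (- x).
have xp : 0 < 1 - x by lra.
have : expR x * (1 - x) <= 1.
  rewrite -[leRHS](expRxMexpNx_1 x) ler_wpM2l ?expR_ge0 //; lra.
rewrite -ler_pdivlMr // => /le_trans; apply.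
rewrite ler_pdivrMr //.
have : 0 <= x ^+ 2 * (1 - 2 * x) by rewrite mulr_ge0 ?sqr_ge0 //; lra.
rewrite !expr2; lra.
Qed.

Lemma bmeas_expR (f : R -> R) : bmeas 0 (2 * pi) f -> bmeas 0 (2 * pi) (fun t => expR (f t)).
Proof.
move=> [mf [M HM]]; split; first by apply: measurableT_comp => //.
exists (expR M) => t ht; rewrite ger0_norm ?expR_ge0 // ler_expR.
exact: le_trans (ler_norm _) (HM t ht).
Qed.

(** The exponential of the sum is a product whose factors are majorized, by [expR_le_subgauss], by
    those of a Riesz product with constants exp (2 (a_k^2 + b_k^2)). *)
Lemma lacunary_exp N (a b : nat -> R) L : lacunary N ->
  itg 0 (2 * pi) (fun t => expR (\sum_(k < L) (a k * cos ((N k)%:R * t) + b k * sin ((N k)%:R * t))))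
  <= 2 * pi * expR (2 * \sum_(k < L) (a k ^+ 2 + b k ^+ 2)).
Proof.
move=> lN.
have [[bQ _] E] := lacunary_prod a b (fun k => expR (2 * (a k ^+ 2 + b k ^+ 2))) L lN.
rewrite mulr_sumr expR_sum -E; apply: itg_le => //.
  apply: bmeas_expR; apply: bmeas_sum => k _.
  by apply: bmeasD; apply: bmeasZ; [exact: bmeas_cos|exact: bmeas_sin].
move=> t _; rewrite expR_sum; apply: ler_prod => k _; rewrite expR_ge0 /=.
set C := cos _; set S := sin _; apply: (le_trans (expR_le_subgauss _)).
rewrite lerD2l ler_expR ler_pM2l //.
have CS : C ^+ 2 + S ^+ 2 = 1 by rewrite cos2Dsin2.
have -> : a k ^+ 2 + b k ^+ 2 = (a k * C + b k * S) ^+ 2 + (a k * S - b k * C) ^+ 2.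
  by rewrite -[LHS]mulr1 -CS; ring.
by rewrite lerDl sqr_ge0.
Qed.

Lemma eitX (n : nat) t : eit t ^+ n = eit (n%:R * t).
Proof.
elim: n => [|n IH]; first by rewrite mul0r eit0.
by rewrite exprS IH -eitD -natr1 mulrDl mul1r addrC.
Qed.

Lemma polarX r (n : nat) t : polar r t ^+ n = polar (r ^+ n) (n%:R * t).
Proof. by rewrite /polar exprMn eitX rmorphXn. Qed.

Lemma sum_Re (I : Type) (s : seq I) (F : I -> Cc R) :
  Re (\sum_(i <- s) F i) = \sum_(i <- s) Re (F i).
Proof. by elim/big_rec2: _ => // i x y _ <-; rewrite cReD. Qed.

Lemma sum_Im (I : Type) (s : seq I) (F : I -> Cc R) :
  Im (\sum_(i <- s) F i) = \sum_(i <- s) Im (F i).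
Proof. by elim/big_rec2: _ => // i x y _ <-; rewrite cImD. Qed.

Lemma powR_le_expR (p : R) : 0 <= p -> exists2 K : R, 0 < K & forall x, 0 <= x -> x `^ p <= K * expR x.
Proof.
move=> p0; pose m := Num.Def.truncn p.
have pm : p <= m.+1%:R by rewrite ltW // truncnS_gt.
exists (1 + m.+1`!%:R) => [|x x0]; first by rewrite ltr_pwDl.
have ex1 : 1 <= expR x by have := expR_ge1Dx x; lra.
have f0 : 0 < m.+1`!%:R :> R by rewrite ltr0n fact_gt0.
have h2 := expR_ge1Dxn m x0.
have h3 : x ^+ m.+1 <= m.+1`!%:R * expR x by rewrite mulrC -ler_pdivrMr //; lra.
have xm : 0 <= x ^+ m.+1 by rewrite exprn_ge0.
rewrite mulrDl mul1r.
have [x1|x1] := leP x 1.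
  apply: (@le_trans _ _ 1); last by nra.
  have -> : 1 = 1 `^ p :> R by rewrite powR1.
  by rewrite ge0_ler_powR ?nnegrE.
apply: (@le_trans _ _ (x ^+ m.+1)); last by lra.
by rewrite -powR_mulrn // ler_powR // ltW.
Qed.

Lemma expR_norm_le (x : R) : expR `|x| <= expR x + expR (- x).
Proof.
by case: (leP 0 x) => h; rewrite ?(ger0_norm h) ?(ltr0_norm h) ?lerDl ?lerDr expR_ge0.
Qed.

(** After division by s the coefficients have square sum at most 1. Then |u|^p is at most a constant
    times exp |u|, which is bounded by exp (2 |Re u|) + exp (2 |Im u|); removing the absolute values
    gives four exponentials of real lacunary sums. *)
Lemma lacunary_moment (p : R) : 0 <= p -> exists2 K : R, 0 < K & forall N L (x : nat -> Cc R) r s,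
  lacunary N -> 0 <= r <= 1 -> 0 < s -> \sum_(k < L) cabs (x k) ^+ 2 <= s ^+ 2 ->
  itg 0 (2 * pi) (fun t => cabs (\sum_(k < L) x k * polar r t ^+ N k) `^ p) <= K * s `^ p.
Proof.
move=> p0; have [K0 K00 HK0] := powR_le_expR p0.
have P0 := pi2_gt0 R.
(* There are four exponentials [A1], ..., [A4]. Doubling the coefficients multiplies the square sum
   by 4, and [lacunary_exp] contributes another factor 2, whence the 8. *)
exists (K0 * (4 * (2 * pi * expR 8))) => [|N L x r s lN /andP[r0 r1] s0 hx].
  by rewrite !mulr_gt0 // ?expR_gt0 // pi_gt0.
pose y k : Cc R := (s^-1)%:C%C * (x k * (r ^+ N k)%:C%C).
pose u t : Cc R := \sum_(k < L) y k * eit ((N k)%:R * t).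
have hu t : \sum_(k < L) x k * polar r t ^+ N k = s%:C%C * u t.
  rewrite /u mulr_sumr; apply: eq_bigr => k _; rewrite polarX /y /polar.
  have sC : s%:C%C * (s^-1)%:C%C = 1 :> Cc R by rewrite -rmorphM mulfV ?gt_eqF.
  by rewrite !mulrA sC mul1r.
have hy : \sum_(k < L) cabs (y k) ^+ 2 <= 1.
  apply: (@le_trans _ _ (\sum_(k < L) s^-1 ^+ 2 * cabs (x k) ^+ 2)).
    apply: ler_sum => k _; rewrite /y !cabsM !cabs_RC !exprMn !ger0_norm ?invr_ge0 ?exprn_ge0 ?(ltW s0) //.
    rewrite ler_wpM2l ?sqr_ge0 // ler_piMr ?sqr_ge0 // -exprM exprn_ile1 //.
  by rewrite -mulr_sumr exprVn mulrC ler_pdivrMr ?exprn_gt0 // mul1r.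
pose Uf t := \sum_(k < L) (Re (y k) * cos ((N k)%:R * t) + (- Im (y k)) * sin ((N k)%:R * t)).
pose Vf t := \sum_(k < L) (Im (y k) * cos ((N k)%:R * t) + Re (y k) * sin ((N k)%:R * t)).
have hU t : Re (u t) = Uf t.
  by rewrite /u sum_Re; apply: eq_bigr => k _; rewrite cReM /=; ring.
have hV t : Im (u t) = Vf t.
  by rewrite /u sum_Im; apply: eq_bigr => k _; rewrite cImM /=; ring.
have bE (a b : nat -> R) : bmeas 0 (2 * pi) (fun t => expR (\sum_(k < L) (a k * cos ((N k)%:R * t) + b k * sin ((N k)%:R * t)))).
  apply: bmeas_expR; apply: bmeas_sum => k _.
  by apply: bmeasD; apply: bmeasZ; [exact: bmeas_cos|exact: bmeas_sin].
have B (a b : nat -> R) : (forall k, a k ^+ 2 + b k ^+ 2 = 4 * cabs (y k) ^+ 2) ->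
   itg 0 (2 * pi) (fun t => expR (\sum_(k < L) (a k * cos ((N k)%:R * t) + b k * sin ((N k)%:R * t))))
   <= 2 * pi * expR 8.
  move=> hab; apply: (le_trans (lacunary_exp a b L lN)).
  rewrite ler_pM2l // ler_expR (eq_bigr _ (fun k _ => hab (val k))) -mulr_sumr; lra.
have yk k : Re (y k) ^+ 2 + Im (y k) ^+ 2 = cabs (y k) ^+ 2 by rewrite sqr_cabs.
pose A1 t := expR (\sum_(k < L) ((2 * Re (y k)) * cos ((N k)%:R * t) + (- 2 * Im (y k)) * sin ((N k)%:R * t))).
pose A2 t := expR (\sum_(k < L) ((- 2 * Re (y k)) * cos ((N k)%:R * t) + (2 * Im (y k)) * sin ((N k)%:R * t))).
pose A3 t := expR (\sum_(k < L) ((2 * Im (y k)) * cos ((N k)%:R * t) + (2 * Re (y k)) * sin ((N k)%:R * t))).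
pose A4 t := expR (\sum_(k < L) ((- 2 * Im (y k)) * cos ((N k)%:R * t) + (- 2 * Re (y k)) * sin ((N k)%:R * t))).
have i1 : itg 0 (2 * pi) A1 <= 2 * pi * expR 8.
  by apply: (B (fun k => 2 * Re (y k)) (fun k => - 2 * Im (y k))) => k; rewrite -yk; ring.
have i2 : itg 0 (2 * pi) A2 <= 2 * pi * expR 8.
  by apply: (B (fun k => - 2 * Re (y k)) (fun k => 2 * Im (y k))) => k; rewrite -yk; ring.
have i3 : itg 0 (2 * pi) A3 <= 2 * pi * expR 8.
  by apply: (B (fun k => 2 * Im (y k)) (fun k => 2 * Re (y k))) => k; rewrite -yk; ring.
have i4 : itg 0 (2 * pi) A4 <= 2 * pi * expR 8.
  by apply: (B (fun k => - 2 * Im (y k)) (fun k => - 2 * Re (y k))) => k; rewrite -yk; ring.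
have b1 : bmeas 0 (2 * pi) A1 by exact: (bE (fun k => 2 * Re (y k)) (fun k => - 2 * Im (y k))).
have b2 : bmeas 0 (2 * pi) A2 by exact: (bE (fun k => - 2 * Re (y k)) (fun k => 2 * Im (y k))).
have b3 : bmeas 0 (2 * pi) A3 by exact: (bE (fun k => 2 * Im (y k)) (fun k => 2 * Re (y k))).
have b4 : bmeas 0 (2 * pi) A4 by exact: (bE (fun k => - 2 * Im (y k)) (fun k => - 2 * Re (y k))).
have bS : bmeas 0 (2 * pi) (fun t => A1 t + A2 t + (A3 t + A4 t)).
  by apply: bmeasD; apply: bmeasD.
apply: (@le_trans _ _ (itg 0 (2 * pi) (fun t => (K0 * s `^ p) * (A1 t + A2 t + (A3 t + A4 t))))).
  apply: itg_le; last 1 first.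
  - move=> t _; rewrite hu cabsM cabs_RC (gtr0_norm s0) powRM ?cabs_ge0 ?(ltW s0) //.
    rewrite [K0 * _]mulrC -[leRHS]mulrA ler_wpM2l ?powR_ge0 //.
    apply: (le_trans (HK0 _ (cabs_ge0 _))); rewrite ler_pM2l //.
    apply: (@le_trans _ _ (expR (2 * `|Uf t|) + expR (2 * `|Vf t|))).
      have := cabs_le (u t); rewrite hU hV => h.
      case: (leP `|Uf t| `|Vf t|) => UV.
        apply: (@le_trans _ _ (expR (2 * `|Vf t|))); last by rewrite lerDr expR_ge0.
        by rewrite ler_expR; move: h UV; clear; lra.
      apply: (@le_trans _ _ (expR (2 * `|Uf t|))); last by rewrite lerDl expR_ge0.
      by rewrite ler_expR; move: h UV; clear; lra.
    have n2 (z : R) : 2 * `|z| = `|2 * z| by rewrite normrM ger0_norm.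
    rewrite !n2; apply: lerD; apply: (le_trans (expR_norm_le _)).
      rewrite -mulNr /Uf !mulr_sumr le_eqVlt; apply/orP; left; apply/eqP.
      by congr (expR _ + expR _); apply: eq_bigr => k _; ring.
    rewrite -mulNr /Vf !mulr_sumr le_eqVlt; apply/orP; left; apply/eqP.
    by congr (expR _ + expR _); apply: eq_bigr => k _; ring.
  - have cu : cbmeas (fun t => \sum_(k < L) x k * polar r t ^+ N k).
      apply: cbmeas_sum => k; apply: cbmeasZ; apply: cbmeasX.
      by apply: (@cbmeas_circ _ id) => t; apply: derivable_ccont; exact: derivable_id.
    apply: bmeas_ext (bmeas_powR p0 (cbmeas_cabs cu)) => t.
    by rewrite ger0_norm ?cabs_ge0.
  - exact: bmeasZ.
rewrite itgZ // itgD ?itgD //; try exact: bmeasD.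
have Q : itg 0 (2 * pi) A1 + itg 0 (2 * pi) A2 + (itg 0 (2 * pi) A3 + itg 0 (2 * pi) A4)
    <= 4 * (2 * pi * expR 8) by move: i1 i2 i3 i4; clear; move: (itg _ _ _) (itg _ _ _) (itg _ _ _) (itg _ _ _) (2 * pi * _) => z1 z2 z3 z4 z5; lra.
have Ks : 0 <= K0 * s `^ p by rewrite mulr_ge0 ?powR_ge0 // ltW.
by apply: (le_trans (ler_wpM2l Ks Q)); rewrite mulrAC.
Qed.

End Lacunary.

(** * Power series *)

Section PowerSeries.
Variable R : realType.
Implicit Types (z w c l : Cc R) (u v b x y : nat -> Cc R) (m N : nat -> nat).

Definition ccvg u l := forall e : R, 0 < e -> exists L0, forall L, (L0 <= L)%N ->
  cabs (u L - l) < e.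

Lemma ccvg_unique u l l' : ccvg u l -> ccvg u l' -> l = l'.
Proof.
move=> H H'; apply/eqP; rewrite -subr_eq0; apply/eqP/cabs_eq0.
apply/eqP; rewrite eq_le cabs_ge0 andbT; apply/ler_addgt0Pl => e e0; rewrite addr0.
have [L1 h1] := H _ (divr_gt0 e0 (ltr0n _ 2)).
have [L2 h2] := H' _ (divr_gt0 e0 (ltr0n _ 2)).
have {}h1 := h1 (maxn L1 L2) (leq_maxl _ _); have {}h2 := h2 (maxn L1 L2) (leq_maxr _ _).
have -> : l - l' = (u (maxn L1 L2) - l') - (u (maxn L1 L2) - l) by ring.
by rewrite (le_trans (cabsBD _ _)) //; lra.
Qed.

Lemma ccvg_ext u v l : (forall n, u n = v n) -> ccvg u l -> ccvg v l.
Proof. by move=> /funext ->. Qed.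

Lemma ccvgD u v l l' : ccvg u l -> ccvg v l' -> ccvg (fun n => u n + v n) (l + l').
Proof.
move=> H H' e e0.
have [L1 h1] := H _ (divr_gt0 e0 (ltr0n _ 2)).
have [L2 h2] := H' _ (divr_gt0 e0 (ltr0n _ 2)).
exists (maxn L1 L2) => L; rewrite geq_max => /andP[/h1 {}h1 /h2 {}h2].
have -> : u L + v L - (l + l') = (u L - l) + (v L - l') by ring.
by rewrite (le_lt_trans (cabsD _ _)) //; lra.
Qed.

Lemma ccvgZ c u l : ccvg u l -> ccvg (fun n => c * u n) (c * l).
Proof.
move=> H e e0; have C0 : 0 < cabs c + 1 by rewrite ltr_wpDl ?cabs_ge0.
have [L h] := H _ (divr_gt0 e0 C0); exists L => n /h.
rewrite -mulrBr cabsM ltr_pdivlMr // => {}h; apply: le_lt_trans h.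
by rewrite mulrC ler_wpM2l ?cabs_ge0 // lerDl.
Qed.

Lemma ccvg_le u l c (M : R) L0 : ccvg u l -> (forall L, (L0 <= L)%N -> cabs (u L - c) <= M) ->
  cabs (l - c) <= M.
Proof.
move=> H HM; apply/ler_addgt0Pl => e e0; have [L1 h1] := H e e0.
have {}h1 := h1 (maxn L0 L1) (leq_maxr _ _); have {}HM := HM (maxn L0 L1) (leq_maxl _ _).
have -> : l - c = (u (maxn L0 L1) - c) - (u (maxn L0 L1) - l) by ring.
by rewrite (le_trans (cabsBD _ _)) //; lra.
Qed.

(** A total definition: it is the sum of the series under the geometric domination assumed in
    [csum_cvg]. *)
Definition csum u : Cc R :=
  Complex (limn (series (fun k => Re (u k)))) (limn (series (fun k => Im (u k)))).

Definition psum u n : Cc R := \sum_(k < n) u k.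

Lemma csum_cvg u (B q : R) : 0 <= q < 1 -> (forall k, cabs (u k) <= B * q ^+ k) ->
  ccvg (psum u) (csum u).
Proof.
move=> /andP[q0 q1] H.
have B0 : 0 <= B by have := H 0%N; rewrite expr0 mulr1; apply: le_trans; exact: cabs_ge0.
have K (f : nat -> R) : (forall k, `|f k| <= B * q ^+ k) -> cvgn (series f).
  move=> hf; apply: (@normed_cvg R R^o).
  apply: series_le_cvg (@is_cvg_geometric_series R B q _) => [n|n|n|].
  - exact: normr_ge0.
  - by rewrite /geometric /= mulr_ge0 // exprn_ge0.
  - exact: hf.
  - by rewrite ger0_norm.
have c1 : cvgn (series (fun k => Re (u k))).
  by apply: K => k; exact: le_trans (Re_le _) (H k).
have c2 : cvgn (series (fun k => Im (u k))).
  by apply: K => k; exact: le_trans (Im_le _) (H k).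
move=> e e0.
have /cvgrPdist_lt/(_ _ (divr_gt0 e0 (ltr0n _ 2)))[L1 _ h1] := c1.
have /cvgrPdist_lt/(_ _ (divr_gt0 e0 (ltr0n _ 2)))[L2 _ h2] := c2.
exists (maxn L1 L2) => L; rewrite geq_max => /andP[/h1 /= {}h1 /h2 /= {}h2].
apply: (le_lt_trans (cabs_le _)); rewrite cReB cImB /csum /psum sum_Re sum_Im /=.
move: h1 h2; rewrite /series /= !big_mkord distrC [X in _ -> X < _ -> _]distrC; lra.
Qed.

Lemma geom_sum_le (q : R) n : 0 <= q < 1 -> \sum_(k < n) q ^+ k <= (1 - q)^-1.
Proof.
move=> /andP[q0 q1]; have q1' : 0 < 1 - q by rewrite subr_gt0.
rewrite -[leRHS]mul1r ler_pdivlMr //.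
suff -> : (\sum_(k < n) q ^+ k) * (1 - q) = 1 - q ^+ n by rewrite gerBl exprn_ge0.
elim: n => [|n IH]; first by rewrite big_ord0 expr0 subrr mul0r.
by rewrite big_ord_recr /= mulrDl IH exprS; ring.
Qed.

(** Choose t < 1 with q <= t^3. Two of the three factors t^n absorb (n + 1)^2, because (n + 1) t^n
    is at most the geometric sum 1 / (1 - t); the third one remains. *)
Lemma sqr_geom (q : R) : 0 <= q < 1 -> exists C s : R, [/\ 0 <= C, 0 <= s < 1 &
  forall n, n.+1%:R ^+ 2 * q ^+ n <= C * s ^+ n].
Proof.
(* Bernoulli's inequality gives t^3 >= 1 - 3 x = q. *)
move=> /andP[q0 q1]; pose x := (1 - q) / 3; pose t := 1 - x.
have t0 : 0 <= t by rewrite /t /x; lra.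
have t1 : t < 1 by rewrite /t /x; lra.
have qt : q <= t ^+ 3.
  have -> : q = 1 - 3 * x by rewrite /x; lra.
  have x0 : 0 <= x by rewrite /x; lra.
  have x1 : x <= 1 by rewrite /x; lra.
  have : 0 <= x ^+ 2 * (3 - x) by rewrite mulr_ge0 ?sqr_ge0 //; lra.
  rewrite /t !exprS expr0; lra.
exists ((1 - t)^-1 ^+ 2), t; split.
- by rewrite sqr_ge0.
- by rewrite t0.
move=> n.
have h : n.+1%:R * t ^+ n <= (1 - t)^-1.
  apply: le_trans (@geom_sum_le t n.+1 _); last by rewrite t0.
  rewrite mulr_natl -[X in _ *+ X]card_ord -sumr_const; apply: ler_sum => k _.
  by rewrite ler_wiXn2l ?t0 ?ltW // -ltnS.
apply: (@le_trans _ _ (n.+1%:R ^+ 2 * (t ^+ 3) ^+ n)).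
  by rewrite ler_wpM2l ?sqr_ge0 // lerXn2r ?nnegrE ?exprn_ge0.
rewrite -exprM mulnC exprM (_ : _ * _ = (n.+1%:R * t ^+ n) ^+ 2 * t ^+ n); last by ring.
apply: ler_wpM2r; first by rewrite exprn_ge0.
apply: lerXn2r => //; rewrite nnegrE; first by rewrite mulr_ge0 // exprn_ge0.
by rewrite invr_ge0 subr_ge0 ltW.
Qed.

(** The estimate is the second-order remainder n^2 r^(n-2) |w|^2; the factor r^2 on the left avoids
    the exponent n - 2 when n < 2 and the division by r. *)
Lemma pow_taylor z w (r : R) n : 0 <= r -> cabs z <= r -> cabs (z + w) <= r ->
  r ^+ 2 * cabs ((z + w) ^+ n - z ^+ n - n%:R * z ^+ n.-1 * w) <= n%:R ^+ 2 * r ^+ n * cabs w ^+ 2.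
Proof.
move=> r0 zr zwr; elim: n => [|n IH].
  by rewrite !expr0 subrr !mul0r subrr cabs0 mulr0 expr0n /= !mul0r.
have -> : (z + w) ^+ n.+1 - z ^+ n.+1 - n.+1%:R * z ^+ n.+1.-1 * w =
   (z + w) * ((z + w) ^+ n - z ^+ n - n%:R * z ^+ n.-1 * w) + n%:R * z ^+ n.-1 * w ^+ 2.
  case: n {IH} => [|n]; first by rewrite /= !expr0 !expr1; ring.
  by rewrite /= !exprS -!natr1; ring.
apply: (@le_trans _ _ (r ^+ 2 * (cabs (z + w) * cabs ((z + w) ^+ n - z ^+ n - n%:R * z ^+ n.-1 * w)
   + cabs (n%:R * z ^+ n.-1 * w ^+ 2)))).
  by rewrite ler_wpM2l ?exprn_ge0 // (le_trans (cabsD _ _)) // cabsM.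
rewrite mulrDr mulrCA.
have nc : cabs (n%:R : Cc R) = n%:R.
  by rewrite -(rmorph_nat (real_complex R)) cabs_RC ger0_norm.
have h1 : cabs (z + w) * (r ^+ 2 * cabs ((z + w) ^+ n - z ^+ n - n%:R * z ^+ n.-1 * w)) <=
   r * (n%:R ^+ 2 * r ^+ n * cabs w ^+ 2).
  by rewrite ler_pM ?mulr_ge0 ?cabs_ge0 ?exprn_ge0.
have h2 : r ^+ 2 * cabs (n%:R * z ^+ n.-1 * w ^+ 2) <= n%:R * r ^+ n.+1 * cabs w ^+ 2.
  rewrite !cabsM !cabsX nc; case: n {IH h1 nc} => [|n /=].
    by rewrite !mul0r mulr0.
  have zn : cabs z ^+ n <= r ^+ n by rewrite lerXn2r ?nnegrE ?cabs_ge0.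
  have q0 : 0 <= n.+1%:R * r ^+ 2 * cabs w ^+ 2 by rewrite !mulr_ge0 ?exprn_ge0 ?cabs_ge0.
  have := ler_wpM2l q0 zn; rewrite !exprS expr0; lra.
apply: (le_trans (lerD h1 h2)).
have : 0 <= (n%:R + 1) * (r ^+ n.+1 * cabs w ^+ 2) by rewrite !mulr_ge0 ?exprn_ge0 ?cabs_ge0 // addr_ge0.
rewrite -natr1 exprS; lra.
Qed.

(* A pointwise limit inherits differentiability from a second-order Taylor estimate
   that is uniform along the sequence. *)
Lemma limit_is_derive (F dF : nat -> Cc R -> Cc R) (f : Cc R -> Cc R) z c (d K : R) :
  0 < d -> (forall w, cabs w < d -> ccvg (fun L => F L (z + w)) (f (z + w))) ->
  ccvg (fun L => dF L z) c ->
  (forall L w, cabs w < d -> cabs (F L (z + w) - F L z - dF L z * w) <= K * cabs w ^+ 2) ->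
  is_derive z (1 : Cc R) f c.
Proof.
move=> d0 HF HdF HK; apply: cdiff_is_derive => e e0.
have K1 : 0 < `|K| + 1 by rewrite ltr_wpDl.
exists (Num.min d (e / (`|K| + 1))) => [|w]; first by rewrite lt_min d0 divr_gt0.
rewrite lt_min => /andP[wd]; rewrite ltr_pdivlMr // => we.
have Hz := HF 0; rewrite addr0 cabs0 in Hz; have {}Hz := Hz d0.
have Hw := HF w wd.
have H := ccvgD Hw (ccvgD (ccvgZ (-1) Hz) (ccvgZ (- w) HdF)).
have : cabs (f (z + w) + (-1 * f z + - w * c) - 0) <= K * cabs w ^+ 2.
  apply: (ccvg_le (L0 := 0%N) H) => L _.
  rewrite subr0; have -> : F L (z + w) + (-1 * F L z + - w * dF L z) =
    F L (z + w) - F L z - dF L z * w by ring.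
  exact: HK.
have -> : f (z + w) + (-1 * f z + - w * c) - 0 = f (z + w) - f z - c * w by ring.
move=> /le_trans; apply; rewrite expr2 mulrA ler_wpM2r ?cabs_ge0 //.
apply: le_trans (ltW we); rewrite mulrC ler_wpM2l ?cabs_ge0 //.
by have := ler_norm K; lra.
Qed.

Definition pser b m z := csum (fun k => b k * z ^+ m k).

Lemma pser_cvg b m (B : R) z : (forall k, cabs (b k) <= B) -> (forall k, (k <= m k)%N) ->
  cabs z < 1 -> ccvg (psum (fun k => b k * z ^+ m k)) (pser b m z).
Proof.
move=> hb hm z1; have z0 := cabs_ge0 z.
apply: (@csum_cvg _ B (cabs z)) => [|k]; first by rewrite z0.
rewrite cabsM cabsX ler_pM ?cabs_ge0 ?exprn_ge0 //.
by rewrite ler_wiXn2l // ltW.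
Qed.

(** On a slightly larger disk of radius r < 1 the second-order remainders are bounded by (m k)^2
    r^(m k), which decays geometrically by [sqr_geom]; so the Taylor estimate is uniform over the
    partial sums. *)
Lemma pser_is_derive b m (B : R) z : (forall k, cabs (b k) <= B) -> (forall k, (k <= m k)%N) ->
  cabs z < 1 ->
  is_derive z (1 : Cc R) (pser b m) (csum (fun k => b k * ((m k)%:R * z ^+ (m k).-1))).
Proof.
move=> hb hm z1; have z0 := cabs_ge0 z.
have B0 : 0 <= B := le_trans (cabs_ge0 _) (hb 0%N).
pose r := (1 + cabs z) / 2.
have [r0 r1 zr] : [/\ 0 < r, r < 1 & cabs z < r] by rewrite /r; split; lra.
have [|C [s [C0 /andP[s0 s1] HC]]] := @sqr_geom r; first by rewrite (ltW r0).
have s01 : 0 <= s < 1 by rewrite s0.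
have nc n : cabs (n%:R : Cc R) = n%:R.
  by rewrite -(rmorph_nat (real_complex R)) cabs_RC ger0_norm.
have Cm k : (m k)%:R ^+ 2 * r ^+ m k <= C * s ^+ k.
  apply: (@le_trans _ _ (C * s ^+ m k)).
    apply: le_trans (HC (m k)); rewrite ler_wpM2r ?exprn_ge0 ?(ltW r0) //.
    by rewrite lerXn2r ?nnegrE // ler_nat.
  by rewrite ler_wpM2l // ler_wiXn2l // ltW.
apply: (@limit_is_derive (fun L z => psum (fun k => b k * z ^+ m k) L)
   (fun L z => psum (fun k => b k * ((m k)%:R * z ^+ (m k).-1)) L) _ _ _ (r - cabs z)
   (B * C / (r ^+ 2) * (1 - s)^-1)).
- by rewrite subr_gt0.
- move=> w wd; apply: (pser_cvg hb hm); apply: le_lt_trans (cabsD _ _) _; lra.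
- apply: (@csum_cvg _ (B * (C / r)) s) => // k.
  rewrite !cabsM cabsX nc -[leRHS]mulrA ler_pM ?cabs_ge0 ?mulr_ge0 ?exprn_ge0 //.
  rewrite mulrAC ler_pdivlMr //; apply: le_trans (Cm k).
  case: (m k) => [|n /=]; first by rewrite !mul0r expr0n /= mul0r.
  apply: (@le_trans _ _ (n.+1%:R * r ^+ n * r)).
    by rewrite ler_wpM2r ?(ltW r0) // ler_wpM2l // lerXn2r ?nnegrE ?(ltW r0) // ltW.
  rewrite -mulrA -exprSr ler_wpM2r ?exprn_ge0 ?(ltW r0) //.
  by rewrite -[leLHS]expr1 ler_weXn2l // ler1n.
- move=> L w wd.
  have zw : cabs (z + w) <= r by rewrite (le_trans (cabsD _ _)) //; lra.
  rewrite /psum !mulr_suml -!sumrB; apply: (le_trans (cabs_sum _ _ _)).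
  apply: (@le_trans _ _ (\sum_(k < L) B * C / r ^+ 2 * cabs w ^+ 2 * s ^+ k)); last first.
    rewrite -mulr_sumr [leRHS]mulrAC ler_wpM2l ?geom_sum_le //.
    by rewrite !mulr_ge0 ?invr_ge0 ?exprn_ge0 ?cabs_ge0 // ltW.
  apply: ler_sum => k _.
  have -> : b k * (z + w) ^+ m k - b k * z ^+ m k - b k * ((m k)%:R * z ^+ (m k).-1) * w =
    b k * ((z + w) ^+ m k - z ^+ m k - (m k)%:R * z ^+ (m k).-1 * w) by ring.
  have := pow_taylor (m k) (ltW r0) (ltW zr) zw.
  set E := cabs (_ - _ - _) => hE.
  rewrite cabsM -/E.
  have r2 : 0 < r ^+ 2 by rewrite exprn_gt0.
  have {}hE : E <= C * s ^+ k * cabs w ^+ 2 / r ^+ 2.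
    rewrite ler_pdivlMr // mulrC (le_trans hE) // ler_wpM2r ?exprn_ge0 ?cabs_ge0 //.
  apply: (@le_trans _ _ (B * (C * s ^+ k * cabs w ^+ 2 / r ^+ 2))).
    by rewrite ler_pM ?cabs_ge0.
  by rewrite le_eqVlt; apply/orP; left; apply/eqP; ring.
Qed.

Lemma csum_fin u L : (forall k, (L <= k)%N -> u k = 0) -> csum u = psum u L.
Proof.
move=> h.
have E n : (L <= n)%N -> psum u n = psum u L.
  elim: n => [|n IH]; first by rewrite leqn0 => /eqP ->.
  rewrite leq_eqVlt => /predU1P[->//|]; rewrite ltnS => Ln.
  by rewrite /psum big_ord_recr /= h // addr0; exact: IH.
have K (f : nat -> R) : (forall k, (L <= k)%N -> f k = 0) -> limn (series f) = \sum_(k < L) f k.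
  move=> hf; apply: (cvg_lim (@Rhausdorff R)).
  apply: (@cvg_near_cst _ _ _ _ \oo).
  exists L => // n /= Ln; rewrite /series /= big_mkord.
  elim: n Ln => [|n IH]; first by rewrite leqn0 => /eqP ->.
  rewrite leq_eqVlt => /predU1P[->//|]; rewrite ltnS => Ln.
  by rewrite big_ord_recr /= hf // addr0; exact: IH.
apply: complex_ext; rewrite /csum /psum ?sum_Re ?sum_Im /= K // => k /h ->//.
Qed.

End PowerSeries.

(** * The sequence space and the Hardy spaces *)

Section SpaceL2.
Variable R : realType.
Implicit Types (x y : nat -> Cc R) (a b : Cc R).

Lemma l2_partial x L : (\sum_(0 <= k < L) ((cabs (x k)) ^+ 2)%:E)%E = (\sum_(k < L) cabs (x k) ^+ 2)%:E.
Proof. by rewrite big_mkord sumEFin. Qed.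

Lemma l2_sum_le x L : in_l2 x -> \sum_(k < L) cabs (x k) ^+ 2 <= l2_norm x ^+ 2.
Proof.
move=> hx; rewrite /l2_norm.
have g0 k : (0 <= ((cabs (x k)) ^+ 2)%:E)%E by rewrite lee_fin sqr_ge0.
have s0 : (0 <= \sum_(0 <= k <oo) ((cabs (x k)) ^+ 2)%:E)%E by apply: nneseries_ge0.
rewrite sqr_sqrtr ?fine_ge0 // -lee_fin fineK ?ge0_fin_numE //.
rewrite -l2_partial; exact: nneseries_lim_ge.
Qed.

Lemma l2_norm_ge0 x : 0 <= l2_norm x.
Proof. exact: sqrtr_ge0. Qed.

Lemma l2_bound x (s : R) : 0 <= s -> (forall L, \sum_(k < L) cabs (x k) ^+ 2 <= s ^+ 2) ->
  in_l2 x /\ l2_norm x <= s.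
Proof.
move=> s0 H.
have g0 k : (0 <= ((cabs (x k)) ^+ 2)%:E)%E by rewrite lee_fin sqr_ge0.
have h : (\sum_(0 <= k <oo) ((cabs (x k)) ^+ 2)%:E <= (s ^+ 2)%:E)%E.
  apply: lime_le; first exact: is_cvg_nneseries.
  by apply: nearW => L; rewrite l2_partial lee_fin.
have hx : in_l2 x by apply: le_lt_trans h _; rewrite ltry.
split=> //; rewrite /l2_norm -[leRHS](ger0_norm s0) -sqrtr_sqr ler_wsqrtr //.
rewrite -lee_fin fineK // ge0_fin_numE //; exact: nneseries_ge0.
Qed.

Lemma l2_coord x k : in_l2 x -> cabs (x k) <= l2_norm x.
Proof.
move=> hx; rewrite -(@ler_pXn2r _ 2) ?nnegrE ?cabs_ge0 ?l2_norm_ge0 //.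
apply: le_trans (l2_sum_le k.+1 hx); rewrite big_ord_recr /= lerDr.
by apply: sumr_ge0 => i _; rewrite sqr_ge0.
Qed.

Lemma l2_lin x y a b : in_l2 x -> in_l2 y -> in_l2 (fun k => a * x k + b * y k) /\
  l2_norm (fun k => a * x k + b * y k) <= 2 * (cabs a * l2_norm x + cabs b * l2_norm y).
Proof.
move=> hx hy.
pose s := 2 * (cabs a * l2_norm x + cabs b * l2_norm y).
have ax : 0 <= cabs a * l2_norm x by rewrite mulr_ge0 ?cabs_ge0 ?l2_norm_ge0.
have bx : 0 <= cabs b * l2_norm y by rewrite mulr_ge0 ?cabs_ge0 ?l2_norm_ge0.
have s0 : 0 <= s by rewrite /s; lra.
apply: (l2_bound s0) => L; apply: (@le_trans _ _ (\sum_(k < L) (2 * cabs a ^+ 2 * cabs (x k) ^+ 2 +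
   2 * cabs b ^+ 2 * cabs (y k) ^+ 2))).
  apply: ler_sum => k _.
  apply: (@le_trans _ _ ((cabs a * cabs (x k) + cabs b * cabs (y k)) ^+ 2)).
    by rewrite lerXn2r ?nnegrE ?addr_ge0 ?mulr_ge0 ?cabs_ge0 // -!cabsM cabsD.
  have := sqr_ge0 (cabs a * cabs (x k) - cabs b * cabs (y k)); rewrite !expr2; lra.
rewrite big_split /= -!mulr_sumr.
have h1 := ler_wpM2l (sqr_ge0 (cabs a)) (l2_sum_le L hx).
have h2 := ler_wpM2l (sqr_ge0 (cabs b)) (l2_sum_le L hy).
have : 0 <= (cabs a * l2_norm x) * (cabs b * l2_norm y) by rewrite mulr_ge0.
have := sqr_ge0 (cabs a * l2_norm x); have := sqr_ge0 (cabs b * l2_norm y).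
rewrite /s !exprMn; move: h1 h2; set A := \sum_(_ < _) _; set B := \sum_(_ < _) _.
clear; rewrite !expr2; lra.
Qed.

Definition tailseq L x k := if (k < L)%N then 0 else x k.
Definition headseq L x k := if (k < L)%N then x k else 0.

Lemma head_tail L x : x = fun k => 1 * headseq L x k + 1 * tailseq L x k.
Proof.
apply/funext => k; rewrite /headseq /tailseq !mul1r.
by case: ifP; rewrite ?addr0 ?add0r.
Qed.

Lemma head_l2 L x : in_l2 x -> in_l2 (headseq L x) /\ l2_norm (headseq L x) <= l2_norm x.
Proof.
move=> hx; apply: l2_bound; first exact: l2_norm_ge0.
move=> M; apply: le_trans (l2_sum_le M hx); apply: ler_sum => k _.
by rewrite /headseq; case: ifP => // _; rewrite cabs0 expr0n sqr_ge0.
Qed.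

Lemma tail_l2 x (e : R) : in_l2 x -> 0 < e ->
  exists L, in_l2 (tailseq L x) /\ l2_norm (tailseq L x) <= e.
Proof.
move=> hx e0.
pose S : R := sup (range (fun L => \sum_(k < L) cabs (x k) ^+ 2)).
have hs : has_sup (range (fun L => \sum_(k < L) cabs (x k) ^+ 2)).
  split; first by exists (\sum_(k < 0) cabs (x k) ^+ 2); exists 0%N.
  by exists (l2_norm x ^+ 2) => _ [L _ <-]; exact: l2_sum_le.
have e2 : 0 < e ^+ 2 by rewrite exprn_gt0.
have [_ [L _ <-] hL] := sup_adherent e2 hs.
exists L; apply: l2_bound; first exact: ltW.
move=> M.
have hM n : \sum_(k < n) cabs (x k) ^+ 2 <= S by apply: ub_le_sup; [case: hs|exists n].
have E n : \sum_(k < L + n) cabs (x k) ^+ 2 =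
   \sum_(k < L) cabs (x k) ^+ 2 + \sum_(k < L + n) cabs (tailseq L x k) ^+ 2.
  elim: n => [|n IH].
    rewrite addn0 (_ : \sum_(k < L) cabs (tailseq L x k) ^+ 2 = 0) ?addr0 //.
    by rewrite big1 // => k _; rewrite /tailseq ltn_ord cabs0 expr0n.
  rewrite addnS !big_ord_recr /= IH addrA; congr (_ + _).
  by rewrite /tailseq ltnNge leq_addr.
have : \sum_(k < M) cabs (tailseq L x k) ^+ 2 <= \sum_(k < L + M) cabs (tailseq L x k) ^+ 2.
  rewrite addnC; elim: L {hL E} (tailseq L x) => [|L IH] y; first by rewrite addn0.
  by rewrite addnS big_ord_recr /= (le_trans (IH y)) // lerDl sqr_ge0.
have := hM (L + M)%N; rewrite E.
move: hL; rewrite -/S; lra.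
Qed.

End SpaceL2.

(** * Means on circles, quasi-norm inequalities and null functions in the Hardy spaces *)

Section HardySpaces.
Variables (R : realType) (p : R) (hp : 1 <= p).
Implicit Types (z w c : Cc R) (f g F G : Cc R -> Cc R) (r s t : R).

Let p0 : 0 < p. Proof. exact: lt_le_trans hp. Qed.

Lemma analytic_cbmeas F r : analytic_on_disk F -> 0 <= r < 1 -> cbmeas (fun t => F (polar r t)).
Proof.
by move=> aF hr; apply: cbmeas_circ => t; apply: derivable_ccont; apply: aF; exact: disk_polar.
Qed.

Lemma bmeas_cabs_powR (u : R -> Cc R) q : 0 <= q -> cbmeas u ->
  bmeas 0 (2 * pi) (fun t => cabs (u t) `^ q).
Proof.
move=> q0 hu; apply: bmeas_ext (bmeas_powR q0 (cbmeas_cabs hu)) => t.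
by rewrite ger0_norm ?cabs_ge0.
Qed.

Definition pmean (q : R) F r := itg 0 (2 * pi) (fun t => cabs (F (polar r t)) `^ q).

Lemma int_mean_pmean F r : analytic_on_disk F -> 0 <= r < 1 ->
  int_mean p F r = ((2 * pi)^-1 * pmean p F r)%:E.
Proof.
move=> aF hr; rewrite /int_mean EFinM; congr (_ * _)%E.
rewrite /pmean /itg /Rintegral fineK //.
apply: integrable_fin_num => //; apply: bmeas_integrable.
by apply: bmeas_cabs_powR; [exact: ltW|exact: analytic_cbmeas].
Qed.

(** With [pmean_le], its converse, this reduces the extended-real supremum in the norm to bounds for
    the real means [pmean]. *)
Lemma Hp_norm_le F (b : R) : analytic_on_disk F -> 0 <= b ->
  (forall r, 0 <= r < 1 -> pmean p F r <= 2 * pi * b `^ p) ->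
  in_Hp p F /\ Hp_norm p F <= b.
Proof.
move=> aF b0 H; have P0 := pi2_gt0 R.
have hle : (Hp_pow p F <= (b `^ p)%:E)%E.
  apply: ge_ereal_sup => _ [r hr <-]; rewrite /= in_itv /= in hr.
  by rewrite int_mean_pmean // lee_fin mulrC ler_pdivrMr // mulrC H.
have h0 : (0 <= Hp_pow p F)%E.
  have h00 : (int_mean p F 0 <= Hp_pow p F)%E.
    by apply: ereal_sup_ubound; exists 0 => //=; rewrite in_itv /= lexx ltr01.
  apply: le_trans h00; rewrite int_mean_pmean ?lexx ?ltr01 // lee_fin mulr_ge0 ?invr_ge0 ?(ltW P0) //.
  by apply: itg_ge0 => t _; rewrite powR_ge0.
split; first by split=> //; apply: le_lt_trans hle _; rewrite ltry.
have ff : Hp_pow p F \is a fin_num by rewrite ge0_fin_numE // (le_lt_trans hle) // ltry.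
rewrite /Hp_norm -[leRHS]powRr1 // -(mulfV (lt0r_neq0 p0)) powRrM.
rewrite ge0_ler_powR ?invr_ge0 ?(ltW p0) ?nnegrE ?powR_ge0 ?fine_ge0 //.
by rewrite -lee_fin fineK.
Qed.

Lemma Hp_norm_ge0 F : 0 <= Hp_norm p F. Proof. exact: powR_ge0. Qed.

Lemma pmean_le F r : in_Hp p F -> 0 <= r < 1 -> pmean p F r <= 2 * pi * Hp_norm p F `^ p.
Proof.
move=> [aF hF] hr; have P0 := pi2_gt0 R.
have hle : (int_mean p F r <= Hp_pow p F)%E.
  by apply: ereal_sup_ubound; exists r.
have h0 : (0 <= Hp_pow p F)%E.
  apply: le_trans hle; rewrite int_mean_pmean // lee_fin mulr_ge0 ?invr_ge0 ?(ltW P0) //.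
  by apply: itg_ge0 => t _; rewrite powR_ge0.
rewrite /Hp_norm -powRrM mulVf ?lt0r_neq0 // powRr1 ?fine_ge0 //.
rewrite -ler_pdivrMl // -lee_fin fineK ?ge0_fin_numE //.
by rewrite -int_mean_pmean.
Qed.

#[global] Opaque Hp_norm derive1.

Lemma powRD_le q (a b : R) : 0 <= q -> 0 <= a -> 0 <= b ->
  (a + b) `^ q <= 2 `^ q * (a `^ q + b `^ q).
Proof.
move=> q0 a0 b0; have [ab|/ltW ab] := leP a b.
  apply: (@le_trans _ _ ((2 * b) `^ q)).
    by rewrite ge0_ler_powR ?nnegrE ?addr_ge0 ?mulr_ge0 //; lra.
  by rewrite powRM // ler_wpM2l ?powR_ge0 // lerDr powR_ge0.
apply: (@le_trans _ _ ((2 * a) `^ q)).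
  by rewrite ge0_ler_powR ?nnegrE ?addr_ge0 ?mulr_ge0 //; lra.
by rewrite powRM // ler_wpM2l ?powR_ge0 // lerDl powR_ge0.
Qed.

Lemma pmean_lin q F G a b r : 0 <= q -> cbmeas (fun t => F (polar r t)) ->
  cbmeas (fun t => G (polar r t)) ->
  pmean q (fun z => a * F z + b * G z) r <=
  2 `^ q * (cabs a `^ q * pmean q F r + cabs b `^ q * pmean q G r).
Proof.
move=> q0 cF cG.
have bF := bmeas_cabs_powR q0 cF; have bG := bmeas_cabs_powR q0 cG.
rewrite /pmean -!itgZ // -itgD; [|exact: bmeasZ..].
rewrite -itgZ; last by apply: bmeasD; exact: bmeasZ.
apply: itg_le.
- by apply: bmeas_cabs_powR => //; apply: cbmeasD; exact: cbmeasZ.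
- by apply: bmeasZ; apply: bmeasD; exact: bmeasZ.
move=> t _; rewrite -!powRM ?cabs_ge0 //.
apply: le_trans (powRD_le q0 _ _); rewrite ?mulr_ge0 ?cabs_ge0 //.
rewrite ge0_ler_powR ?nnegrE ?addr_ge0 ?mulr_ge0 ?cabs_ge0 //.
by rewrite -!cabsM cabsD.
Qed.

Lemma disk_nbhs z : disk z -> exists2 d : R, 0 < d & forall w, cabs (w - z) < d -> disk w.
Proof.
move=> hz; exists (1 - cabs z) => [|w]; first by rewrite subr_gt0.
by move=> h; rewrite /disk /mkset -[w](subrK z) (le_lt_trans (cabsD _ _)) //; lra.
Qed.

Lemma is_derive_eq_near f g z c (d : R) : 0 < d -> (forall w, cabs (w - z) < d -> f w = g w) ->
  is_derive z (1 : Cc R) f c -> is_derive z (1 : Cc R) g c.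
Proof.
move=> d0 H /is_derive_cdiff Hf; apply: cdiff_is_derive => e e0.
have [d1 d10 H1] := Hf e e0; exists (Num.min d d1) => [|w]; first by rewrite lt_min d0.
rewrite lt_min => /andP[wd wd1]; have := H1 w wd1; rewrite !H //.
  by rewrite subrr cabs0.
by rewrite (addrC z) addrK.
Qed.

Lemma is_derive_eq_disk f g z c : (forall w, disk w -> f w = g w) -> disk z ->
  is_derive z (1 : Cc R) f c -> is_derive z (1 : Cc R) g c.
Proof.
move=> H hz; have [d d0 Hd] := disk_nbhs hz.
by apply: is_derive_eq_near d0 _ => w /Hd/H.
Qed.

Lemma analytic_ext f g : (forall w, disk w -> f w = g w) ->
  analytic_on_disk f -> analytic_on_disk g.
Proof.
move=> H af z hz; have := is_derive_eq_disk H hz (derivable_is_derive (af z hz)).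
exact: is_derive_derivable.
Qed.

Lemma derive1_ext f g : (forall w, disk w -> f w = g w) -> analytic_on_disk f ->
  forall z, disk z -> derive1 f z = derive1 g z.
Proof.
move=> H af z hz; have := is_derive_eq_disk H hz (derivable_is_derive (af z hz)).
by move=> /is_derive_derive1 ->.
Qed.

Lemma Hp_ext F G : (forall w, disk w -> F w = G w) -> in_Hp p F ->
  in_Hp p G /\ Hp_norm p G <= Hp_norm p F.
Proof.
move=> H hF; have [aF _] := hF.
apply: Hp_norm_le => [||r hr]; [exact: analytic_ext aF|exact: Hp_norm_ge0|].
apply: le_trans (pmean_le hF hr); rewrite le_eqVlt; apply/orP; left; apply/eqP.
by apply: itg_eq => t _; rewrite H //; exact: disk_polar.
Qed.

(** Functions are defined on the whole plane, but norm and membership only see the disk: it is open,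
    so derivatives at its points are determined by the restriction. *)
Lemma Sp_ext f g : (forall w, disk w -> f w = g w) -> in_Sp p f ->
  in_Sp p g /\ Sp_norm p g = Sp_norm p f.
Proof.
move=> H [af hf].
have [h1 h2] := Hp_ext (derive1_ext H af) hf.
have [_ h3] := Hp_ext (fun z hz => esym (derive1_ext H af hz)) h1.
split; first by split; [exact: analytic_ext af|exact: h1].
have E : Hp_norm p (derive1 g) = Hp_norm p (derive1 f).
  by apply: le_anti; apply/andP; split; [exact: h2|exact: h3].
have D0 : disk (0 : Cc R) by rewrite /disk /mkset cabs0.
exact: (congr2 (fun (u : Cc R) v => cabs u + v) (esym (H 0 D0)) E).
Qed.

Lemma is_derive_lin f g z a b c d : is_derive z (1 : Cc R) f c -> is_derive z (1 : Cc R) g d ->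
  is_derive z (1 : Cc R) (fun z => a * f z + b * g z) (a * c + b * d).
Proof.
by move=> hf hg; exact: is_deriveD (is_deriveZ a hf) (is_deriveZ b hg).
Qed.

(** The factor 4 comes from 2^p (A^p + B^p) <= 2^p 2 (A + B)^p <= (4 (A + B))^p, the last step by 2
    <= 2^p. *)
Lemma Hp_lin F G a b (nF nG : R) : analytic_on_disk F -> analytic_on_disk G ->
  0 <= nF -> 0 <= nG -> (forall r, 0 <= r < 1 -> pmean p F r <= 2 * pi * nF `^ p) ->
  (forall r, 0 <= r < 1 -> pmean p G r <= 2 * pi * nG `^ p) ->
  in_Hp p (fun z => a * F z + b * G z) /\
  Hp_norm p (fun z => a * F z + b * G z) <= 4 * (cabs a * nF + cabs b * nG).
Proof.
move=> aF aG nF0 nG0 HF HG.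
have aH : analytic_on_disk (fun z => a * F z + b * G z).
  move=> z hz; apply: is_derive_derivable.
  exact: is_derive_lin (derivable_is_derive (aF z hz)) (derivable_is_derive (aG z hz)).
have [A A0 EA] : exists2 A : R, 0 <= A & A = cabs a * nF.
  by exists (cabs a * nF); rewrite // mulr_ge0 ?cabs_ge0.
have [B B0 EB] : exists2 B : R, 0 <= B & B = cabs b * nG.
  by exists (cabs b * nG); rewrite // mulr_ge0 ?cabs_ge0.
rewrite -EA -EB; have P0 := pi2_gt0 R; have pp0 := ltW p0.
apply: Hp_norm_le => // [|r hr]; first by rewrite mulr_ge0 // addr_ge0.
apply: (le_trans (pmean_lin _ _ pp0 (analytic_cbmeas aF hr) (analytic_cbmeas aG hr))).
apply: (@le_trans _ _ (2 `^ p * (cabs a `^ p * (2 * pi * nF `^ p) +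
     cabs b `^ p * (2 * pi * nG `^ p)))).
  rewrite ler_wpM2l ?powR_ge0 //; apply: lerD; rewrite ler_wpM2l ?powR_ge0 //.
    exact: HF.
  exact: HG.
have -> : 2 `^ p * (cabs a `^ p * (2 * pi * nF `^ p) +
     cabs b `^ p * (2 * pi * nG `^ p)) = 2 * pi * (2 `^ p * (A `^ p + B `^ p)).
  by rewrite EA EB !powRM ?cabs_ge0 //; ring.
rewrite ler_pM2l // (_ : 4 * (A + B) = 2 * (2 * (A + B))); last by ring.
rewrite (@powRM _ 2) ?mulr_ge0 ?addr_ge0 // ler_wpM2l ?powR_ge0 // powRM ?addr_ge0 //.
apply: (@le_trans _ _ (2 * (A + B) `^ p)).
  have : A `^ p <= (A + B) `^ p by rewrite ge0_ler_powR ?nnegrE ?addr_ge0 // lerDl.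
  have : B `^ p <= (A + B) `^ p by rewrite ge0_ler_powR ?nnegrE ?addr_ge0 // lerDr.
  lra.
rewrite ler_wpM2r ?powR_ge0 // -[leLHS]powRr1 //.
by rewrite ler_powR // ler1n.
Qed.

Lemma Sp_lin f g a b : in_Sp p f -> in_Sp p g ->
  in_Sp p (fun z => a * f z + b * g z) /\
  Sp_norm p (fun z => a * f z + b * g z) <= 4 * (cabs a * Sp_norm p f + cabs b * Sp_norm p g).
Proof.
move=> [af hf] [ag hg].
have D z : disk z -> is_derive z (1 : Cc R) (fun z => a * f z + b * g z)
    (a * derive1 f z + b * derive1 g z).
  by move=> hz; apply: is_derive_lin; apply: derivable_is_derive; [exact: af|exact: ag].
have ah : analytic_on_disk (fun z => a * f z + b * g z).
  by move=> z /D; exact: is_derive_derivable.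
have [h1 h2] := Hp_lin a b hf.1 hg.1 (Hp_norm_ge0 _) (Hp_norm_ge0 _) (fun r => pmean_le hf)
  (fun r => pmean_le hg).
have E z : disk z -> a * derive1 f z + b * derive1 g z = derive1 (fun z => a * f z + b * g z) z.
  by move=> /D/is_derive_derive1 ->.
have [h3 h4] := Hp_ext E h1.
split; first by split; [exact: ah|exact: h3].
have h5 : cabs (a * f 0 + b * g 0) <= cabs a * cabs (f 0) + cabs b * cabs (g 0).
  by rewrite -!cabsM cabsD.
have h6 := mulr_ge0 (cabs_ge0 a) (cabs_ge0 (f 0)).
have h7 := mulr_ge0 (cabs_ge0 b) (cabs_ge0 (g 0)).
have arith (x1 x2 x3 x4 x5 x6 y1 y2 : R) : x6 <= y1 * x4 + y2 * x5 -> 0 <= y1 * x4 ->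
    0 <= y2 * x5 -> x3 <= 4 * (y1 * x1 + y2 * x2) ->
    x6 + x3 <= 4 * (y1 * (x4 + x1) + y2 * (x5 + x2)) by clear; lra.
exact: (arith _ _ _ _ _ _ _ _ h5 h6 h7 (le_trans h4 h2)).
Qed.

(** For y > e write y = y^(1-p) y^p and use 1 - p <= 0. Integrated, this controls a mean of order 1
    by the one of order p, with an error [e] at choice. *)
Lemma le_young (e y : R) : 0 < e -> 0 <= y -> y <= e + e `^ (1 - p) * y `^ p.
Proof.
move=> e0 y0; have [ye|ey] := leP y e.
  by rewrite (le_trans ye) // lerDl mulr_ge0 ?powR_ge0.
rewrite ler_wpDl ?(ltW e0) //.
have yp : 0 < y by apply: lt_trans ey.
apply: (@le_trans _ _ (y `^ (1 - p) * y `^ p)).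
  by rewrite -powRD ?subrK ?powRr1 // (gt_eqF yp) implybT.
apply: (@le_trans _ _ (e `^ (1 - p) * y `^ p)) => //.
rewrite ler_wpM2r ?powR_ge0 // -[1 - p]opprB !powRN lef_pV2 ?posrE ?powR_gt0 //.
by rewrite ge0_ler_powR ?nnegrE ?subr_ge0 ?(ltW e0) // ltW.
Qed.

Lemma pmean1_le F r (e : R) : analytic_on_disk F -> 0 <= r < 1 -> 0 < e ->
  pmean 1 F r <= 2 * pi * e + e `^ (1 - p) * pmean p F r.
Proof.
move=> aF hr e0; have cF := analytic_cbmeas aF hr.
have bF := bmeas_cabs_powR (ltW p0) cF.
rewrite /pmean -itgZ // [2 * pi * e]mulrC -[X in e * X]subr0 -itg_cst ?(ltW (pi2_gt0 R)) //.
rewrite -itgD; [|exact: bmeas_cst|exact: bmeasZ].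
apply: itg_le.
- exact: bmeas_cabs_powR.
- by apply: bmeasD; [exact: bmeas_cst|exact: bmeasZ].
- by move=> t _; rewrite powRr1 ?cabs_ge0 //; apply: le_young => //; exact: cabs_ge0.
Qed.

(** The mean of |F| vanishes on a circle that encloses z, by [pmean1_le] with arbitrarily small
    error, and Cauchy's formula recovers F z from that circle. *)
Lemma Hp_norm_eq0 F : in_Hp p F -> Hp_norm p F = 0 -> forall z, disk z -> F z = 0.
Proof.
move=> hF F0 z hz; have [aF _] := hF.
pose r := (cabs z + 1) / 2; have z0 := cabs_ge0 z; have z1 : cabs z < 1 := hz.
have [zr r1 r0] : [/\ cabs z < r, r < 1 & 0 < r] by rewrite /r; split; lra.
have hr : 0 <= r < 1 by rewrite (ltW r0).
have P0 := pi2_gt0 R.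
have q0 : 0 < r - cabs z by rewrite subr_gt0.
have m1 : pmean 1 F r <= 0.
  apply/ler_addgt0Pl => e e0; rewrite addr0.
  have e1 : 0 < e / (2 * pi) by rewrite divr_gt0.
  apply: (le_trans (pmean1_le aF hr e1)).
  have := pmean_le hF hr; rewrite F0 powR0 ?lt0r_neq0 // mulr0 => h.
  have : (e / (2 * pi)) `^ (1 - p) * pmean p F r <= 0 by rewrite mulr_ge0_le0 // powR_ge0.
  have -> : 2 * pi * (e / (2 * pi)) = e by rewrite mulrC mulfVK ?lt0r_neq0.
  lra.
have C := cauchy_formula aF zr r1.
have nz t : polar r t - z != 0.
  by rewrite -cabs_gt0 (lt_le_trans _ (cabsB_ge _ _)) // subr_gt0 cabs_polar gtr0_norm.
have cF := analytic_cbmeas aF hr.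
have cq : cbmeas (fun t => F (polar r t) * (polar r t * (polar r t - z)^-1)).
  apply: cbmeasM => //; apply: (@cbmeas_circ _ (fun w => w * (w - z)^-1)) => t.
  apply: derivable_ccont; apply: derivableM; first exact: derivable_id.
  apply: derivableV; first exact: nz.
  by apply: derivableB; [exact: derivable_id|exact: derivable_cst].
have : cabs ((2 * pi)%:C%C * F z) <= r / (r - cabs z) * pmean 1 F r.
  rewrite -C (le_trans (cabs_cint cq)) // /pmean -itgZ; last exact: bmeas_cabs_powR.
  apply: itg_le; [exact: cbmeas_cabs|by apply: bmeasZ; exact: bmeas_cabs_powR|].
  move=> t _; rewrite powRr1 ?cabs_ge0 // cabsM [cabs (polar r t * _)]cabsM cabsV cabs_polar gtr0_norm // mulrC.
  rewrite ler_wpM2r ?cabs_ge0 // ler_wpM2l ?(ltW r0) // lef_pV2 ?posrE ?cabs_gt0 //.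
  by rewrite (le_trans _ (cabsB_ge _ _)) // cabs_polar gtr0_norm.
rewrite cabsM cabs_RC gtr0_norm // => h.
have : r / (r - cabs z) * pmean 1 F r <= 0 by rewrite mulr_ge0_le0 // divr_ge0 // ltW.
move=> /(le_trans h); rewrite pmulr_rle0 // => h2.
by apply: cabs_eq0; apply/eqP; rewrite eq_le h2 cabs_ge0.
Qed.

Lemma real_is_derive0 (f : R -> R) (x : R) : (forall e : R, 0 < e -> exists2 d : R, 0 < d &
  forall h, `|h| < d -> `|f (x + h) - f x| <= e * `|h|) -> is_derive x (1 : R) f 0.
Proof.
move=> H.
suff Hc : (fun h : R => h^-1 *: (f (h *: (1 : R) + x) - f x)) @ (0 : R)^' --> (0 : R).
  by split; [apply/cvg_ex; exists 0|exact/cvg_lim].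
apply/cvgrPdist_le => e e0; have [d d0 Hd] := H e e0.
apply/nbhs_ballP; exists d => // h; rewrite /ball /= !sub0r !normrN => hd h0.
have hp' : 0 < `|h| by rewrite normr_gt0.
by rewrite /GRing.scale /= mulr1 normrM normfV mulrC ler_pdivrMr // (addrC h); exact: Hd.
Qed.

(** The mean value theorem along the segment from 0 to z, applied to the real and the imaginary
    part. *)
Lemma derive0_const f : analytic_on_disk f -> (forall z, disk z -> derive1 f z = 0) ->
  forall z, disk z -> f z = f 0.
Proof.
move=> af df z hz.
have K (P : Cc R -> R) : (forall z w, `|P z - P w| <= cabs (z - w)) -> P (f z) = P (f 0).
  move=> HP; pose g s := P (f (s%:C%C * z)).
  have D s : 0 <= s <= 1 -> is_derive s (1 : R) g 0.
    move=> /andP[s0 s1].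
    have dz : disk (s%:C%C * z).
      rewrite /disk /mkset cabsM cabs_RC ger0_norm //.
      by apply: le_lt_trans hz; rewrite ler_piMl ?cabs_ge0.
    apply: real_is_derive0 => e e0.
    have := derivable_is_derive (af _ dz); rewrite df // => /is_derive_cdiff.
    have Z1 : 0 < cabs z + 1 by rewrite ltr_wpDl ?cabs_ge0.
    move=> /(_ (e / (cabs z + 1)) (divr_gt0 e0 Z1))[d d0 Hd].
    exists (d / (cabs z + 1)) => [|h]; first by rewrite divr_gt0.
    rewrite ltr_pdivlMr // => hd.
    have hh : `|h| * cabs z <= `|h| * (cabs z + 1) by rewrite ler_wpM2l // lerDl.
    have := Hd (h%:C%C * z); rewrite cabsM cabs_RC mul0r subr0 => /(_ (le_lt_trans hh hd)).
    rewrite -mulrDl -rmorphD => H1; apply: le_trans (HP _ _) _; apply: (le_trans H1).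
    by rewrite mulrAC ler_pdivrMr // -mulrA ler_wpM2l // ltW.
  have cg : {within `[0, 1], continuous g}.
    apply: continuous_in_subspaceT => s; rewrite inE /= in_itv /= => /D[ds _].
    by apply: differentiable_continuous; apply/derivable1_diffP.
  have [|c _] := @MVT_segment R g (fun=> 0) 0 1 ler01 _ cg.
    move=> s; rewrite in_itv /= => /andP[s0 s1]; apply: D; rewrite !ltW //.
  by rewrite mul0r /g => /eqP; rewrite subr_eq0 mul1r mul0r => /eqP.
apply: complex_ext.
  by apply: (K (fun z => Re z)) => z1 z2; rewrite -cReB Re_le.
by apply: (K (fun z => Im z)) => z1 z2; rewrite -cImB Im_le.
Qed.

Lemma Sp_norm_eq0 f : in_Sp p f -> Sp_norm p f = 0 -> forall z, disk z -> f z = 0.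
Proof.
move=> [af hf] /eqP; rewrite /Sp_norm paddr_eq0 ?cabs_ge0 ?Hp_norm_ge0 //.
move=> /andP[/eqP/cabs_eq0 f0 /eqP h] z hz.
rewrite (derive0_const af (Hp_norm_eq0 hf h) hz) //.
Qed.

Lemma Sp_norm_ge0 f : 0 <= Sp_norm p f.
Proof. by rewrite addr_ge0 ?cabs_ge0 ?Hp_norm_ge0. Qed.

End HardySpaces.

(** * The lacunary embedding of the sequence space into S^p *)

Section LacunaryEmbedding.
Variables (R : realType) (p : R) (hp : 1 <= p).
Implicit Types (z w c : Cc R) (f g F G : Cc R -> Cc R) (r s t : R) (x y : nat -> Cc R) (N : nat -> nat).

Let p0 : 0 < p. Proof. exact: lt_le_trans hp. Qed.

Definition Jcoef N x k : Cc R := ((N k).+1%:R)^-1 * x k.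
Definition gser N x := pser x N.
(** The value 0 outside the disk makes linearity an equality of functions on the whole plane, as
    [fixes_copy_of_l2] demands. *)
Definition Jmap N x z : Cc R :=
  if cabs z < 1 then pser (Jcoef N x) (fun k => (N k).+1) z else 0.

Lemma lacunary_ge N : lacunary N -> forall k, (2 ^ k * N 0 <= N k)%N.
Proof.
move=> [N0 HN]; elim=> [|k IH]; first by rewrite mul1n.
by apply: leq_trans (HN k); rewrite expnS -mulnA leq_mul2l.
Qed.

Lemma lacunary_ge_id N k : lacunary N -> (k <= N k)%N.
Proof.
move=> lN; apply: leq_trans (lacunary_ge lN k); case: lN => N0 _.
by apply: leq_trans (ltnW (ltn_expl k (ltnSn 1))) _; rewrite leq_pmulr.
Qed.

Lemma cabs_nat n : cabs (n%:R : Cc R) = n%:R.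
Proof. by rewrite -(rmorph_nat (real_complex R)) cabs_RC ger0_norm. Qed.

Lemma Jcoef_le N x (B : R) k : cabs (x k) <= B -> cabs (Jcoef N x k) <= B / (N k).+1%:R.
Proof.
move=> h; rewrite /Jcoef cabsM cabsV cabs_nat mulrC ler_wpM2r // invr_ge0 //.
Qed.

Lemma Jcoef_le' N x (B : R) k : cabs (x k) <= B -> cabs (Jcoef N x k) <= B.
Proof.
move=> h; have B0 : 0 <= B := le_trans (cabs_ge0 _) h.
by apply: (le_trans (Jcoef_le N h)); rewrite ler_pdivrMr ?ltr0n // ler_peMr // ler1n.
Qed.

Lemma gser_tail N x (B : R) z r L : lacunary N -> (forall k, cabs (x k) <= B) ->
  cabs z <= r -> r < 1 -> cabs (gser N x z - \sum_(k < L) x k * z ^+ N k) <= B * r ^+ L / (1 - r).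
Proof.
move=> lN hB zr r1; have z0 := cabs_ge0 z; have r0 : 0 <= r := le_trans z0 zr.
have B0 : 0 <= B := le_trans (cabs_ge0 _) (hB 0%N).
have q0 : 0 < 1 - r by rewrite subr_gt0.
have C := pser_cvg hB (fun k => lacunary_ge_id k lN) (le_lt_trans zr r1).
apply: (ccvg_le (L0 := L) C) => M LM.
have -> : M = (L + (M - L))%N by rewrite subnKC.
move: (M - L)%N => n.
have -> : psum (fun k => x k * z ^+ N k) (L + n) - \sum_(k < L) x k * z ^+ N k =
   \sum_(k < n) x (L + k)%N * z ^+ N (L + k)%N.
  elim: n => [|n IH]; first by rewrite addn0 big_ord0 subrr.
  by rewrite big_ord_recr -IH addnS /psum big_ord_recr /=; ring.
apply: (le_trans (cabs_sum _ _ _)).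
apply: (@le_trans _ _ (\sum_(k < n) B * r ^+ L * r ^+ k)).
  apply: ler_sum => k _; rewrite cabsM cabsX -mulrA -exprD ler_pM ?cabs_ge0 ?exprn_ge0 //.
  apply: (@le_trans _ _ (r ^+ N (L + k)%N)); first by rewrite lerXn2r ?nnegrE.
  by rewrite ler_wiXn2l ?(ltW r1) // lacunary_ge_id.
by rewrite -mulr_sumr ler_wpM2l ?mulr_ge0 ?exprn_ge0 // geom_sum_le // r0.
Qed.

Lemma Jmap_is_derive N x (B : R) z : lacunary N -> (forall k, cabs (x k) <= B) -> disk z ->
  is_derive z (1 : Cc R) (Jmap N x) (gser N x z).
Proof.
move=> lN hB hz.
apply: (@is_derive_eq_disk _ (pser (Jcoef N x) (fun k => (N k).+1))) => //.
  by move=> w hw; rewrite /Jmap hw.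
have -> : gser N x z = csum (fun k => Jcoef N x k * ((N k).+1%:R * z ^+ ((N k).+1).-1)).
  rewrite /gser /pser; congr csum; apply/funext => k; rewrite /Jcoef /=.
  have nz : ((N k).+1%:R : Cc R) != 0 by rewrite -cabs_gt0 cabs_nat ltr0n.
  by field.
apply: (@pser_is_derive _ _ _ B) => // k; first exact: Jcoef_le'.
exact: leqW (lacunary_ge_id k lN).
Qed.

Lemma gser_analytic N x (B : R) : lacunary N -> (forall k, cabs (x k) <= B) ->
  analytic_on_disk (gser N x).
Proof.
move=> lN hB z hz.
have := pser_is_derive hB (fun k => lacunary_ge_id k lN) hz.
exact: is_derive_derivable.
Qed.

Lemma Jmap0 N x : Jmap N x 0 = 0.
Proof.
rewrite /Jmap cabs0 ltr01 /pser (@csum_fin _ _ 0) /psum ?big_ord0 // => k _.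
by rewrite expr0n /= mulr0.
Qed.

Lemma cabs_lacsum N (x : nat -> Cc R) L r : cbmeas (fun t => \sum_(k < L) x k * polar r t ^+ N k).
Proof.
apply: cbmeas_sum => k; apply: cbmeasZ; apply: cbmeasX.
by apply: (@cbmeas_circ _ id) => t; apply: derivable_ccont; exact: derivable_id.
Qed.

(** A finite section obeys [lacunary_moment], and the rest of the series is at most s on the circle
    if the section is long enough. Its length depends on r, the constant does not. *)
Lemma gser_pmean q : 0 <= q -> exists2 K : R, 0 < K & forall N x r s, lacunary N -> in_l2 x ->
  0 <= r < 1 -> 0 < s -> l2_norm x <= s -> pmean q (gser N x) r <= K * s `^ q.
Proof.
move=> q0; have [K K0 HK] := lacunary_moment q0.
have P0 := pi2_gt0 R.
exists (2 `^ q * (K + 2 * pi)) => [|N x r s lN hx hr s0 xs].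
  by rewrite mulr_gt0 ?powR_gt0 // addr_gt0.
case/andP: (hr) => r0 r1.
have hB k : cabs (x k) <= s := le_trans (l2_coord k hx) xs.
have r01 : `|r| < 1 by rewrite ger0_norm.
have e0 : 0 < 1 - r by rewrite subr_gt0.
(* L is such that r^L < 1 - r, which makes the tail bound s r^L / (1 - r) at most s. *)
have /cvgrPdist_lt/(_ _ e0)[L _ /(_ L (leqnn L))] /= := cvg_geometric 1 r01.
rewrite sub0r normrN /geometric /= mul1r => /(le_lt_trans (ler_norm _)) hL.
pose u t := \sum_(k < L) x k * polar r t ^+ N k.
have cu : cbmeas u := cabs_lacsum N x L r.
have bu := bmeas_cabs_powR q0 cu.
have hu : itg 0 (2 * pi) (fun t => cabs (u t) `^ q) <= K * s `^ q.
  apply: HK => //; first by rewrite r0 ltW.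
  apply: (le_trans (l2_sum_le L hx)).
  by rewrite lerXn2r ?nnegrE ?l2_norm_ge0 // ltW.
apply: (@le_trans _ _ (itg 0 (2 * pi) (fun t => 2 `^ q * (cabs (u t) `^ q + s `^ q)))).
  apply: itg_le.
  - by apply: bmeas_cabs_powR => //; apply: analytic_cbmeas => //; exact: gser_analytic lN hB.
  - by apply: bmeasZ; apply: bmeasD => //; exact: bmeas_cst.
  move=> t _; apply: le_trans (powRD_le q0 (cabs_ge0 _) (ltW s0)).
  rewrite ge0_ler_powR ?nnegrE ?cabs_ge0 ?addr_ge0 ?cabs_ge0 ?(ltW s0) //.
  rewrite -[gser N x _](subrK (u t)) addrC (le_trans (cabsD _ _)) // lerD2l.
  have pr : cabs (polar r t) <= r by rewrite cabs_polar ger0_norm.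
  apply: (le_trans (gser_tail L lN hB pr r1)).
  by rewrite -mulrA ler_piMr ?(ltW s0) // ler_pdivrMr // mul1r ltW.
rewrite itgZ; last by apply: bmeasD => //; exact: bmeas_cst.
rewrite itgD //; last exact: bmeas_cst.
rewrite itg_cst ?(ltW P0) // subr0 -[leRHS]mulrA; apply: ler_wpM2l; first exact: powR_ge0.
by rewrite (mulrDl K) [s `^ q * _]mulrC; apply: lerD; [exact: hu|exact: lexx].
Qed.

(** The derivative of [Jmap N x] is [gser N x] and its value at 0 is 0, so the norm is the p-th root
    of the moment bound; K solves 2 pi K^p = K0. *)
Lemma Jmap_Sp : exists2 K : R, 0 < K & forall N x, lacunary N -> in_l2 x ->
  in_Sp p (Jmap N x) /\ Sp_norm p (Jmap N x) <= K * l2_norm x.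
Proof.
have P0 := pi2_gt0 R.
have [K0 K00 HK] := gser_pmean (ltW p0).
pose K := (K0 / (2 * pi)) `^ p^-1.
have Kp : 2 * pi * K `^ p = K0.
  rewrite /K -powRrM mulVf ?lt0r_neq0 // powRr1 ?divr_ge0 ?(ltW K00) ?(ltW P0) //.
  by rewrite mulrC mulfVK // lt0r_neq0.
have K1 : 0 < K by rewrite powR_gt0 // divr_gt0.
exists K => // N x lN hx.
have hB k : cabs (x k) <= l2_norm x := l2_coord k hx.
have ag := gser_analytic lN hB.
have D z : disk z -> is_derive z (1 : Cc R) (Jmap N x) (gser N x z).
  by move=> hz; exact: Jmap_is_derive lN hB hz.
have aJ : analytic_on_disk (Jmap N x) by move=> z /D; exact: is_derive_derivable.
have E z : disk z -> gser N x z = derive1 (Jmap N x) z by move=> /D/is_derive_derive1 ->.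
(* The moment bound needs a positive s, while the norm of x may be 0; s is let tend to the norm
   afterwards. *)
have H s : 0 < s -> l2_norm x <= s -> in_Hp p (gser N x) /\ Hp_norm p (gser N x) <= K * s.
  move=> s0 xs; apply: Hp_norm_le => // [|r hr]; first by rewrite mulr_ge0 // ltW.
  by rewrite powRM ?(ltW K1) ?(ltW s0) // mulrA Kp; exact: HK.
have n0 := l2_norm_ge0 x.
have [h1 _] : in_Hp p (gser N x) /\ Hp_norm p (gser N x) <= K * (l2_norm x + 1).
  by apply: H; lra.
have h2 : Hp_norm p (gser N x) <= K * l2_norm x.
  apply/ler_addgt0Pr => e e0; have e1 : 0 < e / K by rewrite divr_gt0.
  have [||_] := H (l2_norm x + e / K); [lra|lra|].
  by rewrite mulrDr mulrCA mulfV ?lt0r_neq0 // mulr1.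
have [h3 h4] := Hp_ext hp E h1.
split; first by split; [exact: aJ|exact: h3].
by rewrite /Sp_norm Jmap0 cabs0 add0r; exact: le_trans h4 h2.
Qed.

Lemma pser_lin b1 b2 m (B1 B2 : R) a c z : (forall k, cabs (b1 k) <= B1) ->
  (forall k, cabs (b2 k) <= B2) -> (forall k, (k <= m k)%N) -> cabs z < 1 ->
  pser (fun k => a * b1 k + c * b2 k) m z = a * pser b1 m z + c * pser b2 m z.
Proof.
move=> h1 h2 hm hz.
have c1 := pser_cvg h1 hm hz; have c2 := pser_cvg h2 hm hz.
have h3 k : cabs (a * b1 k + c * b2 k) <= cabs a * B1 + cabs c * B2.
  rewrite (le_trans (cabsD _ _)) // !cabsM lerD // ler_wpM2l ?cabs_ge0 //.
have c3 := pser_cvg h3 hm hz.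
apply: ccvg_unique c3 _; apply: ccvg_ext (ccvgD (ccvgZ a c1) (ccvgZ c c2)) => n.
by rewrite /psum !mulr_sumr -big_split /=; apply: eq_bigr => k _; ring.
Qed.

Lemma Jmap_lin N x y a b : lacunary N -> in_l2 x -> in_l2 y ->
  Jmap N (fun k => a * x k + b * y k) = fun z => a * Jmap N x z + b * Jmap N y z.
Proof.
move=> lN hx hy; apply/funext => z; rewrite /Jmap; case: ifP => hz; last by rewrite !mulr0 addr0.
have hm k : (k <= (N k).+1)%N := leqW (lacunary_ge_id k lN).
rewrite -(@pser_lin _ _ _ (l2_norm x) (l2_norm y)) //; last 2 first.
- by move=> k; apply: Jcoef_le'; exact: l2_coord.
- by move=> k; apply: Jcoef_le'; exact: l2_coord.
by rewrite /pser; congr csum; apply/funext => k; rewrite /Jcoef; ring.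
Qed.

End LacunaryEmbedding.

(** * The weighted composition operator *)

Section WeightedComposition.
Variables (R : realType) (p : R) (hp : 1 <= p) (phi vphi : Cc R -> Cc R).
Hypotheses (aphi : analytic_on_disk phi) (avphi : analytic_on_disk vphi)
  (selfv : self_map_disk vphi) (bT : bounded_on_Sp p (wcomp phi vphi)).
Implicit Types (z w c : Cc R) (f g F G : Cc R -> Cc R) (r s t : R).

Let p0 : 0 < p. Proof. exact: lt_le_trans hp. Qed.

Local Notation T := (wcomp phi vphi).
Definition symbol z : Cc R := phi z * derive1 vphi z.
Local Notation h := symbol.

Lemma cst_Hp c : in_Hp p (fun=> c).
Proof.
have [|||//] := @Hp_norm_le _ _ hp (fun=> c) (cabs c).
- by move=> z _; exact: derivable_cst.
- exact: cabs_ge0.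
- move=> r hr; rewrite /pmean itg_cst ?(ltW (pi2_gt0 R)) // subr0 mulrC; exact: lexx.
Qed.

Lemma affine_Sp a c : in_Sp p (fun z => a * z + c).
Proof.
have D z : is_derive z (1 : Cc R) (fun z => a * z + c) a.
  have := is_deriveD (is_deriveZ (a : R[i]) (is_derive_id (z : Cc R) (1 : Cc R))) (is_derive_cst c (z : Cc R) (1 : Cc R)).
  by rewrite /GRing.scale /= mulr1 addr0.
split; first by move=> z _; exact: is_derive_derivable (D z).
by have [] := Hp_ext hp (fun z _ => esym (is_derive_derive1 (D z))) (cst_Hp a).
Qed.

Lemma phi_Sp : in_Sp p phi.
Proof.
have h1 := bT.1 _ (affine_Sp 0 1).
by have [] := Sp_ext hp (f := T (fun z => 0 * z + 1)) (g := phi) (fun z _ => ltac:(by rewrite /wcomp mul0r add0r mulr1)) h1.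
Qed.

Lemma phivphi_Sp : in_Sp p (fun z => phi z * vphi z).
Proof.
have h1 := bT.1 _ (affine_Sp 1 0).
by have [] := Sp_ext hp (f := T (fun z => 1 * z + 0)) (g := fun z => phi z * vphi z)
  (fun z _ => ltac:(by rewrite /wcomp mul1r addr0)) h1.
Qed.

Lemma is_derive_mulC f g z c d : is_derive z (1 : Cc R) f c -> is_derive z (1 : Cc R) g d ->
  is_derive z (1 : Cc R) (fun z => f z * g z) (c * g z + f z * d).
Proof.
move=> hf hg; have H := is_deriveM hf hg.
have <- : f z *: d + g z *: c = c * g z + f z * d by rewrite /GRing.scale /=; ring.
exact: H.
Qed.

Lemma wcomp_is_derive f z : analytic_on_disk f -> disk z ->
  is_derive z (1 : Cc R) (T f) (derive1 phi z * f (vphi z) + h z * derive1 f (vphi z)).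
Proof.
move=> af hz.
have d1 := derivable_is_derive (aphi hz); have d2 := derivable_is_derive (avphi hz).
have d3 := derivable_is_derive (af _ (selfv hz)).
have := is_derive_mulC d1 (is_derive_comp d2 d3).
rewrite /symbol; move: (derive1 phi z) (derive1 vphi z) (derive1 f _) => c1 c2 c3.
have <- : c1 * f (vphi z) + phi z * (c3 * c2) = c1 * f (vphi z) + phi z * c2 * c3 by ring.
by [].
Qed.

(** Both derivatives on the left belong to functions in S^p, the images of z and of 1 under T, so
    they are analytic and lie in H^p by definition. Thus h inherits analyticity and bounded p-th
    means. *)
Lemma symbolE z : disk z ->
  derive1 (fun z => phi z * vphi z) z + - derive1 phi z * vphi z = h z.
Proof.
move=> hz.
have d1 := derivable_is_derive (aphi hz); have d2 := derivable_is_derive (avphi hz).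
rewrite (is_derive_derive1 (is_derive_mulC d1 d2)) /symbol.
by move: (derive1 phi z) (derive1 vphi z) => c1 c2; ring.
Qed.

Lemma symbol_analytic : analytic_on_disk h.
Proof.
apply: analytic_ext symbolE _ => z hz.
have [_ [a1 _]] := phivphi_Sp; have [_ [a2 _]] := phi_Sp.
have d1 := derivable_is_derive (a1 z hz); have d2 := derivable_is_derive (a2 z hz).
have d3 := derivable_is_derive (avphi hz).
exact: (is_derive_derivable (is_deriveD d1 (is_derive_mulC (is_deriveN d2) d3))).
Qed.

Lemma pmean_le2 F G H r : cbmeas (fun t => F (polar r t)) -> cbmeas (fun t => G (polar r t)) ->
  cbmeas (fun t => H (polar r t)) ->
  (forall t, cabs (F (polar r t)) <= cabs (G (polar r t)) + cabs (H (polar r t))) ->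
  pmean p F r <= 2 `^ p * (pmean p G r + pmean p H r).
Proof.
move=> cF cG cH le; have pp0 := ltW p0.
have bG := bmeas_cabs_powR pp0 cG; have bH := bmeas_cabs_powR pp0 cH.
rewrite /pmean -itgD // -itgZ; last exact: bmeasD.
apply: itg_le; [exact: bmeas_cabs_powR|by apply: bmeasZ; exact: bmeasD|].
move=> t _; apply: le_trans (powRD_le pp0 (cabs_ge0 _) (cabs_ge0 _)).
by rewrite ge0_ler_powR ?nnegrE ?addr_ge0 ?cabs_ge0.
Qed.

Lemma symbol_pmean : exists2 C : R, 0 <= C & forall r, 0 <= r < 1 -> pmean p h r <= C.
Proof.
have [_ hA] := phivphi_Sp; have [_ hB] := phi_Sp.
exists (2 `^ p * (2 * pi * Hp_norm p (derive1 (fun z => phi z * vphi z)) `^ p +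
   2 * pi * Hp_norm p (derive1 phi) `^ p)).
  by rewrite mulr_ge0 ?powR_ge0 // addr_ge0 // mulr_ge0 ?powR_ge0 // ltW // pi2_gt0.
move=> r hr; have [aA _] := hA; have [aB _] := hB.
apply: (@le_trans _ _ (2 `^ p * (pmean p (derive1 (fun z => phi z * vphi z)) r +
    pmean p (derive1 phi) r))); last first.
  by apply: ler_wpM2l; [exact: powR_ge0|apply: lerD; exact: pmean_le].
apply: pmean_le2; [exact: analytic_cbmeas symbol_analytic hr|exact: analytic_cbmeas aA hr|
  exact: analytic_cbmeas aB hr|].
move=> t; have dz := disk_polar t hr; rewrite -symbolE //.
apply: (le_trans (cabsD _ _)); apply: lerD; first exact: lexx.
by rewrite cabsM cabsN ler_piMr ?cabs_ge0 // ltW //; exact: selfv.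
Qed.

(** The part of the derivative of T f that contains f'; the other part is phi' (f o vphi). *)
Definition lifted f z : Cc R := h z * derive1 f (vphi z).

Lemma lifted_analytic f : in_Sp p f -> analytic_on_disk (lifted f).
Proof.
move=> [_ [af _]] z hz.
have d1 := derivable_is_derive (symbol_analytic hz).
have d2 := is_derive_comp (derivable_is_derive (avphi hz)) (derivable_is_derive (af _ (selfv hz))).
exact: (is_derive_derivable (is_derive_mulC d1 d2)).
Qed.

(** Solving the product rule for the term with f' leaves (T f)' and phi' (f o vphi), and the latter
    costs only the supremum of |f|. *)
Lemma lifted_pmean_le f (S : R) r : in_Sp p f -> 0 <= S -> (forall z, disk z -> cabs (f z) <= S) ->
  0 <= r < 1 -> pmean p (lifted f) r <=
  2 `^ p * (2 * pi * Sp_norm p (T f) `^ p + S `^ p * (2 * pi * Hp_norm p (derive1 phi) `^ p)).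
Proof.
move=> hf S0 HS hr; have [af _] := hf; have P0 := pi2_gt0 R; have pp0 := ltW p0.
have hTf := bT.1 _ hf; have [_ hdT] := hTf; have [adT _] := hdT.
have [_ hdphi] := phi_Sp; have [adphi _] := hdphi.
apply: (@le_trans _ _ (2 `^ p * (pmean p (derive1 (T f)) r + pmean p (fun z => S%:C%C * derive1 phi z) r))).
  have cphi := analytic_cbmeas adphi hr.
  apply: pmean_le2; [exact: analytic_cbmeas (lifted_analytic hf) hr|exact: analytic_cbmeas adT hr|
    exact: cbmeasZ cphi|].
  move=> t; have dz := disk_polar t hr.
  have E : derive1 (T f) (polar r t) = derive1 phi (polar r t) * f (vphi (polar r t)) + lifted f (polar r t).
    exact: is_derive_derive1 (wcomp_is_derive af dz).
  have gen (A B D : Cc R) : cabs A <= S * cabs D -> cabs B <= cabs (A + B) + cabs (S%:C%C * D).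
    move=> hA; rewrite cabsM cabs_RC ger0_norm //.
    have EB : B = (A + B) - A by ring.
    by rewrite {1}EB; have := cabsBD (A + B) A; lra.
  rewrite E; apply: gen; rewrite cabsM mulrC; apply: ler_wpM2r; first exact: cabs_ge0.
  by apply: HS; exact: selfv.
apply: ler_wpM2l; first exact: powR_ge0.
apply: lerD.
  apply: (le_trans (pmean_le hp hdT hr)); rewrite ler_pM2l //.
  rewrite ge0_ler_powR ?nnegrE ?Sp_norm_ge0 ?Hp_norm_ge0 // /Sp_norm lerDr cabs_ge0 //.
rewrite /pmean (@itg_eq _ _ _ _ (fun t => S `^ p * cabs (derive1 phi (polar r t)) `^ p)); last first.
  by move=> t _; rewrite cabsM cabs_RC ger0_norm // powRM ?cabs_ge0.
rewrite itgZ; last by apply: bmeas_cabs_powR => //; exact: analytic_cbmeas adphi hr.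
apply: ler_wpM2l; first exact: powR_ge0.
exact: (pmean_le hp hdphi hr).
Qed.

(** The shift by 2 starts the radii at 1/2, the range in which [boundary_mass_lower] is uniform. *)
Definition crad n : R := 1 - (n.+2%:R)^-1.

Lemma crad_itv n : 2^-1 <= crad n < 1.
Proof.
rewrite /crad; apply/andP; split; last by rewrite ltrBlDr ltrDl invr_gt0.
have : (n.+2%:R : R)^-1 <= 2^-1 by rewrite lef_pV2 ?posrE ?ltr0n // ler_nat.
by move: (n.+2%:R^-1) => x hx; lra.
Qed.

Lemma crad_itv0 n : 0 <= crad n < 1.
Proof. by have /andP[h1 ->] := crad_itv n; rewrite andbT; apply: le_trans h1. Qed.

Lemma crad_cvg (d : R) : 0 < d -> exists n0, forall n, (n0 <= n)%N -> 1 - d < crad n.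
Proof.
move=> d0; have [n0 _ H] := near_infty_natSinv_lt (PosNum d0).
exists n0 => n /H /= h; rewrite /crad ltrD2l ltrN2; apply: le_lt_trans h.
by rewrite lef_pV2 ?posrE ?ltr0n // ler_nat.
Qed.

Definition vn n t := vphi (polar (crad n) t).

Lemma vn_lt1 n t : cabs (vn n t) < 1.
Proof. by apply: selfv; apply: disk_polar; exact: crad_itv0. Qed.

Lemma vn_cbmeas n : cbmeas (vn n).
Proof. exact: analytic_cbmeas avphi (crad_itv0 n). Qed.

(* Egorov: on a set of positive measure |vphi| tends to 1 uniformly along the radii [crad n]. *)
Lemma contact_set : (0 < lebesgue_measure (E_set vphi))%E ->
  exists A : set R, [/\ measurable A, 0 < itg 0 (2 * pi) (\1_A) &
    forall e : R, 0 < e -> exists n0, forall n, (n0 <= n)%N -> forall t, A t -> 1 - e < cabs (vn n t)].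
Proof.
move=> HE; have P0 := pi2_gt0 R.
pose J : set R := `[0, 2 * pi]%classic.
pose B j m : set R := J `&` (fun t => cabs (vn m t)) @^-1` `]1 - (j.+1%:R)^-1, +oo[%classic.
(* The points at which |vphi| tends to 1 along [crad]. This set is measurable and contains
   [E_set vphi], so its measure is positive by monotonicity of the outer measure. *)
pose E' : set R := \bigcap_j \bigcup_n \bigcap_(m in [set m | (n <= m)%N]) B j m.
have mB j m : measurable (B j m).
  have [mv _] := cbmeas_cabs (vn_cbmeas m).
  exact: mv.
have mE' : measurable E'.
  apply: bigcapT_measurable => j; apply: bigcupT_measurable => n.
  by apply: bigcap_measurable => // ; exists n => /=.
have E'J : E' `<=` J.
  by move=> t /(_ 0%N I)[n _ /(_ n (leqnn n))[]].
have EE' : E_set vphi `<=` E'.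
  move=> t /= [/andP[t0 t2] [w [wc w1]]] j _.
  have j0 : 0 < (j.+1%:R : R)^-1 by rewrite invr_gt0.
  have : nbhs w [set u : Cc R | cabs (u - w) < (j.+1%:R : R)^-1] by apply/cnbhsP; exists (j.+1%:R^-1).
  move=> /wc [d /= d0 Hd].
  have [n0 Hn0] := crad_cvg d0.
  exists n0 => // m /= nm; split; first by rewrite /J /= in_itv /= t0 ltW.
  have /andP[_ r1] := crad_itv m.
  have := Hd (crad m); rewrite /ball /= gtr0_norm ?subr_gt0 // => /(_ _ r1).
  have h1 : 1 - crad m < d by have := Hn0 m nm; lra.
  move=> /(_ h1); rewrite -/(vn m t) => h2.
  rewrite /= in_itv /= andbT.
  move: h2 (cabsB_ge w (vn m t)); rewrite w1 cabsB; move: (j.+1%:R^-1) (cabs (_ - _)) => x1 x2; lra.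
have fE' : (lebesgue_measure E' < +oo)%E.
  apply: (@le_lt_trans _ _ (lebesgue_measure J)).
    by apply: le_measure => //; rewrite inE //; exact: measurable_itv.
  by rewrite /J /= lebesgue_measure_itv /= lte_fin P0 -EFinB ltry.
have pE' : (0 < lebesgue_measure E')%E by apply: lt_le_trans HE _; exact: le_outer_measure.
pose m0 := fine (lebesgue_measure E').
have Em0 : lebesgue_measure E' = m0%:E by rewrite /m0 fineK // ge0_fin_numE // ltW.
have m00 : 0 < m0 by rewrite -lte_fin -Em0.
(* The exceptional set C is allowed any measure below that of [E'], so a set of positive measure
   remains. *)
have [|||||C [mC hC uC]] := @pointwise_almost_uniform _ R _ (@lebesgue_measure R)
  (fun n t => cabs (vn n t)) (fun=> 1) E' m0.
- by move=> n; have [mv _] := cbmeas_cabs (vn_cbmeas n); exact: measurable_funS mv.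
- by [].
- by [].
- move=> t tE; apply/cvgrPdist_lt => e e0.
  have [j _ Hj] := near_infty_natSinv_lt (PosNum e0).
  have [n _ Hn] := tE j I.
  exists n => // m /= nm; have [_ /=] := Hn m nm; rewrite in_itv /= andbT => h1.
  have h2 : (j.+1%:R : R)^-1 < e := Hj j (leqnn j).
  move: h1 h2 (vn_lt1 m t); rewrite ltr_norml; move: (j.+1%:R^-1) => x; lra.
- exact: m00.
exists (E' `\` C); split; first exact: measurableD.
- rewrite /itg /Rintegral integral_indic //; last exact: measurableD.
  rewrite fine_gt0 //; apply/andP; split.
    rewrite (_ : (E' `\` C) `&` _ = E' `\` C); last by apply/setIidPl => t [/E'J].
    have MD : (lebesgue_measure (E' `\` C) = m0%:E - lebesgue_measure (E' `&` C))%E.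
      by rewrite -Em0; exact: measureD.
    suff pos : (0 < lebesgue_measure (E' `\` C))%E by exact: pos.
    rewrite MD sube_gt0; apply: le_lt_trans hC.
    by apply: le_measure; rewrite ?inE //; exact: measurableI.
  apply: le_lt_trans fE'; apply: le_measure; rewrite ?inE //.
    by apply: measurableI; [exact: measurableD|exact: measurable_itv].
  by move=> t [[]].
- move=> e e0.
  have : nbhs ((fun=> 1) : {uniform` (E' `\` C) -> R}) [set g : R -> R | forall t, (E' `\` C) t -> `|1 - g t| < e].
    apply/uniform_nbhs; exists [set xy : R * R | `|xy.1 - xy.2| < e]; split=> //.
    exact: (@entourage_ball R R (PosNum e0)).
  move=> /uC [n0 _ Hn0]; exists n0 => n nn t tA.
  have := Hn0 n nn t tA; rewrite ltr_norml; lra.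
Qed.

End WeightedComposition.

(** * The weights on the contact set and their correlations with powers of the self-map *)

Section BoundaryWeight.
Variables (R : realType) (p : R) (hp : 1 <= p) (phi vphi : Cc R -> Cc R).
Hypotheses (aphi : analytic_on_disk phi) (avphi : analytic_on_disk vphi)
  (selfv : self_map_disk vphi) (bT : bounded_on_Sp p (wcomp phi vphi)).
Implicit Types (z w c : Cc R) (f g F G : Cc R -> Cc R) (r s t : R) (x : nat -> Cc R) (N : nat -> nat).

Let p0 : 0 < p. Proof. exact: lt_le_trans hp. Qed.

Local Notation T := (wcomp phi vphi).
Local Notation h := (symbol phi vphi).
Local Notation v := (vn vphi).

(** Integration divides the k-th coefficient by N_k + 1 >= 2^k N_0, so the series is dominated by a
    geometric one. The decay in N_0 is what makes the term with phi' small. *)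
Lemma Jmap_sup N x z (B : R) : lacunary N -> (forall k, cabs (x k) <= B) -> disk z ->
  cabs (Jmap N x z) <= B * (2 / (N 0)%:R).
Proof.
move=> lN hB hz; have [N0 _] := lN.
have B0 : 0 <= B := le_trans (cabs_ge0 _) (hB 0%N).
have N0R : 0 < (N 0%N)%:R :> R by rewrite ltr0n.
rewrite /Jmap hz.
have C := pser_cvg (fun k => Jcoef_le' N (hB k)) (fun k => leqW (lacunary_ge_id k lN)) hz.
rewrite -[pser _ _ _]subr0; apply: (ccvg_le (L0 := 0%N) C) => L _.
rewrite subr0; apply: (le_trans (cabs_sum _ _ _)).
apply: (@le_trans _ _ (\sum_(k < L) B / (N 0%N)%:R * 2^-1 ^+ k)).
  apply: ler_sum => k _; rewrite cabsM cabsX.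
  apply: (@le_trans _ _ (B / (N k).+1%:R)).
    apply: le_trans (Jcoef_le N (hB k)); rewrite ler_piMr ?cabs_ge0 //.
    by rewrite exprn_ile1 ?cabs_ge0 // ltW.
  rewrite -mulrA ler_wpM2l // exprVn -invfM lef_pV2 ?posrE ?ltr0n ?mulr_gt0 ?exprn_gt0 //.
  by rewrite -natrX -natrM ler_nat mulnC; apply: leq_trans (lacunary_ge lN k) _.
rewrite -mulr_sumr -mulrA ler_wpM2l // mulrC ler_wpM2r ?invr_ge0 ?(ltW N0R) //.
have h2 : 0 <= (2^-1 : R) < 1 by lra.
have e2 : (1 - 2^-1 : R)^-1 = 2 by field.
by rewrite -[leRHS]e2; exact: geom_sum_le.
Qed.

Lemma derive1_Jmap N x (B : R) z : lacunary N -> (forall k, cabs (x k) <= B) -> disk z ->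
  derive1 (Jmap N x) z = gser N x z.
Proof. by move=> lN hB hz; exact: is_derive_derive1 (Jmap_is_derive lN hB hz). Qed.

Variables (A : set R) (mA : measurable A).

Definition wt n t : R := \1_A t * cabs (h (polar (crad R n) t)) `^ p.

Lemma h_cbmeas n : cbmeas (fun t => h (polar (crad R n) t)).
Proof.
exact: analytic_cbmeas (symbol_analytic hp aphi avphi bT) (crad_itv0 R n).
Qed.

Lemma wt_bmeas n : bmeas 0 (2 * pi) (wt n).
Proof.
apply: bmeasM; first exact: bmeas_indic.
exact: bmeas_cabs_powR (ltW p0) (h_cbmeas n).
Qed.

Lemma indic01 t : 0 <= (\1_A t : R) <= 1.
Proof. by rewrite indicE; case: (_ \in _); rewrite ?lexx ?ler01. Qed.

Lemma wt_ge0 n t : 0 <= wt n t.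
Proof. by have /andP[h1 _] := indic01 t; rewrite mulr_ge0 ?powR_ge0. Qed.

Lemma wt_mass : exists2 C : R, 0 <= C & forall n, itg 0 (2 * pi) (wt n) <= C.
Proof.
have [C C0 HC] := symbol_pmean hp aphi avphi selfv bT.
exists C => // n; apply: le_trans (HC _ (crad_itv0 R n)).
apply: itg_le; [exact: wt_bmeas|exact: bmeas_cabs_powR (ltW p0) (h_cbmeas n)|].
by move=> t _; have /andP[_ h1] := indic01 t; rewrite ler_piMl ?powR_ge0.
Qed.

(** Jensen's inequality bounds the mass of |h| on A from below, and [le_young] converts this into a
    bound for |h|^p. *)
Lemma wt_mass_lower z1 : disk z1 -> h z1 != 0 -> 0 < itg 0 (2 * pi) (\1_A) ->
  exists2 m : R, 0 < m & forall n, m <= itg 0 (2 * pi) (wt n).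
Proof.
move=> dz1 hz1 A0; have P0 := pi2_gt0 R.
have ah := symbol_analytic hp aphi avphi bT.
have [C C0 HC] := symbol_pmean hp aphi avphi selfv bT.
have [c c0 Hc] := boundary_mass_lower (2 * pi * 1 + 1 `^ (1 - p) * C) ah dz1 hz1 mA A0.
(* The constant k integrates to c / 2, so half of the lower bound c is left for the p-th powers. *)
pose k := c / (2 * (2 * pi)).
have k0 : 0 < k by rewrite divr_gt0 // mulr_gt0.
pose K := k `^ (1 - p).
have K0 : 0 < K by rewrite powR_gt0.
exists (c / 2 / K) => [|n]; first by rewrite !divr_gt0.
have hn := h_cbmeas n; have bh := cbmeas_cabs hn.
have bA : bmeas 0 (2 * pi) (\1_A : R -> R) by exact: bmeas_indic.
have h1 : itg 0 (2 * pi) (fun t => cabs (h (polar (crad R n) t))) <= 2 * pi * 1 + 1 `^ (1 - p) * C.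
  apply: (@le_trans _ _ (pmean 1 h (crad R n))).
    rewrite le_eqVlt; apply/orP; left; apply/eqP; apply: itg_eq => t _.
    by rewrite powRr1 ?cabs_ge0.
  apply: (le_trans (pmean1_le hp ah (crad_itv0 R n) ltr01)); rewrite lerD2l.
  by rewrite ler_wpM2l ?powR_ge0 // HC // crad_itv0.
have := Hc _ (crad_itv R n) h1 => h2.
have bw := wt_bmeas n.
have : itg 0 (2 * pi) (fun t => \1_A t * cabs (h (polar (crad R n) t))) <=
   itg 0 (2 * pi) (fun t => k + K * wt n t).
  apply: itg_le; [exact: bmeasM|by apply: bmeasD; [exact: bmeas_cst|exact: bmeasZ]|].
  move=> t _; rewrite /wt indicE; case: (_ \in _); rewrite ?mul1r ?mul0r ?mulr0 ?addr0 ?(ltW k0) //.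
  by apply: le_young => //; exact: cabs_ge0.
rewrite itgD; [|exact: bmeas_cst|exact: bmeasZ].
rewrite itg_cst ?(ltW P0) // subr0 itgZ // => h3.
have ek : k * (2 * pi) = c / 2.
  by rewrite /k; move: (lt0r_neq0 P0); move: (2 * pi) => P hP; field.
rewrite ler_pdivrMr // mulrC; move: (le_trans h2 h3); rewrite ek; lra.
Qed.

Lemma vn_pow_cbmeas n k : cbmeas (fun t => v n t ^+ k).
Proof. by apply: cbmeasX; exact: vn_cbmeas avphi n. Qed.

(** The k-th moment of the image under vphi of the measure with density [wt n]. Its smallness for
    large k is a Riemann-Lebesgue property, uniform enough to select exponents. *)
Definition corr n k : Cc R := cint (fun t => (wt n t)%:C%C * v n t ^+ k).

Lemma lifted_Jmap_pmean : exists2 C : R, 0 <= C & forall N x n, lacunary N -> in_l2 x ->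
  l2_norm x <= 1 -> pmean p (lifted phi vphi (Jmap N x)) (crad R n) <= C.
Proof.
have P0 := pi2_gt0 R.
have [K K0 HK] := Jmap_Sp hp; have [c Hc] := bT.2.
exists (2 `^ p * (2 * pi * (`|c| * K) `^ p + 2 `^ p * (2 * pi * Hp_norm p (derive1 phi) `^ p))).
  by rewrite mulr_ge0 ?powR_ge0 // addr_ge0 ?mulr_ge0 ?powR_ge0 ?(ltW P0) ?pi_ge0.
move=> N x n lN hx x1.
have [hJ nJ] := HK N x lN hx.
have hB k : cabs (x k) <= 1 := le_trans (l2_coord k hx) x1.
have sup z : disk z -> cabs (Jmap N x z) <= 2.
  move=> hz; apply: (le_trans (Jmap_sup lN hB hz)); rewrite mul1r.
  by case: lN => N0 _; rewrite ler_pdivrMr ?ltr0n // ler_peMr // ler1n.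
have t0 : (0 : R) <= 2 by [].
apply: (le_trans (lifted_pmean_le hp aphi avphi selfv bT hJ t0 sup (crad_itv0 R n))).
apply: ler_wpM2l; first exact: powR_ge0.
rewrite lerD2r ler_pM2l // ge0_ler_powR ?nnegrE ?Sp_norm_ge0 ?mulr_ge0 ?(ltW K0) ?(ltW p0) //.
apply: (le_trans (Hc _ hJ)).
apply: (@le_trans _ _ (`|c| * Sp_norm p (Jmap N x))).
  by rewrite ler_wpM2r ?Sp_norm_ge0 // ler_norm.
rewrite ler_wpM2l //; apply: (le_trans nJ); rewrite ler_piMr // ltW //.
Qed.

Lemma gser_fin N x L z : (forall k, (L <= k)%N -> x k = 0) ->
  gser N x z = \sum_(k < L) x k * z ^+ N k.
Proof. by move=> hx; rewrite /gser /pser (@csum_fin _ _ L) // => k /hx ->; rewrite mul0r. Qed.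

Lemma cint_wt_le n (u : R -> Cc R) : cbmeas u ->
  cabs (cint (fun t => (wt n t)%:C%C * u t)) <= itg 0 (2 * pi) (fun t => wt n t * cabs (u t)).
Proof.
move=> cu; apply: le_trans (cabs_cint _) _.
  by apply: cbmeasM => //; apply: cbmeas_RC; exact: wt_bmeas.
rewrite le_eqVlt; apply/orP; left; apply/eqP; apply: itg_eq => t _.
by rewrite cabsM cabs_RC ger0_norm ?wt_ge0.
Qed.

(** On A the left integrand is |h (g o vphi)|^p, and off A it is 0. *)
Lemma wt_lifted_le N x n : lacunary N -> in_l2 x ->
  itg 0 (2 * pi) (fun t => wt n t * cabs (gser N x (v n t)) `^ p) <=
  pmean p (lifted phi vphi (Jmap N x)) (crad R n).
Proof.
move=> lN hx; have [K K0 HK] := Jmap_Sp hp; have [hJ _] := HK N x lN hx.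
have hB k := l2_coord k hx.
have dv n' t : disk (v n' t) by exact: vn_lt1.
have cg : cbmeas (fun t => gser N x (v n t)).
  apply: (@analytic_cbmeas _ (fun z => gser N x (vphi z))); last exact: crad_itv0.
  move=> z hz; apply: is_derive_derivable.
  exact: is_derive_comp (derivable_is_derive (avphi hz))
    (derivable_is_derive (gser_analytic lN hB (selfv hz))).
apply: itg_le.
- by apply: bmeasM; [exact: wt_bmeas|exact: bmeas_cabs_powR (ltW p0) cg].
- apply: bmeas_cabs_powR (ltW p0) _.
  exact: analytic_cbmeas (lifted_analytic hp aphi avphi selfv bT hJ) (crad_itv0 R n).
move=> t _; rewrite /lifted -/(v n t) (derive1_Jmap lN hB) //.
rewrite cabsM powRM ?cabs_ge0 // /wt -mulrA.
have /andP[_ h1] := indic01 t.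
by rewrite ler_piMl ?mulr_ge0 ?powR_ge0.
Qed.

Lemma cabs_conj z : cabs (z^*)%C = cabs z.
Proof. by case: z => a b; rewrite /cabs /= sqrrN. Qed.

(** Duality: testing the correlations against their own normalized conjugates gives the root of
    their square sum as the integral of wt (g o vphi), where g is a lacunary sum with coefficients
    of norm at most 1. As y <= 1 + y^p, it is bounded by the mass of the weight plus its p-th moment
    of g o vphi. *)
Lemma bessel : exists2 C : R, 0 <= C & forall N Q n, lacunary N ->
  \sum_(i < Q) cabs (corr n (N i)) ^+ 2 <= C ^+ 2.
Proof.
have [Ch Ch0 HCh] := wt_mass; have [Cb Cb0 HCb] := lifted_Jmap_pmean.
exists (Ch + Cb) => [|N Q n lN]; first by rewrite addr_ge0.
set S := \sum_(i < Q) _.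
have S0 : 0 <= S by apply: sumr_ge0 => i _; rewrite sqr_ge0.
have [SZ|SP] := eqVneq S 0; first by rewrite SZ sqr_ge0.
have Sp : 0 < S by rewrite lt_def SP.
pose s := Num.sqrt S.
have s0 : 0 < s by rewrite sqrtr_gt0.
have ss : s ^+ 2 = S by rewrite sqr_sqrtr.
(* Normalized so that the squares |x_k|^2 sum to 1 and the sum of x_k times the k-th correlation is
   s. *)
pose x k : Cc R := if (k < Q)%N then (s^-1)%:C%C * ((corr n (N k))^*)%C else 0.
have xk (k : 'I_Q) : x k = (s^-1)%:C%C * ((corr n (N k))^*)%C by rewrite /x ltn_ord.
have xsum L : \sum_(k < L) cabs (x k) ^+ 2 <= 1 ^+ 2.
  have E : \sum_(k < Q) cabs (x k) ^+ 2 = 1.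
    rewrite (eq_bigr (fun k : 'I_Q => s^-1 ^+ 2 * cabs (corr n (N k)) ^+ 2)) => [|k _].
      by rewrite -mulr_sumr -/S -ss -exprMn mulVf ?expr1n // gt_eqF.
    by rewrite xk cabsM cabs_RC cabs_conj exprMn ger0_norm // invr_ge0 ltW.
  rewrite expr1n -E; have [LQ|/ltnW QL] := leqP L Q.
    rewrite (big_ord_widen Q (fun k => cabs (x k) ^+ 2) LQ) big_mkcond /=.
    by apply: ler_sum => k _; case: ifP => // _; rewrite sqr_ge0.
  rewrite (big_ord_widen L (fun k => cabs (x k) ^+ 2) QL) [leRHS]big_mkcond /=.
  apply: ler_sum => k _; case: ifP => // /negbT; rewrite -leqNgt /x ltnNge => ->.
  by rewrite /= cabs0 expr0n.
have [hx x1] := l2_bound ler01 xsum.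
have hx0 k : (Q <= k)%N -> x k = 0 by rewrite /x ltnNge => ->.
have hB k := l2_coord k hx.
have cg : cbmeas (fun t => gser N x (v n t)).
  apply: (@cbmeas_ext _ (fun t => \sum_(k < Q) x k * v n t ^+ N k)).
    by move=> t; rewrite (gser_fin N _ hx0).
  by apply: cbmeas_sum => k; apply: cbmeasZ; exact: vn_pow_cbmeas.
have cw : cbmeas (fun t => (wt n t)%:C%C) by apply: cbmeas_RC; exact: wt_bmeas.
have E : s%:C%C = cint (fun t => (wt n t)%:C%C * gser N x (v n t)).
  transitivity (\sum_(k < Q) x k * corr n (N k)).
    rewrite (eq_bigr (fun k : 'I_Q => (s^-1 * cabs (corr n (N k)) ^+ 2)%:C%C)) => [|k _].
      rewrite -rmorph_sum -mulr_sumr -/S -ss expr2 mulKf // gt_eqF //.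
    rewrite xk rmorphM -mulrA; congr (_ * _).
    case: (corr n (N k)) => a b; rewrite /cabs /= sqr_sqrtr ?addr_ge0 ?sqr_ge0 //.
    by apply: complex_ext; rewrite ?cReM ?cImM /=; ring.
  rewrite (@cint_eq _ _ (fun t => \sum_(k < Q) x k * ((wt n t)%:C%C * v n t ^+ N k))); last first.
    move=> t _; rewrite (gser_fin N _ hx0) mulr_sumr; apply: eq_bigr => k _; exact: mulrCA.
  rewrite (@cint_sum _ _ _ (fun (k : 'I_Q) t => x k * ((wt n t)%:C%C * v n t ^+ N k))).
    by apply: eq_bigr => k _; rewrite cintZ //; apply: cbmeasM => //; exact: vn_pow_cbmeas.
  by move=> k; apply: cbmeasZ; apply: cbmeasM => //; exact: vn_pow_cbmeas.
have bw := wt_bmeas n.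
have bgp := bmeasM bw (bmeas_cabs_powR (ltW p0) cg).
have : s <= Ch + Cb.
  have -> : s = cabs (s%:C%C) by rewrite cabs_RC gtr0_norm.
  rewrite E; apply: (le_trans (cint_wt_le n cg)).
  apply: (@le_trans _ _ (itg 0 (2 * pi) (fun t => wt n t + wt n t * cabs (gser N x (v n t)) `^ p))).
    apply: itg_le; [exact: bmeasM bw (cbmeas_cabs cg)|exact: bmeasD bw bgp|].
    move=> t _; rewrite -[X in X + _]mulr1 -mulrDr ler_wpM2l ?wt_ge0 //.
    have := le_young hp ltr01 (cabs_ge0 (gser N x (v n t))).
    by rewrite powR1 mul1r.
  rewrite itgD //; apply: lerD; first exact: HCh.
  by apply: (le_trans (wt_lifted_le n lN hx)); exact: HCb.
by move=> sC; rewrite -ss lerXn2r ?nnegrE ?addr_ge0 // ltW.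
Qed.

Lemma filter_forall_lt (U : set_system nat) (P : nat -> set nat) L : Filter U ->
  (forall k, (k < L)%N -> U (P k)) -> U [set n | forall k, (k < L)%N -> P k n].
Proof.
move=> FU; elim: L => [|L IH] H; first by apply: filterS filterT.
apply: filterS (filterI (IH (fun k hk => H k (ltnW hk))) (H L (ltnSn L))) => n [h1 h2] k.
by rewrite ltnS leq_eqVlt => /predU1P[->|/h1].
Qed.

(* Many exponents with a large correlation along the ultrafilter would contradict [bessel]. *)
Lemma corr_small (U : set_system nat) : UltraFilter U -> forall d : R, 0 < d ->
  exists n0, forall k, (n0 <= k)%N -> U [set n | cabs (corr n k) <= d].
Proof.
move=> UU d d0; apply: contrapT => NE.
have bad n0 : exists k, (n0 <= k)%N /\ U [set n | d < cabs (corr n k)].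
  apply: contrapT => H; apply: NE; exists n0 => k hk.
  have [//|h1] := in_ultra_setVsetC [set n | cabs (corr n k) <= d] UU.
  exfalso; apply: H; exists k; split=> //; apply: filterS h1 => n /= /negP.
  by rewrite -ltNge.
pose b n0 := projT1 (cid (bad n0)).
have bP n0 : (n0 <= b n0)%N /\ U [set n | d < cabs (corr n (b n0))].
  by rewrite /b; case: (cid (bad n0)).
(* Each bad exponent is sought beyond twice the previous one, which makes the sequence lacunary;
   starting from [b 1] keeps the first exponent positive. *)
pose N := fix N k := if k is j.+1 then b (2 * N j)%N else b 1%N.
have lN : lacunary N.
  by split=> [|k]; [have [] := bP 1%N|have [] := bP (2 * N k)%N].
have UN i : U [set n | d < cabs (corr n (N i))].
  by case: i => [|i]; [have [] := bP 1%N|have [] := bP (2 * N i)%N].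
have [C C0 HC] := bessel.
(* Q bad exponents, all bad at one common n, have squared correlations summing to at least Q d^2 >
   C^2. *)
pose Q := (Num.Def.truncn (C ^+ 2 / d ^+ 2)).+1.
have HQ : C ^+ 2 < Q%:R * d ^+ 2.
  by rewrite -ltr_pdivrMr ?exprn_gt0 // truncnS_gt.
have UQ q : U [set n | forall i, (i < q)%N -> d < cabs (corr n (N i))].
  exact: (@filter_forall_lt U (fun i => [set n | d < cabs (corr n (N i))])).
have [n Hn] := @filter_ex _ _ _ _ (UQ Q).
have := HC N Q n lN; rewrite leNgt => /negP; apply.
apply: lt_le_trans HQ _; rewrite mulr_natl -[X in _ *+ X]card_ord -sumr_const.
apply: ler_sum => i _; rewrite lerXn2r ?nnegrE ?cabs_ge0 ?(ltW d0) //.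
by apply: ltW; exact: Hn.
Qed.

End BoundaryWeight.

(** * Lower bounds for sparse sums *)

Section CubePrimitive.
Variables (R : realType) (p : R) (hp : 1 <= p).
Implicit Types (z w c : Cc R) (r s t : R) (x : nat -> Cc R) (N : nat -> nat).

Let p0 : 0 < p. Proof. exact: lt_le_trans hp. Qed.

Lemma cube_sum (S : comPzRingType) (u : nat -> S) L : (\sum_(i < L) u i) ^+ 3 =
  \sum_(i < L) \sum_(j < L) \sum_(k < L) u i * u j * u k.
Proof.
rewrite (_ : _ ^+ 3 = (\sum_(i < L) u i) * (\sum_(i < L) u i) * (\sum_(i < L) u i)); last by rewrite !exprS expr0 mulr1 mulrA.
rewrite big_distrlr /= big_distrl /=; apply: eq_bigr => i _.
rewrite big_distrl /=; apply: eq_bigr => j _; by rewrite big_distrr.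
Qed.

Lemma is_derive_sum_fun (F : nat -> Cc R -> Cc R) (dF : nat -> Cc R) z L :
  (forall i, is_derive z (1 : Cc R) (F i) (dF i)) ->
  is_derive z (1 : Cc R) (fun w => \sum_(i < L) F i w) (\sum_(i < L) dF i).
Proof.
move=> H; elim: L => [|L IH].
  rewrite big_ord0 (_ : (fun w => _) = fun=> (0 : Cc R)); first exact: is_derive_cst.
  by apply/funext => w; rewrite big_ord0.
rewrite big_ord_recr /= (_ : (fun w => _) = fun w => \sum_(i < L) F i w + F L w).
  exact: is_deriveD IH (H L).
by apply/funext => w; rewrite big_ord_recr.
Qed.

Lemma is_derive_mono z n : is_derive z (1 : Cc R) (fun w => w ^+ n.+1) (n.+1%:R * z ^+ n).
Proof.
have Did : is_derive z (1 : Cc R) (fun w : Cc R => w) (1 : Cc R) by exact: is_derive_id.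
elim: n => [|n IH].
  by rewrite expr0 mulr1.
have := is_derive_mulC Did IH.
have -> : 1 * z ^+ n.+1 + z * (n.+1%:R * z ^+ n) = n.+2%:R * z ^+ n.+1.
  by rewrite -(natr1 n.+1) exprS; ring.
by congr (is_derive _ _ _ _); apply/funext => w; rewrite [in RHS]exprS.
Qed.

(** The ratio 8 = 2^3 serves triple sums: N_i + N_j + N_k then grows at least like 2^(i+j+k), and
    the series for the primitive of g^3 is summable with a bound free of its length. *)
Definition octlacunary N := (0 < N 0)%N /\ forall k, (8 * N k <= N k.+1)%N.

Lemma octlacunary_lacunary N : octlacunary N -> lacunary N.
Proof. by move=> [N0 HN]; split=> // k; apply: leq_trans (HN k); rewrite leq_mul2r orbT. Qed.

Lemma octlacunary_ge N k : octlacunary N -> (8 ^ k <= N k)%N.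
Proof.
move=> [N0 HN]; elim: k => [|k IH]; first by [].
by apply: leq_trans (HN k); rewrite expnS leq_mul2l.
Qed.

(** The largest of the three indices is at least their mean, and 8^m = 2^(3m). *)
Lemma octlacunary_sum_ge N i j k : octlacunary N -> (2 ^ (i + j + k) <= N i + N j + N k)%N.
Proof.
move=> oN.
have H m : (i + j + k <= 3 * m)%N -> (2 ^ (i + j + k) <= N m)%N.
  move=> h; apply: leq_trans (octlacunary_ge m oN).
  by rewrite -[8%N]/((2 ^ 3)%N) -expnM leq_exp2l.
have [h|[h|h]] : ((i + j + k <= 3 * i) \/ (i + j + k <= 3 * j) \/ (i + j + k <= 3 * k))%N by lia.
- by apply: leq_trans (H _ h) _; rewrite -addnA leq_addr.
- by apply: leq_trans (H _ h) _; rewrite addnAC leq_addl.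
- by apply: leq_trans (H _ h) _; rewrite leq_addl.
Qed.

(** The primitive, vanishing at 0, of the cube of the lacunary polynomial with coefficients x_k, k <
    L. *)
Definition cube_prim N x L z : Cc R :=
  \sum_(i < L) \sum_(j < L) \sum_(k < L)
    ((N i + N j + N k).+1%:R^-1 * (x i * x j * x k)) * z ^+ (N i + N j + N k).+1.

Lemma cube_prim_is_derive N x L z : (forall k, (L <= k)%N -> x k = 0) ->
  is_derive z (1 : Cc R) (cube_prim N x L) (gser N x z ^+ 3).
Proof.
move=> hx.
have -> : gser N x z ^+ 3 = \sum_(i < L) \sum_(j < L) \sum_(k < L)
    ((N i + N j + N k).+1%:R^-1 * (x i * x j * x k)) * ((N i + N j + N k).+1%:R * z ^+ (N i + N j + N k)).
  rewrite (gser_fin N _ hx) (cube_sum (fun i => x i * z ^+ N i)).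
  apply: eq_bigr => i _; apply: eq_bigr => j _; apply: eq_bigr => k _.
  set n := (N i + N j + N k)%N.
  have nz : (n.+1%:R : Cc R) != 0 by rewrite -cabs_gt0 cabs_nat ltr0n.
  have -> : n.+1%:R^-1 * (x i * x j * x k) * (n.+1%:R * z ^+ n) =
     n.+1%:R^-1 * n.+1%:R * (x i * x j * x k * z ^+ n) by ring.
  by rewrite mulVf // mul1r /n !exprD; ring.
rewrite /cube_prim.
pose G i j k z := ((N i + N j + N k).+1%:R^-1 * (x i * x j * x k)) * z ^+ (N i + N j + N k).+1 : Cc R.
pose dG i j k := ((N i + N j + N k).+1%:R^-1 * (x i * x j * x k)) *
  ((N i + N j + N k).+1%:R * z ^+ (N i + N j + N k)) : Cc R.
apply: (is_derive_sum_fun (F := fun i z => \sum_(j < L) \sum_(k < L) G i j k z)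
  (dF := fun i => \sum_(j < L) \sum_(k < L) dG i j k)) => i.
apply: (is_derive_sum_fun (F := fun j z => \sum_(k < L) G i j k z)
  (dF := fun j => \sum_(k < L) dG i j k)) => j.
apply: (is_derive_sum_fun (F := G i j) (dF := dG i j)) => k.
exact: (is_deriveZ _ (is_derive_mono z _)).
Qed.

(** The coefficients are at most 2^(-(i+j+k)), so the triple sum is bounded by the cube of a
    geometric sum, 2^3. *)
Lemma cube_prim_sup N x L z : octlacunary N -> (forall k, cabs (x k) <= 1) -> disk z ->
  cabs (cube_prim N x L z) <= 8.
Proof.
move=> oN hx hz.
have z1 : cabs z <= 1 := ltW hz.
have h2 : 0 <= (2^-1 : R) < 1 by lra.
have e2 : (1 - 2^-1 : R)^-1 = 2 by field.
have G := geom_sum_le L h2; rewrite e2 in G.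
have G0 : 0 <= \sum_(i < L) (2^-1 : R) ^+ i by apply: sumr_ge0 => i _; rewrite exprn_ge0.
apply: (@le_trans _ _ ((\sum_(i < L) 2^-1 ^+ i) ^+ 3)); last first.
  have -> : (8 : R) = 2 ^+ 3 by rewrite -natrX.
  by rewrite lerXn2r ?nnegrE.
rewrite (cube_sum (fun i => 2^-1 ^+ i : R)).
apply: (le_trans (cabs_sum _ _ _)); apply: ler_sum => i _.
apply: (le_trans (cabs_sum _ _ _)); apply: ler_sum => j _.
apply: (le_trans (cabs_sum _ _ _)); apply: ler_sum => k _.
rewrite cabsM cabsM cabsV cabs_nat cabsX -!exprD.
apply: (@le_trans _ _ (((N i + N j + N k).+1%:R)^-1 * 1 * 1)).
  apply: ler_pM; rewrite ?mulr_ge0 ?exprn_ge0 ?invr_ge0 ?exprn_ile1 ?cabs_ge0 //.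
  by rewrite ler_wpM2l ?invr_ge0 // !cabsM !mulr_ile1 ?mulr_ge0 ?cabs_ge0.
rewrite !mulr1 exprVn lef_pV2 ?posrE ?ltr0n ?exprn_gt0 // -natrX ler_nat.
exact: leqW (octlacunary_sum_ge i j k oN).
Qed.

(** The p-th mean of g^3 is the mean of g of order 3p, which lacunarity bounds by the norm of x;
    hence K depends neither on N nor on L. *)
Lemma cube_prim_Sp : exists2 K : R, 0 <= K & forall N x L, octlacunary N ->
  (forall k, (L <= k)%N -> x k = 0) -> in_l2 x -> l2_norm x <= 1 ->
  in_Sp p (cube_prim N x L) /\ Sp_norm p (cube_prim N x L) <= K.
Proof.
have P0 := pi2_gt0 R.
have p30 : 0 <= 3 * p by rewrite mulr_ge0 ?(ltW p0).
have [K0 K00 HK] := gser_pmean p30.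
pose K := (K0 / (2 * pi)) `^ p^-1.
have Kp : 2 * pi * K `^ p = K0.
  rewrite /K -powRrM mulVf ?lt0r_neq0 // powRr1 ?divr_ge0 ?(ltW K00) ?(ltW P0) //.
  by rewrite mulrC mulfVK // lt0r_neq0.
have Kge : 0 <= K := powR_ge0 _ _.
exists (8 + K) => [|N x L oN hx0 hx x1]; first by rewrite addr_ge0.
have lN := octlacunary_lacunary oN.
have hB k : cabs (x k) <= 1 := le_trans (l2_coord k hx) x1.
have D z : disk z -> is_derive z (1 : Cc R) (cube_prim N x L) (gser N x z ^+ 3).
  by move=> _; exact: cube_prim_is_derive.
have aG : analytic_on_disk (fun z => gser N x z ^+ 3).
  move=> z hz; have D1 := derivable_is_derive (gser_analytic lN hB hz).
  exact: (is_derive_derivable (is_derive_comp D1 (is_derive_mono _ 2))).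
have [h1 h2] : in_Hp p (fun z => gser N x z ^+ 3) /\ Hp_norm p (fun z => gser N x z ^+ 3) <= K.
  apply: Hp_norm_le => // r hr.
  rewrite Kp; have := HK N x r 1 lN hx hr ltr01 x1; rewrite powR1 mulr1.
  apply: le_trans; rewrite le_eqVlt; apply/orP; left; apply/eqP; apply: itg_eq => t _.
  by rewrite cabsX -powR_mulrn ?cabs_ge0 // -powRrM.
have [h3 h4] := Hp_ext hp (fun z hz => esym (is_derive_derive1 (D z hz))) h1.
split.
  by split; [move=> z hz; exact: is_derive_derivable (D z hz)|exact: h3].
rewrite /Sp_norm; apply: lerD; last by apply: le_trans h4 h2.
apply: cube_prim_sup => //; by rewrite /disk /mkset cabs0.
Qed.

End CubePrimitive.

(** * Almost orthogonality of powers of the self-map and the lower bound for finite sums *)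

Section LowerBound.
Variables (R : realType) (p : R) (hp : 1 <= p) (phi vphi : Cc R -> Cc R).
Hypotheses (aphi : analytic_on_disk phi) (avphi : analytic_on_disk vphi)
  (selfv : self_map_disk vphi) (bT : bounded_on_Sp p (wcomp phi vphi)).
Variables (A : set R) (mA : measurable A).
Hypothesis contactA : forall e : R, 0 < e ->
  exists n0, forall n, (n0 <= n)%N -> forall t, A t -> 1 - e < cabs (vn vphi n t).
Variables (m0 : R) (m00 : 0 < m0) (mass_lower : forall n, m0 <= itg 0 (2 * pi) (wt p phi vphi A n)).
Implicit Types (z w c : Cc R) (f g : Cc R -> Cc R) (r s t : R) (x : nat -> Cc R) (N : nat -> nat).

Let p0 : 0 < p. Proof. exact: lt_le_trans hp. Qed.

Local Notation T := (wcomp phi vphi).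
Local Notation v := (vn vphi).
Local Notation wt := (wt p phi vphi A).
Local Notation corr := (corr p phi vphi A).
Let bw n : bmeas 0 (2 * pi) (wt n). Proof. exact: wt_bmeas. Qed.
Let cw n : cbmeas (fun t => (wt n t)%:C%C). Proof. by apply: cbmeas_RC. Qed.
Let wtE n t : wt n t = \1_A t * cabs (symbol phi vphi (polar (crad R n) t)) `^ p. Proof. by []. Qed.
Let corrE n k : corr n k = cint (fun t => (wt n t)%:C%C * v n t ^+ k). Proof. by []. Qed.
Let w0 n t : 0 <= wt n t. Proof. exact: wt_ge0. Qed.

Lemma conjE z : z * (z^*)%C = (cabs z ^+ 2)%:C%C.
Proof. by rewrite sqr_cabs; case: z => a b; apply: complex_ext; rewrite ?cReM ?cImM /=; ring. Qed.

Lemma conjM z w : ((z * w)^*)%C = (z^*)%C * (w^*)%C.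
Proof. exact: rmorphM. Qed.

Lemma conjX z k : ((z ^+ k)^*)%C = (z^*)%C ^+ k.
Proof. exact: rmorphXn. Qed.

Lemma conj_sum L (u : nat -> Cc R) : ((\sum_(k < L) u k)^*)%C = \sum_(k < L) ((u k)^*)%C.
Proof. exact: rmorph_sum. Qed.

Lemma cbmeas_conj (u : R -> Cc R) : cbmeas u -> cbmeas (fun t => ((u t)^*)%C).
Proof.
move=> [h1 h2]; split.
  by apply: bmeas_ext h1 => t; case: (u t).
by apply: bmeas_ext (bmeasN h2) => t; case: (u t).
Qed.

Lemma one_sub_pow (a : R) m : 0 <= a <= 1 -> 1 - a ^+ m <= m%:R * (1 - a).
Proof.
move=> /andP[a0 a1]; elim: m => [|m IH]; first by rewrite expr0 mul0r subrr.
have h : 0 <= m%:R * (1 - a) by rewrite mulr_ge0 // subr_ge0.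
have : a * (1 - a ^+ m) <= m%:R * (1 - a).
  apply: le_trans IH; rewrite ler_piMl // subr_ge0 exprn_ile1 //.
rewrite -natr1 exprS; lra.
Qed.

Lemma contact_pow m (e : R) : 0 < e ->
  \forall n \near \oo, forall t, A t -> 1 - cabs (v n t) ^+ m <= e.
Proof.
move=> e0; have d0 : 0 < e / m.+1%:R by rewrite divr_gt0.
have [n0 Hn] := contactA d0; exists n0 => // n /= hn t At.
have v1 : 0 <= cabs (v n t) <= 1 by rewrite cabs_ge0 ltW //; exact: vn_lt1.
apply: (le_trans (one_sub_pow m v1)).
have h := Hn n hn t At.
apply: (@le_trans _ _ (m.+1%:R * (1 - cabs (v n t)))).
  by rewrite ler_wpM2r ?subr_ge0 ?ler_nat //; case/andP: v1.
by rewrite mulrC -ler_pdivlMr // ltW // ltrBlDr addrC -ltrBlDr.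
Qed.

(** v^N1 conj(v)^N2 = v^(N1-N2) |v|^(2 N2), and on A the last factor differs from 1 by at most e. *)
Lemma cross_le n (N1 N2 : nat) (e C : R) : (N2 <= N1)%N -> 0 <= e ->
  (forall t, A t -> 1 - cabs (v n t) ^+ (2 * N2) <= e) -> itg 0 (2 * pi) (wt n) <= C ->
  cabs (cint (fun t => (wt n t)%:C%C * (v n t ^+ N1 * ((v n t)^*)%C ^+ N2))) <=
  cabs (corr n (N1 - N2)) + e * C.
Proof.
move=> N12 e0 he hC.
pose q t : Cc R := (1 - cabs (v n t) ^+ (2 * N2))%:C%C.
have bv := cbmeas_cabs (vn_cbmeas avphi n).
have bpow k : bmeas 0 (2 * pi) (fun t => cabs (v n t) ^+ k).
  by apply: bmeas_ext (cbmeas_cabs (vn_pow_cbmeas avphi n k)) => t; rewrite cabsX.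
have bq : bmeas 0 (2 * pi) (fun t => 1 - cabs (v n t) ^+ (2 * N2)).
  by apply: bmeasB; [exact: bmeas_cst|exact: bpow].
have cq : cbmeas q by exact: cbmeas_RC.
have c1 := cbmeasM (cw n) (vn_pow_cbmeas avphi n (N1 - N2)).
have c2 := cbmeasM cq (vn_pow_cbmeas avphi n (N1 - N2)).
have E : cint (fun t => (wt n t)%:C%C * (v n t ^+ N1 * ((v n t)^*)%C ^+ N2)) =
    corr n (N1 - N2) - cint (fun t => (wt n t)%:C%C * (q t * v n t ^+ (N1 - N2))).
  rewrite corrE -cintB //; last exact: cbmeasM.
  apply: cint_eq => t _; rewrite -{1}(subnK N12) exprD -mulrA -exprMn conjE.
  rewrite /q exprM; move: (cabs (v n t) ^+ 2) => y.
  rewrite (_ : (1 - y ^+ N2)%:C%C = 1 - y%:C%C ^+ N2); last by rewrite rmorphB rmorph1 rmorphXn.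
  move: (y%:C%C) ((wt n t)%:C%C) => y' w'; ring.
rewrite E; apply: (le_trans (cabsBD _ _)); rewrite lerD2l.
apply: (le_trans (cint_wt_le hp aphi avphi bT mA n c2)).
apply: (@le_trans _ _ (itg 0 (2 * pi) (fun t => e * wt n t))).
  apply: itg_le; [exact: bmeasM (bw n) (cbmeas_cabs c2)|exact: bmeasZ|].
  move=> t _; rewrite /q cabsM cabs_RC cabsX.
  have v1 : cabs (v n t) <= 1 by rewrite ltW //; exact: vn_lt1.
  have [At|At] := pselect (A t); last first.
    rewrite wtE indicE memNset // !mul0r mulr0 //.
  rewrite mulrC ler_wpM2r //.
  rewrite ger0_norm ?subr_ge0 ?exprn_ile1 ?cabs_ge0 //.
  apply: le_trans (he t At); rewrite ler_piMr ?subr_ge0 ?exprn_ile1 ?cabs_ge0 //.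
by rewrite itgZ // ler_wpM2l.
Qed.

Lemma wt_sqr_step n (u w : R -> Cc R) : cbmeas u -> cbmeas w ->
  itg 0 (2 * pi) (fun t => wt n t * cabs (u t) ^+ 2) +
  itg 0 (2 * pi) (fun t => wt n t * cabs (w t) ^+ 2) -
  2 * cabs (cint (fun t => (wt n t)%:C%C * (w t * ((u t)^*)%C))) <=
  itg 0 (2 * pi) (fun t => wt n t * cabs (u t + w t) ^+ 2).
Proof.
move=> hu hw.
have bsq (y : R -> Cc R) : cbmeas y -> bmeas 0 (2 * pi) (fun t => wt n t * cabs (y t) ^+ 2).
  by move=> hy; have hc := cbmeas_cabs hy; apply: (bmeasM (bw n)); apply: bmeas_ext (bmeasM hc hc) => t.
have cc := cbmeasM (cw n) (cbmeasM hw (cbmeas_conj hu)).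
set I := cint _.
have -> : itg 0 (2 * pi) (fun t => wt n t * cabs (u t + w t) ^+ 2) =
  itg 0 (2 * pi) (fun t => wt n t * cabs (u t) ^+ 2) +
  itg 0 (2 * pi) (fun t => wt n t * cabs (w t) ^+ 2) + 2 * Re I.
  rewrite -itgD; [|exact: bsq..].
  rewrite [Re I]/= -itgZ; last exact: cc.1.
  rewrite -itgD; [|by apply: bmeasD; exact: bsq|by apply: bmeasZ; exact: cc.1].
  apply: itg_eq => t _; rewrite !sqr_cabs.
  by case: (u t) (w t) => [a b] [c d] /=; ring.
have := Re_le I; rewrite ler_norml => /andP[h _]; lra.
Qed.

(** The terms are added one at a time: a new one contributes a diagonal part of at least 3/4 m0
    |x_j|^2, since |v|^(2 N_j) >= 3/4 on A, and meets j earlier terms, each cross product being at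
    most d_j because |x_k| <= 1. *)
Lemma gram_lower n N x (d : nat -> R) L : (forall k, cabs (x k) <= 1) ->
  (forall k, (k < L)%N -> forall t, A t -> 1 - cabs (v n t) ^+ (2 * N k) <= 4^-1) ->
  (forall j k, (k < j)%N -> (j < L)%N ->
    cabs (cint (fun t => (wt n t)%:C%C * (v n t ^+ N j * ((v n t)^*)%C ^+ N k))) <= d j) ->
  3 / 4 * m0 * (\sum_(k < L) cabs (x k) ^+ 2) - \sum_(j < L) 2 * (j%:R * d j) <=
  itg 0 (2 * pi) (fun t => wt n t * cabs (\sum_(k < L) x k * v n t ^+ N k) ^+ 2).
Proof.
move=> x1; elim: L => [|L IH] hdiag hcross.
  rewrite !big_ord0 mulr0 subr0; apply: itg_ge0 => t _; by rewrite mulr_ge0 ?sqr_ge0.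
have {IH} := IH (fun k hk => hdiag k (ltnW hk)) (fun j k hk hj => hcross j k hk (ltnW hj)).
rewrite !big_ord_recr /=.
pose u t := \sum_(k < L) x k * v n t ^+ N k.
pose w t := x L * v n t ^+ N L.
have cu : cbmeas u by apply: cbmeas_sum => k; apply: cbmeasZ; exact: vn_pow_cbmeas.
have cwt : cbmeas w by apply: cbmeasZ; exact: vn_pow_cbmeas.
have := wt_sqr_step n cu cwt.
rewrite (_ : (fun t => wt n t * cabs (\sum_(k < L.+1) _) ^+ 2) =
   fun t => wt n t * cabs (u t + w t) ^+ 2); last first.
  by apply/funext => t; rewrite big_ord_recr.
have hw : 3 / 4 * m0 * cabs (x L) ^+ 2 <= itg 0 (2 * pi) (fun t => wt n t * cabs (w t) ^+ 2).
  apply: (@le_trans _ _ (itg 0 (2 * pi) (fun t => 3 / 4 * cabs (x L) ^+ 2 * wt n t))).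
    have k0 : 0 <= 3 / 4 * cabs (x L) ^+ 2 by rewrite mulr_ge0 ?sqr_ge0 // divr_ge0.
    rewrite itgZ //; have := ler_wpM2l k0 (mass_lower n).
    by rewrite [3 / 4 * m0 * _]mulrAC.
  apply: itg_le; [exact: bmeasZ|have hc := cbmeas_cabs cwt; apply: (bmeasM (bw n)); exact: bmeas_ext (bmeasM hc hc)|].
  move=> t _; rewrite /w cabsM cabsX exprMn -exprM [(N L * 2)%N]mulnC.
  have [At|At] := pselect (A t); last first.
    by rewrite wtE indicE memNset // !mul0r mulr0.
  have h := hdiag L (ltnSn L) t At.
  rewrite [leLHS]mulrC ler_wpM2l // mulrC ler_wpM2l ?sqr_ge0 //.
  move: h; move: (cabs (v n t) ^+ _) => a; lra.
have hcr : cabs (cint (fun t => (wt n t)%:C%C * (w t * ((u t)^*)%C))) <= L%:R * d L.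
  have -> : cint (fun t => (wt n t)%:C%C * (w t * ((u t)^*)%C)) =
    \sum_(k < L) (x L * ((x k)^*)%C) * cint (fun t => (wt n t)%:C%C * (v n t ^+ N L * ((v n t)^*)%C ^+ N k)).
    have ck (k : 'I_L) : cbmeas (fun t => (wt n t)%:C%C * (v n t ^+ N L * ((v n t)^*)%C ^+ N k)).
      apply: cbmeasM => //; apply: cbmeasM; first exact: vn_pow_cbmeas.
      by apply: cbmeasX; apply: cbmeas_conj; exact: vn_cbmeas.
    rewrite (@cint_eq _ _ (fun t => \sum_(k < L) (x L * ((x k)^*)%C) *
       ((wt n t)%:C%C * (v n t ^+ N L * ((v n t)^*)%C ^+ N k)))); last first.
      move=> t _; rewrite /u (conj_sum L (fun k => x k * v n t ^+ N k)) !mulr_sumr; apply: eq_bigr => k _.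
      rewrite conjM conjX /w; set a := (_^*)%C; set b := (_^*)%C; ring.
    rewrite (@cint_sum _ _ _ (fun (k : 'I_L) t => (x L * ((x k)^*)%C) *
       ((wt n t)%:C%C * (v n t ^+ N L * ((v n t)^*)%C ^+ N k)))).
      by apply: eq_bigr => k _; rewrite cintZ.
    by move=> k; apply: cbmeasZ.
  apply: (le_trans (cabs_sum _ _ _)).
  rewrite mulr_natl -[X in _ *+ X]card_ord -sumr_const; apply: ler_sum => k _.
  rewrite cabsM cabsM cabs_conj; apply: le_trans (hcross L k (ltn_ord k) (ltnSn L)).
  by rewrite ler_piMl ?cabs_ge0 // mulr_ile1 ?cabs_ge0.
move: hw hcr; rewrite mulrDr -/(u _).
set a := itg _ _ _; set b := itg _ _ _; set c := cabs (cint _); set e := itg _ _ _.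
set S1 := \sum_(_ < _) _; set S2 := \sum_(_ < _) _ => h1 h2 h3 h4.
have : S2 + 2 * c <= S2 + 2 * (L%:R * d L) by rewrite lerD2l ler_pM2l.
lra.
Qed.

(** One sequence serves all lengths L; only the radius index n depends on L, since finitely many
    conditions along the ultrafilter have a common point. The first exponent M remains free, with
    bounds that do not involve it. *)
Lemma good_exponents : exists Nf : nat -> nat -> nat, forall M, (0 < M)%N ->
  [/\ octlacunary (Nf M), Nf M 0%N = M & forall L, exists n,
    (forall k, (k < L)%N -> forall t, A t -> 1 - cabs (v n t) ^+ (2 * Nf M k) <= 4^-1) /\
    (forall j k, (k < j)%N -> (j < L)%N ->
      cabs (cint (fun t => (wt n t)%:C%C * (v n t ^+ Nf M j * ((v n t)^*)%C ^+ Nf M k))) <=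
      2 * (m0 * 16^-1 ^+ j.+1))].
Proof.
have [C C0 HC] := wt_mass hp aphi avphi selfv bT mA.
have [U [UU sU]] := ultraFilterLemma eventually_filter.
(* The j-th power meets j earlier ones, so its correlations must be summable with weight j and small
   against m0. *)
pose d j : R := m0 * 16^-1 ^+ j.+1.
have d0 j : 0 < d j by rewrite mulr_gt0 // exprn_gt0 // invr_gt0.
have H j : exists n0, forall k, (n0 <= k)%N -> U [set n | cabs (corr n k) <= d j].
  exact: (corr_small hp aphi avphi selfv bT mA UU (d0 j)).
pose n0 j := projT1 (cid (H j)).
have Hn0 j k : (n0 j <= k)%N -> U [set n | cabs (corr n k) <= d j].
  by rewrite /n0; case: (cid (H j)) => /= m; apply.
(* The summand [n0 k] makes every difference N_k - N_i with i < k at least [n0 k]; correlations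
   enter only at such differences. *)
pose Nf M := fix N k := if k is j.+1 then (8 * N j + n0 k)%N else M.
exists Nf => M M0.
have oN : octlacunary (Nf M) by split=> // k; rewrite /= leq_addr.
have mono k i : (Nf M k <= Nf M (k + i))%N.
  elim: i => [|i IH]; first by rewrite addn0.
  rewrite addnS; apply: (leq_trans IH) => /=.
  by apply: leq_trans (leq_addr _ _); rewrite leq_pmull.
have gap j k : (k < j)%N -> (Nf M k + n0 j <= Nf M j)%N.
  case: j => // j; rewrite ltnS => kj /=; rewrite leq_add2r.
  by apply: leq_trans (mono k (j - k)%N) _; rewrite subnKC // leq_pmull.
split=> // L.
(* The mass of the weight is at most C, so the error term of [cross_le] is at most d_j and the cross
   product at most 2 d_j. *)
pose e j := d j / (C + 1).
have C1 : 0 < C + 1 by rewrite ltr_wpDl.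
have e0 j : 0 < e j by rewrite divr_gt0.
have U1 : U [set n | forall k, (k < L)%N -> forall t, A t -> 1 - cabs (v n t) ^+ (2 * Nf M k) <= 4^-1].
  by apply: filter_forall_lt => k _; apply: sU; apply: contact_pow; rewrite invr_gt0.
have U2 : U [set n | forall j, (j < L)%N -> forall k, (k < j)%N ->
    cabs (corr n (Nf M j - Nf M k)) <= d j /\ forall t, A t -> 1 - cabs (v n t) ^+ (2 * Nf M k) <= e j].
  apply: (@filter_forall_lt U (fun j => [set n | forall k, (k < j)%N ->
    cabs (corr n (Nf M j - Nf M k)) <= d j /\ forall t, A t -> 1 - cabs (v n t) ^+ (2 * Nf M k) <= e j])) => j _.
  apply: (@filter_forall_lt U (fun k => [set n |
    cabs (corr n (Nf M j - Nf M k)) <= d j /\ forall t, A t -> 1 - cabs (v n t) ^+ (2 * Nf M k) <= e j])) => k kj.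
  apply: filterI; last by apply: sU; exact: contact_pow.
  by apply: Hn0; rewrite leq_subRL; [exact: gap|apply: leq_trans (gap j k kj); exact: leq_addr].
have [n [h1 h2]] := @filter_ex _ _ _ _ (filterI U1 U2).
exists n; split=> // j k kj jL; have [h3 h4] := h2 j jL k kj.
have kle : (Nf M k <= Nf M j)%N by apply: leq_trans (gap j k kj); exact: leq_addr.
apply: (le_trans (cross_le kle (ltW (e0 j)) h4 (HC n))).
have : e j * C <= d j by rewrite /e -mulrA ler_piMr ?(ltW (d0 j)) // mulrC ler_pdivrMr // mul1r lerDl.
rewrite -/(d j); lra.
Qed.

(** Since 16 = 8 * 2 and j <= 8^j, a geometric series of ratio 1/2 remains. The total m0 / 2 stays
    below the diagonal part 3/4 m0 of a unit vector. *)
Lemma cross_sum_le L : \sum_(j < L) 2 * (j%:R * (2 * (m0 * 16^-1 ^+ j.+1))) <= m0 / 2.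
Proof.
have h2 : 0 <= (2^-1 : R) < 1 by lra.
have e2 : (1 - 2^-1 : R)^-1 = 2 by field.
have G := geom_sum_le L h2; rewrite e2 in G.
apply: (@le_trans _ _ (\sum_(j < L) m0 / 4 * 2^-1 ^+ j)); last first.
  rewrite -mulr_sumr; have := ler_wpM2l (ltW m00) G; lra.
apply: ler_sum => j _.
have -> : 2 * (j%:R * (2 * (m0 * 16^-1 ^+ j.+1))) = m0 / 4 * (j%:R * 16^-1 ^+ j) by rewrite exprS; field.
rewrite ler_wpM2l ?divr_ge0 ?(ltW m00) //.
have -> : (16^-1 : R) = 8^-1 * 2^-1 by field.
rewrite exprMn mulrA ler_piMl ?exprn_ge0 ?invr_ge0 //.
rewrite exprVn ler_pdivrMr ?exprn_gt0 // mul1r -natrX ler_nat.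
by apply: ltnW; apply: ltn_expl.
Qed.

(** The second power is interpolated between the orders p and 3p, one summand for each of the ranges
    y <= a, a < y <= b and y > b. In the last range y^2 <= y^3 / b, and y^3 <= y^(3p) by p >= 1. *)
Lemma pow_interp (a b y : R) : 0 < a -> 1 <= b -> 0 <= y ->
  y ^+ 2 <= a ^+ 2 + b ^+ 2 / a `^ p * y `^ p + b^-1 * y `^ (3 * p).
Proof.
move=> a0 b1 y0; have b0 : 0 < b := lt_le_trans ltr01 b1.
have t2 : 0 <= b ^+ 2 / a `^ p * y `^ p by rewrite mulr_ge0 ?powR_ge0 // divr_ge0 ?sqr_ge0 ?powR_ge0.
have t3 : 0 <= b^-1 * y `^ (3 * p) by rewrite mulr_ge0 ?powR_ge0 // invr_ge0 ltW.
have t1 : 0 <= a ^+ 2 := sqr_ge0 _.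
have [ya|ay] := leP y a.
  have : y ^+ 2 <= a ^+ 2 by rewrite lerXn2r ?nnegrE // ltW.
  lra.
have [yb|by_] := leP y b.
  have : y ^+ 2 <= b ^+ 2 / a `^ p * y `^ p.
    apply: (@le_trans _ _ (b ^+ 2)); first by rewrite lerXn2r ?nnegrE // ltW.
    rewrite -mulrA ler_peMr ?sqr_ge0 // mulrC ler_pdivlMr ?powR_gt0 // mul1r.
    by rewrite ge0_ler_powR ?nnegrE ?(ltW p0) ?(ltW a0) // ltW.
  lra.
have y1 : 1 <= y by rewrite ltW // (le_lt_trans b1).
have : y ^+ 2 <= b^-1 * y `^ (3 * p).
  rewrite mulrC ler_pdivlMr //; apply: (@le_trans _ _ (y `^ 3)).
    by rewrite powR_mulrn // [y ^+ 3]exprSr ler_wpM2l ?sqr_ge0 // ltW.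
  by apply: ler_powR => //; rewrite ler_peMr.
lra.
Qed.

(** Boundedness of T is applied to [cube_prim], whose derivative is g^3: the p-th mean of h (g^3 o
    vphi) dominates the weighted moment of g o vphi of order 3p. *)
Lemma cube_weight : exists2 C : R, 0 <= C & forall N x L n, octlacunary N ->
  (forall k, (L <= k)%N -> x k = 0) -> in_l2 x -> l2_norm x <= 1 ->
  itg 0 (2 * pi) (fun t => wt n t * cabs (gser N x (v n t)) `^ (3 * p)) <= C.
Proof.
have P0 := pi2_gt0 R.
have [K K0 HK] := cube_prim_Sp hp; have [c Hc] := bT.2.
exists (2 `^ p * (2 * pi * (`|c| * K) `^ p + 8 `^ p * (2 * pi * Hp_norm p (derive1 phi) `^ p))).
  by rewrite mulr_ge0 ?powR_ge0 // addr_ge0 ?mulr_ge0 ?powR_ge0 ?(ltW P0) ?pi_ge0.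
move=> N x L n oN hx0 hx x1.
have [hJ nJ] := HK N x L oN hx0 hx x1.
have lN := octlacunary_lacunary oN.
have hB k : cabs (x k) <= 1 := le_trans (l2_coord k hx) x1.
have t0 : (0 : R) <= 8 by [].
have sup z : disk z -> cabs (cube_prim N x L z) <= 8 by move=> hz; exact: cube_prim_sup.
have h1 := lifted_pmean_le hp aphi avphi selfv bT hJ t0 sup (crad_itv0 R n).
have h2 : 2 `^ p * (2 * pi * Sp_norm p (T (cube_prim N x L)) `^ p +
     8 `^ p * (2 * pi * Hp_norm p (derive1 phi) `^ p)) <=
   2 `^ p * (2 * pi * (`|c| * K) `^ p + 8 `^ p * (2 * pi * Hp_norm p (derive1 phi) `^ p)).
  apply: ler_wpM2l; first exact: powR_ge0.
  rewrite lerD2r ler_pM2l // ge0_ler_powR ?nnegrE ?Sp_norm_ge0 ?mulr_ge0 ?(ltW p0) //.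
  apply: (le_trans (Hc _ hJ)).
  apply: (@le_trans _ _ (`|c| * Sp_norm p (cube_prim N x L))).
    by rewrite ler_wpM2r ?Sp_norm_ge0 // ler_norm.
  by rewrite ler_wpM2l.
apply: le_trans (le_trans h1 h2).
have cg : cbmeas (fun t => gser N x (v n t)).
  apply: (@cbmeas_ext _ (fun t => \sum_(k < L) x k * v n t ^+ N k)).
    by move=> t; rewrite (gser_fin N _ hx0).
  by apply: cbmeas_sum => k; apply: cbmeasZ; exact: vn_pow_cbmeas.
have p30 : 0 <= 3 * p by rewrite mulr_ge0 ?(ltW p0).
apply: itg_le.
- by apply: bmeasM => //; exact: bmeas_cabs_powR p30 cg.
- apply: bmeas_cabs_powR (ltW p0) _.
  exact: analytic_cbmeas (lifted_analytic hp aphi avphi selfv bT hJ) (crad_itv0 R n).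
move=> t _; rewrite /lifted -/(v n t) (is_derive_derive1 (cube_prim_is_derive N _ hx0)).
rewrite cabsM cabsX powRM ?exprn_ge0 ?cabs_ge0 // wtE -mulrA.
rewrite -powR_mulrn ?cabs_ge0 // -powRrM.
have /andP[_ h3] := indic01 A t.
by rewrite ler_piMl ?mulr_ge0 ?powR_ge0.
Qed.

(** The weighted second moment is at least 3/4 m0 - m0 / 2 = m0 / 4, and the first and third terms
    of [pow_interp] take at most m0 / 16 each; so the p-th moment keeps m0 / 8. The constant c1 is
    fixed before M, which allows M to be chosen in terms of c1. *)
Lemma powR_lower : exists2 c1 : R, 0 < c1 & exists Nf : nat -> nat -> nat, forall M, (0 < M)%N ->
  [/\ lacunary (Nf M), Nf M 0%N = M & forall x L, (forall k, (L <= k)%N -> x k = 0) ->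
    in_l2 x -> l2_norm x <= 1 -> \sum_(k < L) cabs (x k) ^+ 2 = 1 ->
    exists n, c1 <= itg 0 (2 * pi) (fun t => wt n t * cabs (gser (Nf M) x (v n t)) `^ p)].
Proof.
have [C C0 HC] := wt_mass hp aphi avphi selfv bT mA.
have [C3 C30 HC3] := cube_weight.
have [Nf HN] := good_exponents.
(* Makes a^2 times the mass of the weight at most m0 / 16. *)
pose a := Num.sqrt (m0 / (16 * (C + 1))).
have C1 : 0 < C + 1 by rewrite ltr_wpDl.
have ap : 0 < m0 / (16 * (C + 1)) by rewrite divr_gt0 // mulr_gt0.
have a0 : 0 < a by rewrite sqrtr_gt0.
have a2 : a ^+ 2 * C <= m0 / 16.
  rewrite /a sqr_sqrtr ?(ltW ap) // mulrAC ler_pdivrMr ?mulr_gt0 //.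
  have -> : m0 / 16 * (16 * (C + 1)) = m0 * (C + 1) by field.
  by rewrite ler_wpM2l ?(ltW m00) // lerDl.
(* Makes b^-1 times the moment of order 3p at most m0 / 16. *)
pose b := 1 + C3 * 16 / m0.
have b1 : 1 <= b by rewrite lerDl mulr_ge0 ?mulr_ge0 // invr_ge0 ltW.
have b0 : 0 < b := lt_le_trans ltr01 b1.
have b3 : b^-1 * C3 <= m0 / 16.
  rewrite mulrC ler_pdivrMr // /b mulrDr mulr1.
  have -> : m0 / 16 * (C3 * 16 / m0) = C3 by field; rewrite gt_eqF.
  by rewrite lerDr divr_ge0 // ltW.
have ap0 : 0 < a `^ p := powR_gt0 _ a0.
pose k := b ^+ 2 / a `^ p.
have k0 : 0 < k by rewrite divr_gt0 ?exprn_gt0.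
exists (m0 / 8 / k); first by apply: divr_gt0 => //; apply: divr_gt0.
exists Nf => M M0; have [oN N0 Hn] := HN M M0; have lN := octlacunary_lacunary oN.
split=> // x L hx0 hx x1 xs; have [n [h1 h2]] := Hn L; exists n.
have hB i : cabs (x i) <= 1 := le_trans (l2_coord i hx) x1.
have G := gram_lower hB h1 h2; rewrite xs mulr1 in G.
have S := cross_sum_le L.
have H3 := HC3 (Nf M) x L n oN hx0 hx x1.
have cg : cbmeas (fun t => gser (Nf M) x (v n t)).
  apply: (@cbmeas_ext _ (fun t => \sum_(k < L) x k * v n t ^+ Nf M k)).
    by move=> t; rewrite (gser_fin (Nf M) _ hx0).
  by apply: cbmeas_sum => i; apply: cbmeasZ; exact: vn_pow_cbmeas.
have p30 : 0 <= 3 * p by rewrite mulr_ge0 ?(ltW p0).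
have bg1 := bmeasM (bw n) (bmeas_cabs_powR (ltW p0) cg).
have bg3 := bmeasM (bw n) (bmeas_cabs_powR p30 cg).
have : itg 0 (2 * pi) (fun t => wt n t * cabs (\sum_(k < L) x k * v n t ^+ Nf M k) ^+ 2) <=
  itg 0 (2 * pi) (fun t => a ^+ 2 * wt n t + k * (wt n t * cabs (gser (Nf M) x (v n t)) `^ p) +
    b^-1 * (wt n t * cabs (gser (Nf M) x (v n t)) `^ (3 * p))).
  apply: itg_le.
  - have hc := cbmeas_cabs cg; apply: (bmeasM (bw n)); apply: bmeas_ext (bmeasM hc hc) => t.
    by rewrite (gser_fin (Nf M) _ hx0).
  - by apply: bmeasD; [apply: bmeasD|]; apply: bmeasZ.
  move=> t _; rewrite -(gser_fin (Nf M) _ hx0).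
  have := ler_wpM2l (w0 n t) (pow_interp a0 b1 (cabs_ge0 (gser (Nf M) x (v n t)))).
  rewrite -/k; move: (cabs _ ^+ 2) (cabs _ `^ p) (cabs _ `^ (3 * p)) (a ^+ 2) (b^-1) => y1 y2 y3 y4 y5.
  by move=> h; apply: (le_trans h); rewrite le_eqVlt; apply/orP; left; apply/eqP; ring.
rewrite itgD; [|by apply: bmeasD; exact: bmeasZ|exact: bmeasZ].
rewrite itgD; [|exact: bmeasZ..].
rewrite !itgZ // => H.
have H5 : a ^+ 2 * itg 0 (2 * pi) (wt n) <= m0 / 16.
  by apply: le_trans a2; rewrite ler_wpM2l ?sqr_ge0.
have H6 : b^-1 * itg 0 (2 * pi) (fun t => wt n t * cabs (gser (Nf M) x (v n t)) `^ (3 * p)) <= m0 / 16.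
  by apply: le_trans b3; rewrite ler_wpM2l // invr_ge0 ltW.
rewrite ler_pdivrMr // [leRHS]mulrC.
move: G S H H5 H6; clear; set I1 := itg _ _ _; set I2 := _ * itg _ _ _; set I3 := _ * itg _ _ _.
set I4 := _ * itg _ _ _; set S := \sum_(_ < _) _; lra.
Qed.

Let half_le (X c : R) : c <= X + c / 2 -> c <= X + X.
Proof. lra. Qed.

Let quarter_lt (Y c M : R) : Y * 4 < M * c -> Y * 2 <= c / 2 * M.
Proof. lra. Qed.

Lemma T_lower_fin : exists2 N, lacunary N & exists2 a : R, 0 < a & forall x L,
  (forall k, (L <= k)%N -> x k = 0) -> in_l2 x -> l2_norm x <= 1 ->
  \sum_(k < L) cabs (x k) ^+ 2 = 1 -> a <= Sp_norm p (T (Jmap N x)).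
Proof.
have P0 := pi2_gt0 R.
have [c1 c10 [Nf HN]] := powR_lower.
have [K K0 HK] := Jmap_Sp hp.
have q0 : 0 < 2 `^ p :> R by rewrite powR_gt0.
pose D := 2 * pi * Hp_norm p (derive1 phi) `^ p.
have D0 : 0 <= D by rewrite mulr_ge0 ?(ltW P0) ?powR_ge0.
(* Makes the contribution of phi' at most c1 / 2. The shift by 2 gives M >= 2, so that 2 / M <= 1
   and (2 / M)^p <= 2 / M. *)
pose M := (Num.Def.truncn (2 `^ p * D * 4 / c1)).+2.
have HM : 2 `^ p * D * 4 / c1 < M%:R by apply: lt_le_trans (truncnS_gt _) _; rewrite ler_nat.
have [lN N0 Hx] := HN M isT.
exists (Nf M) => //.
(* The solution of 2^p (2 pi) a^p = c1 / 2, the half of c1 that is left for T (J x). *)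
pose a := (c1 / (2 * (2 `^ p * (2 * pi)))) `^ p^-1.
have b0 : 0 < c1 / (2 * (2 `^ p * (2 * pi))) by apply: divr_gt0 => //; do 2?[apply: mulr_gt0 => //]; apply: mulr_gt0.
have ap : a `^ p = c1 / (2 * (2 `^ p * (2 * pi))).
  by rewrite /a -powRrM mulVf ?lt0r_neq0 // powRr1 // ltW.
exists a => [|x L hx0 hx x1 xs]; first by rewrite powR_gt0.
have [n Hn] := Hx x L hx0 hx x1 xs.
have hB k : cabs (x k) <= 1 := le_trans (l2_coord k hx) x1.
have [hJ _] := HK (Nf M) x lN hx.
have M2 : 2 <= M%:R :> R by rewrite ler_nat.
have Mp : 0 < M%:R :> R by rewrite ltr0n.
have t0 : 0 <= 2 / M%:R :> R by rewrite divr_ge0.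
have sup z : disk z -> cabs (Jmap (Nf M) x z) <= 2 / M%:R.
  by move=> hz; have := Jmap_sup lN hB hz; rewrite mul1r N0.
have h1 := lifted_pmean_le hp aphi avphi selfv bT hJ t0 sup (crad_itv0 R n).
have h2 := wt_lifted_le hp aphi avphi selfv bT mA n lN hx.
have h3 := le_trans (le_trans Hn h2) h1.
have h4 : (2 / M%:R) `^ p <= 2 / M%:R :> R.
  rewrite -[leRHS]powRr1 //; apply: ger_powR => //.
  by rewrite divr_gt0 //= ler_pdivrMr // mul1r.
have h5 : 2 `^ p * ((2 / M%:R) `^ p * D) <= c1 / 2.
  apply: (@le_trans _ _ (2 `^ p * (2 / M%:R * D))).
    by rewrite ler_wpM2l ?(ltW q0) // ler_wpM2r.
  have -> : 2 `^ p * (2 / M%:R * D) = (2 `^ p * D * 2) / M%:R by ring.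
  rewrite ler_pdivrMr //; by apply: quarter_lt; rewrite -ltr_pdivrMr.
have h6 : a `^ p <= Sp_norm p (T (Jmap (Nf M) x)) `^ p.
  rewrite ap ler_pdivrMr ?mulr_gt0 ?pi_gt0 //.
  have h7 : c1 <= 2 `^ p * (2 * pi * Sp_norm p (T (Jmap (Nf M) x)) `^ p) + 2 `^ p * ((2 / M%:R) `^ p * D).
    by rewrite -mulrDr; exact: h3.
  move: h5 h7; set d := _ * (_ * D); set s := Sp_norm _ _ `^ p; set q := 2 `^ p; set P := 2 * pi.
  move=> h5 h7; have h8 : q * (P * s) = s * (q * P) by ring.
  have : c1 <= s * (q * P) + c1 / 2 by rewrite -h8; apply: le_trans h7 _; rewrite lerD2l.
  have -> : s * (2 * (q * P)) = s * (q * P) + s * (q * P) by ring.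
  exact: half_le.
rewrite leNgt; apply/negP => h7; move: h6; rewrite leNgt => /negP; apply.
have := @gt0_ltr_powR _ p p0 _ _ _ _ h7; apply; rewrite nnegrE ?Sp_norm_ge0 //; exact: powR_ge0.
Qed.

End LowerBound.

(** * The fixed copy of the sequence space *)

Section FixedCopy.
Variables (R : realType) (p : R) (hp : 1 <= p) (phi vphi : Cc R -> Cc R).
Hypotheses (aphi : analytic_on_disk phi) (avphi : analytic_on_disk vphi)
  (selfv : self_map_disk vphi) (bT : bounded_on_Sp p (wcomp phi vphi)).
Implicit Types (z w c : Cc R) (f g : Cc R -> Cc R) (x y : nat -> Cc R) (N : nat -> nat).

Local Notation T := (wcomp phi vphi).

Lemma wcomp_lin f g (a b : Cc R) : T (fun z => a * f z + b * g z) = fun z => a * T f z + b * T g z.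
Proof. by apply/funext => z; rewrite /wcomp; ring. Qed.

Lemma l2_norm_fin x L : (forall k, (L <= k)%N -> x k = 0) -> in_l2 x ->
  \sum_(k < L) cabs (x k) ^+ 2 = l2_norm x ^+ 2.
Proof.
move=> x0 hx; apply/le_anti/andP; split; first exact: l2_sum_le.
set S := \sum_(_ < _) _.
have S0 : 0 <= S by apply: sumr_ge0 => i _; rewrite sqr_ge0.
have [||_ h] := @l2_bound _ x (Num.sqrt S); first exact: sqrtr_ge0.
  move=> M; rewrite sqr_sqrtr //.
  have [LM|/ltnW ML] := leqP L M.
    rewrite /S (big_ord_widen M (fun k => cabs (x k) ^+ 2) LM) [leRHS]big_mkcond /=.
    by apply: ler_sum => k _; case: ifP => // /negbT; rewrite -leqNgt => /x0 ->; rewrite cabs0 expr0n.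
  rewrite /S (big_ord_widen L (fun k => cabs (x k) ^+ 2) ML) big_mkcond /=.
  by apply: ler_sum => k _; case: ifP => // _; rewrite sqr_ge0.
by rewrite -[leRHS]sqr_sqrtr // lerXn2r ?nnegrE ?sqrtr_ge0 ?l2_norm_ge0.
Qed.

Lemma Sp_sub f g : in_Sp p f -> in_Sp p g -> in_Sp p (fun z => 1 * f z + (-1) * g z) /\
  Sp_norm p (fun z => 1 * f z + (-1) * g z) <= 4 * (Sp_norm p f + Sp_norm p g).
Proof.
move=> hf hg; have [h1 h2] := Sp_lin hp 1 (-1) hf hg; split; first exact: h1.
apply: (le_trans h2); move: (Sp_norm p f) (Sp_norm p g) => a b.
by rewrite cabsN cabs1 !mul1r.
Qed.

Let T_lower_arith (a k u w s s' s'' e : R) : a * w <= 4 * s' -> s' <= 4 * (s + s'') -> s'' <= k * e ->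
  a * u <= a * (2 * (w + e)) -> a * u <= 32 * s + (2 * a + 32 * k) * e.
Proof. lra. Qed.

Let sqr_sum_le (a b d : R) : a <= b + d -> 0 <= a -> 0 <= b -> 0 <= d -> a ^+ 2 <= 2 * b ^+ 2 + 2 * d ^+ 2.
Proof. by move=> h1 h2 h3 h4; have := sqr_ge0 (b - d); have := lerXn2r 2 (x := a) (y := b + d); rewrite !nnegrE; nra. Qed.

(** Homogeneity removes the normalization of x. A general x is split into a finite head and a tail
    of norm at most e, and the image of the tail is controlled by the boundedness of T and of the
    embedding. *)
Lemma T_lower : (0 < lebesgue_measure (E_set vphi))%E ->
  (exists2 z, disk z & symbol phi vphi z != 0) ->
  exists2 N, lacunary N & exists2 a : R, 0 < a & forall x, in_l2 x ->
    a * l2_norm x <= Sp_norm p (T (Jmap N x)).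
Proof.
move=> HE [z1 dz1 hz1].
have [A [mA A0 contactA]] := contact_set avphi selfv HE.
have [m0 m00 mass_lower] := wt_mass_lower hp aphi avphi selfv bT mA dz1 hz1 A0.
have [N lN [a a0 Ha]] := T_lower_fin hp aphi avphi selfv bT mA contactA m00 mass_lower.
have [K K0 HK] := Jmap_Sp hp; have [c Hc] := bT.2.
exists N => //.
have fin x L : (forall k, (L <= k)%N -> x k = 0) -> in_l2 x ->
    a * l2_norm x <= 4 * Sp_norm p (T (Jmap N x)).
  move=> hx0 hx; have [hJ _] := HK N x lN hx.
  have [->|s0] := eqVneq (l2_norm x) 0; first by rewrite mulr0 mulr_ge0 ?Sp_norm_ge0.
  set s := l2_norm x in s0 *.
  have sp : 0 < s by rewrite lt_def s0 l2_norm_ge0.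
  (* The null summand puts the scalar multiple into the two-term form for which linearity of the
     embedding is stated. *)
  pose y k : Cc R := (s^-1)%:C%C * x k + 0 * x k.
  have cy k : cabs (y k) = s^-1 * cabs (x k).
    by rewrite /y mul0r addr0 cabsM cabs_RC ger0_norm // invr_ge0 ltW.
  have ys M : \sum_(k < M) cabs (y k) ^+ 2 = s^-1 ^+ 2 * \sum_(k < M) cabs (x k) ^+ 2.
    by rewrite mulr_sumr; apply: eq_bigr => k _; rewrite cy exprMn.
  have ss : s^-1 ^+ 2 * s ^+ 2 = 1 by rewrite -exprMn mulVf // expr1n.
  have yle M : \sum_(k < M) cabs (y k) ^+ 2 <= 1 ^+ 2.
    by rewrite ys expr1n -ss ler_wpM2l ?sqr_ge0 // l2_sum_le.
  have [hy y1] := l2_bound ler01 yle.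
  have hy0 k : (L <= k)%N -> y k = 0 by rewrite /y => /hx0 ->; rewrite !mulr0 addr0.
  have ys1 : \sum_(k < L) cabs (y k) ^+ 2 = 1 by rewrite ys (l2_norm_fin hx0 hx).
  have h1 := Ha y L hy0 hy y1 ys1.
  have E : T (Jmap N y) = fun z => (s^-1)%:C%C * T (Jmap N x) z + 0 * T (Jmap N x) z.
    by rewrite /y (Jmap_lin _ _ lN hx hx) wcomp_lin.
  have hT := bT.1 _ hJ.
  have [_ h2] := Sp_lin hp (s^-1)%:C%C 0 hT hT.
  rewrite E in h1; have := le_trans h1 h2.
  rewrite cabs0 mul0r addr0 cabs_RC ger0_norm ?invr_ge0 ?(ltW sp) //.
  by rewrite mulrCA mulrC ler_pdivlMr.
(* 32 = 2 * 4 * 4: the factor 2 of [l2_lin] for head plus tail, 4 from homogeneity in [fin], and 4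
   from subtracting the image of the tail. *)
exists (a / 32); first by rewrite divr_gt0.
move=> x hx; have [hJ _] := HK N x lN hx.
pose B := 2 * a + 32 * (`|c| * K).
have B0 : 0 < B by rewrite ltr_wpDr ?mulr_ge0 ?mulr_gt0 ?(ltW K0).
suff H e : 0 < e -> a * l2_norm x <= 32 * Sp_norm p (T (Jmap N x)) + B * e.
  rewrite mulrAC ler_pdivrMr // mulrC [leRHS]mulrC; apply/ler_addgt0Pr => e e0.
  by rewrite mulrC -[e](@mulfVK _ B) ?lt0r_neq0 // [e / B * B]mulrC; apply: H; rewrite divr_gt0.
move=> e0; have [L [ht te]] := tail_l2 hx e0.
have [hh _] := head_l2 L hx.
have hfin : forall k, (L <= k)%N -> headseq L x k = 0.
  by move=> k; rewrite /headseq ltnNge => ->.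
have F := fin _ _ hfin hh.
have [hJt nJt] := HK N _ lN ht.
have Eh : headseq L x = fun k => 1 * x k + (-1) * tailseq L x k.
  apply/funext => k; rewrite /headseq /tailseq; case: ifP => _.
    by rewrite mulr0 addr0 mul1r.
  by rewrite mulN1r mul1r subrr.
have ET : T (Jmap N (headseq L x)) =
    fun z => 1 * T (Jmap N x) z + (-1) * T (Jmap N (tailseq L x)) z.
  by rewrite Eh (Jmap_lin _ _ lN hx ht) wcomp_lin.
have [_ h1] := Sp_sub (bT.1 _ hJ) (bT.1 _ hJt); rewrite -ET in h1.
have h2 : Sp_norm p (T (Jmap N (tailseq L x))) <= `|c| * K * e.
  apply: (le_trans (Hc _ hJt)).
  apply: (@le_trans _ _ (`|c| * Sp_norm p (Jmap N (tailseq L x)))).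
    by rewrite ler_wpM2r ?Sp_norm_ge0 // ler_norm.
  by rewrite -mulrA ler_wpM2l //; apply: (le_trans nJt); rewrite ler_wpM2l // ltW.
have h3 : l2_norm x <= 2 * (l2_norm (headseq L x) + e).
  have [_] := l2_lin 1 1 hh ht; rewrite -head_tail cabs1 !mul1r => h.
  by apply: (le_trans h); rewrite ler_pM2l // lerD2l.
have h4 := ler_wpM2l (ltW a0) h3.
rewrite /B; exact: (T_lower_arith F h1 h2 h4).
Qed.

Lemma real_cauchy (u : nat -> R) : (forall e : R, 0 < e -> exists n0, forall n m,
  (n0 <= n)%N -> (n0 <= m)%N -> `|u n - u m| <= e) ->
  exists l : R, forall e : R, 0 < e -> exists n0, forall n, (n0 <= n)%N -> `|u n - l| < e.
Proof.
move=> H.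
have cu : cvg (u @ \oo).
  apply: cauchy_cvg; apply: cauchy_exP => e e0.
  have e2 : 0 < e / 2 by rewrite divr_gt0.
  have [n0 Hn] := H _ e2; exists (u n0); exists n0 => // n /= hn.
  rewrite /ball /=; apply: le_lt_trans (Hn n0 n (leqnn _) hn) _.
  by rewrite ltr_pdivrMr // ltr_pMr // ltr1n.
exists (limn u) => e e0; have /cvgrPdist_lt/(_ e e0)[n0 _ Hn] : u @ \oo --> limn u := cu.
by exists n0 => n /Hn /=; rewrite distrC.
Qed.

Lemma complex_cauchy (u : nat -> Cc R) : (forall e : R, 0 < e -> exists n0, forall n m,
  (n0 <= n)%N -> (n0 <= m)%N -> cabs (u n - u m) <= e) -> exists l, ccvg u l.
Proof.
move=> H.
have [a Ha] : exists l : R, forall e : R, 0 < e -> exists n0, forall n, (n0 <= n)%N -> `|Re (u n) - l| < e.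
  apply: real_cauchy => e e0; have [n0 Hn] := H e e0; exists n0 => n m hn hm.
  by apply: le_trans (Hn n m hn hm); apply: le_trans (Re_le _); case: (u n) (u m) => [? ?] [? ?].
have [b Hb] : exists l : R, forall e : R, 0 < e -> exists n0, forall n, (n0 <= n)%N -> `|Im (u n) - l| < e.
  apply: real_cauchy => e e0; have [n0 Hn] := H e e0; exists n0 => n m hn hm.
  by apply: le_trans (Hn n m hn hm); apply: le_trans (Im_le _); case: (u n) (u m) => [? ?] [? ?].
exists (Complex a b) => e e0; have e2 : 0 < e / 2 by rewrite divr_gt0.
have [n1 H1] := Ha _ e2; have [n2 H2] := Hb _ e2.
exists (n1 + n2)%N => n hn; apply: le_lt_trans (cabs_le _) _.
have h1 := H1 n (leq_trans (leq_addr _ _) hn); have h2 := H2 n (leq_trans (leq_addl _ _) hn).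
rewrite [e]splitr; apply: ltrD.
  by apply: le_lt_trans h1; case: (u n) => [? ?].
by apply: le_lt_trans h2; case: (u n) => [? ?].
Qed.

(** The limit is taken coordinatewise; each partial square sum of xs n - y is compared with that of
    xs n - xs m for a late m. *)
Lemma l2_complete (xs : nat -> nat -> Cc R) : (forall n, in_l2 (xs n)) ->
  (forall e : R, 0 < e -> exists n0, forall n m, (n0 <= n)%N -> (n0 <= m)%N ->
    l2_norm (fun k => 1 * xs n k + (-1) * xs m k) <= e) ->
  exists2 y, in_l2 y & forall e : R, 0 < e -> exists n0, forall n, (n0 <= n)%N ->
    in_l2 (fun k => 1 * xs n k + (-1) * y k) /\ l2_norm (fun k => 1 * xs n k + (-1) * y k) <= e.
Proof.
move=> hxs HC.
have hd n m := (l2_lin 1 (-1) (hxs n) (hxs m)).1.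
have coord n m k : cabs (xs n k - xs m k) <= l2_norm (fun k => 1 * xs n k + (-1) * xs m k).
  by have := l2_coord k (hd n m); rewrite mul1r mulN1r.
have lim k : exists l, ccvg (fun n => xs n k) l.
  apply: complex_cauchy => e e0; have [n0 Hn] := HC e e0.
  by exists n0 => n m hn hm; apply: le_trans (coord n m k) (Hn n m hn hm).
pose y k := projT1 (cid (lim k)).
have hy k : ccvg (fun n => xs n k) (y k) by rewrite /y; case: (cid (lim k)).
have unif (e : R) : 0 < e -> exists n0, forall n k, (n0 <= n)%N -> cabs (xs n k - y k) <= e.
  move=> e0; have [n0 Hn] := HC e e0; exists n0 => n k hn; rewrite cabsB.
  apply: (ccvg_le (L0 := n0) (hy k)) => m hm; rewrite cabsB.
  exact: le_trans (coord n m k) (Hn n m hn hm).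
have main (e : R) : 0 < e -> exists n0, forall n, (n0 <= n)%N ->
    in_l2 (fun k => 1 * xs n k + (-1) * y k) /\ l2_norm (fun k => 1 * xs n k + (-1) * y k) <= e.
  move=> e0; have e2 : 0 < e / 2 by rewrite divr_gt0.
  have [n0 Hn] := HC _ e2; exists n0 => n hn; apply: l2_bound; first exact: ltW.
  (* The index m may depend on L: when each coordinate of xs m is within e / (2 (L + 1)) of y, the L
     errors have square sum at most (e / 2)^2, and (u + v)^2 <= 2 u^2 + 2 v^2 gives e^2 in total. *)
  move=> L; have d0 : 0 < e / 2 / L.+1%:R by rewrite divr_gt0.
  have [n1 H1] := unif _ d0.
  pose m := (n0 + n1)%N.
  have hm := Hn n m hn (leq_addr _ _).
  apply: (@le_trans _ _ (\sum_(k < L) (2 * cabs (1 * xs n k + (-1) * xs m k) ^+ 2 +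
     2 * (e / 2 / L.+1%:R) ^+ 2))).
    apply: ler_sum => k _; have h1 := H1 m k (leq_addl _ _).
    rewrite !mul1r !mulN1r.
    have h2 : cabs (xs n k - y k) <= cabs (xs n k - xs m k) + e / 2 / L.+1%:R.
      rewrite (_ : xs n k - y k = (xs n k - xs m k) + (xs m k - y k)); last by ring.
      by apply: le_trans (cabsD _ _) _; rewrite lerD2l.
    move: h2 (cabs_ge0 (xs n k - y k)) (cabs_ge0 (xs n k - xs m k)) (ltW d0).
    exact: sqr_sum_le.
  rewrite big_split /= -mulr_sumr sumr_const card_ord -[X in _ + X]mulr_natl.
  have h3 := le_trans (l2_sum_le L (hd n m)) _.
  have h4 : \sum_(k < L) cabs (1 * xs n k + (-1) * xs m k) ^+ 2 <= (e / 2) ^+ 2.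
    by apply: h3; rewrite lerXn2r ?nnegrE ?l2_norm_ge0 ?(ltW e2).
  have h5 : L%:R * (2 * (e / 2 / L.+1%:R) ^+ 2) <= 2 * (e / 2) ^+ 2.
    rewrite mulrCA ler_pM2l // exprMn mulrCA ler_piMr ?sqr_ge0 //.
    rewrite exprVn ler_pdivrMr ?exprn_gt0 // mul1r expr2 -natrM ler_nat.
    by apply: leq_trans (leqnSn L) _; rewrite leq_pmulr.
  have -> : e ^+ 2 = 2 * (e / 2) ^+ 2 + 2 * (e / 2) ^+ 2 by field.
  by apply: lerD; [rewrite ler_pM2l|exact: h5].
exists y => //.
have [n0 Hn] := main 1 ltr01; have [h1 _] := Hn n0 (leqnn _).
have [h2 _] := l2_lin 1 (-1) (hxs n0) h1.
congr in_l2: h2; apply/funext => k; ring.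
Qed.

(** The subspace is the range of J. For its closedness, the lower bound on J turns convergence in
    S^p into a Cauchy condition on the coefficient sequences; the image of their limit has distance
    0 from the given limit, hence agrees with it on the disk. *)
Lemma fixes_copy : (0 < lebesgue_measure (E_set vphi))%E ->
  (exists2 z, disk z & symbol phi vphi z != 0) -> fixes_copy_of_l2 p T.
Proof.
move=> HE Hz; have [N lN [a a0 Ha]] := T_lower HE Hz.
have [K K0 HK] := Jmap_Sp hp; have [c Hc] := bT.2.
have q4 : 0 <= 4 :> R by [].
pose J := Jmap (R := R) N.
have JS x : in_l2 x -> in_Sp p (J x) by move=> /(HK N x lN)[].
have JK x : in_l2 x -> Sp_norm p (J x) <= K * l2_norm x by move=> /(HK N x lN)[].
have c1 : 0 < `|c| + 1 by rewrite ltr_wpDl.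
(* The lower bound for J itself comes from the one for T J and the boundedness of T: a |x| <= |T (J
   x)| <= c |J x|. Adding 1 keeps the denominator positive. *)
pose b := a / (`|c| + 1).
have b0 : 0 < b by rewrite divr_gt0.
have Jb x : in_l2 x -> b * l2_norm x <= Sp_norm p (J x).
  move=> hx; rewrite mulrAC ler_pdivrMr // [leRHS]mulrC; apply: (le_trans (Ha x hx)).
  apply: (le_trans (Hc _ (JS x hx))); rewrite ler_wpM2r ?Sp_norm_ge0 //.
  by apply: (le_trans (ler_norm c)); rewrite lerDl.
have Jlin x y (s t : Cc R) : in_l2 x -> in_l2 y ->
    J (fun k => s * x k + t * y k) = (fun z => s * J x z + t * J y z).
  by move=> hx hy; exact: Jmap_lin.
exists [set f | exists2 x, in_l2 x & J x = f], J; split.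
- by move=> f [x hx <-]; exact: JS.
- move=> f g s t [x hx <-] [y hy <-]; exists (fun k => s * x k + t * y k); first exact: (l2_lin _ _ hx hy).1.
  exact: Jlin.
- move=> u g uM hg ucv.
  pose xs n := projT1 (cid2 (uM n)).
  have hxs n : in_l2 (xs n) by rewrite /xs; case: (cid2 (uM n)).
  have Jxs n : J (xs n) = u n by rewrite /xs; case: (cid2 (uM n)).
  have near0 (e : R) : 0 < e -> exists n0, forall n, (n0 <= n)%N ->
      Sp_norm p (fun z => u n z - g z) <= e.
    move=> e0; have /cvgrPdist_lt/(_ e e0)[n0 _ Hn] := ucv.
    exists n0 => n /Hn /=; rewrite sub0r normrN => h; apply: ltW; apply: le_lt_trans h; exact: ler_norm.
  have hug n : in_Sp p (fun z => u n z - g z).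
    have hu : in_Sp p (u n) by rewrite -Jxs; exact: JS.
    have [h _] := Sp_sub hu hg.
    by move: h; congr in_Sp; apply/funext => z; rewrite mul1r mulN1r.
  have [y hy Hy] : exists2 y, in_l2 y & forall e : R, 0 < e -> exists n0, forall n, (n0 <= n)%N ->
    in_l2 (fun k => 1 * xs n k + (-1) * y k) /\ l2_norm (fun k => 1 * xs n k + (-1) * y k) <= e.
    apply: l2_complete => // e e0.
    have d0 : 0 < b * e / 8 by rewrite divr_gt0 // mulr_gt0.
    have [n0 Hn] := near0 _ d0; exists n0 => n m hn hm.
    have h1 := Jb _ (l2_lin 1 (-1) (hxs n) (hxs m)).1.
    have [_ h2] := Sp_sub (hug n) (hug m).
    rewrite -(ler_pM2l b0); apply: (le_trans h1).
    rewrite (Jlin _ _ _ _ (hxs n) (hxs m)) !Jxs.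
    have E : (fun z => 1 * u n z + -1 * u m z) = fun z => 1 * (u n z - g z) + -1 * (u m z - g z).
      by apply/funext => z; ring.
    rewrite E; apply: (le_trans h2).
    have h3 := Hn n hn; have h4 := Hn m hm.
    apply: (@le_trans _ _ (4 * (b * e / 8 + b * e / 8))); first exact: (ler_wpM2l q4 (lerD h3 h4)).
    by rewrite le_eqVlt; apply/orP; left; apply/eqP; field.
  exists (J y); first by exists y.
  have [hd _] := Sp_sub (JS y hy) hg.
  have Z : Sp_norm p (fun z => 1 * J y z + -1 * g z) = 0.
    apply/le_anti/andP; split; last exact: Sp_norm_ge0.
    apply/ler_addgt0Pr => e e0; rewrite add0r.
    have d0 : 0 < e / 8 by rewrite divr_gt0.
    have d1 : 0 < e / 8 / K by rewrite divr_gt0.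
    have [n0 Hn] := near0 _ d0; have [n1 Hn1] := Hy _ d1.
    pose n := (n0 + n1)%N.
    have h1 := Hn n (leq_addr _ _); have [h2 h3] := Hn1 n (leq_addl _ _).
    have [_ h4] := Sp_sub (hug n) (JS _ h2).
    have E : (fun z => 1 * J y z + -1 * g z) =
       fun z => 1 * (u n z - g z) + -1 * J (fun k => 1 * xs n k + (-1) * y k) z.
      by apply/funext => z; rewrite (Jlin _ _ _ _ (hxs n) hy) Jxs; ring.
    rewrite E; apply: (le_trans h4).
    apply: (@le_trans _ _ (4 * (e / 8 + e / 8))).
      apply: (ler_wpM2l q4); apply: (lerD h1); apply: (le_trans (JK _ h2)).
      by rewrite mulrC -ler_pdivlMr.
    by rewrite le_eqVlt; apply/orP; left; apply/eqP; field.
  move=> z hz; have := Sp_norm_eq0 hp hd Z hz.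
  by rewrite mul1r mulN1r => /eqP; rewrite subr_eq0 => /eqP.
- split.
  + by move=> x hx; exists x.
  + by move=> f [x hx <-]; exists x.
  (* J (x - y) is identified with the image of a null combination; the upper bound makes that image
     have norm 0, and the lower bound then gives x = y coordinatewise. *)
  + move=> x y hx hy E.
    have hd := (l2_lin 1 (-1) hx hy).1.
    have [h0 n0] := l2_lin 0 0 hx hx.
    have Z : J (fun k => 1 * x k + -1 * y k) = J (fun k => 0 * x k + 0 * x k).
      by rewrite (Jlin _ _ _ _ hx hy) (Jlin _ _ _ _ hx hx) E; apply/funext => z; ring.
    have h1 := Jb _ hd; rewrite Z in h1.
    have h2 : l2_norm (fun k => 1 * x k + -1 * y k) <= 0.
      rewrite -(ler_pM2l b0) mulr0; apply: (le_trans h1); apply: (le_trans (JK _ h0)).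
      by move: n0; rewrite cabs0 !mul0r addr0 mulr0 => n0; rewrite pmulr_rle0.
    apply/funext => k; have := le_trans (l2_coord k hd) h2.
    rewrite mul1r mulN1r => h3; apply/eqP; rewrite -subr_eq0; apply/eqP/cabs_eq0.
    by apply/le_anti; rewrite h3 cabs_ge0.
  + by move=> x y s t hx hy; exact: Jlin.
  + by exists b, K; split=> //; split=> // x hx; split; [exact: Jb|exact: JK].
exists (a / K) => [|f [x hx <-]]; first by rewrite divr_gt0.
apply: le_trans (Ha x hx); rewrite mulrAC ler_pdivrMr // -mulrA ler_pM2l // mulrC.
exact: JK.
Qed.

End FixedCopy.

Theorem theorem3 (R : realType) (p : R) (phi vphi : Cc R -> Cc R) :
  1 <= p ->
  analytic_on_disk phi ->
  analytic_on_disk vphi -> self_map_disk vphi ->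
  bounded_on_Sp p (wcomp phi vphi) ->
  (0 < lebesgue_measure (E_set vphi))%E ->
  (exists2 z, disk z & phi z * derive1 vphi z != 0) ->
  fixes_copy_of_l2 p (wcomp phi vphi).
Proof.
move=> hp aphi avphi selfv bT HE [z dz hz].
by apply: (fixes_copy hp aphi avphi selfv bT HE); exists z.
Qed.
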